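(* Let $\rho:\Gamma\to GL_4(\mathbb{C})$ be a $T$-determined, $T$-unitarizable representation, $\upsilon$ a multiplier system with cusp parameter $m$, and let $k_0$, $k_1=k_0+1$, $F_1$ and $\rho_1$ be as in the context. Let $G$ be a nonzero element of $\mathcal{H}(k_1,\rho_1,\upsilon)$. Then: (i) $\mathcal{H}(\rho_1,\upsilon)$ is a free $\mathcal{M}$-module of rank four with basis $\{G,DG,F_1,D^2G\}$; (ii) for all integers $k\ge0$, $\dim\mathcal{H}(k_1+2k,\rho_1,\upsilon)=\left[\frac{2k+1}{3}\right]+1$.
   Context: $\Gamma=SL(2,\mathbb{Z})$ acts on the upper half-plane $\mathbb{H}$ by Möbius transformations; $T=\begin{pmatrix}1&1\\0&1\end{pmatrix}$; $q=e^{2\pi iz}$, $\mathbf{e}(r)=e^{2\pi ir}$; $[x]$ is the greatest integer $\le x$; $\delta_{i,j}$ is the Kronecker delta. Complex powers use the principal branch of $\log$. For $k\in\mathbb{R}$, a multiplier system of weight $k$ is a map $\upsilon:\Gamma\to\{|w|=1\}$ such that $\nu(\gamma,z)=\upsilon(\gamma)(cz+d)^k$ satisfies $\nu(\gamma\sigma,z)=\nu(\gamma,\sigma z)\nu(\sigma,z)$; it is also one of weight $k+n$, $n\in\mathbb{Z}$. Cusp parameter: the $m\in[0,12)$ with $\upsilon(T)=\mathbf{e}(m/12)$. Slash: $(f|_k^\upsilon\gamma)(z)=\upsilon(\gamma)^{-1}(cz+d)^{-k}f(\gamma z)$. Moderate growth: $|f(x+iy)|\le y^N$ for $y>c$. $\mathcal{H}(k,\rho,\upsilon)$: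 column vectors $F$ of holomorphic moderate-growth functions on $\mathbb{H}$ with $F|_k^\upsilon\gamma=\rho(\gamma)F$ for all $\gamma$; $\mathcal{H}(\rho,\upsilon)=\bigoplus_{n\in\mathbb{Z}}\mathcal{H}(k+n,\rho,\upsilon)$. $\mathcal{M}=\mathbb{C}[E_4,E_6]$ is the graded ring of holomorphic integral-weight modular forms for $\Gamma$ with trivial multiplier, acting by multiplication. $T$-unitarizable: $\rho(T)$ conjugate to a unitary matrix. An irreducible $\rho$ of dimension $d$ is $T$-determined if every indecomposable $\rho':\Gamma\to GL_d(\mathbb{C})$ with $\rho'(T)$ having the same eigenvalues as $\rho(T)$ is irreducible. $\eta=q^{1/24}\prod_{n\ge1}(1-q^n)$, $P=\frac{i}{\pi}\frac{\eta'}{\eta}$, $D_kf=\frac{1}{2\pi i}\frac{df}{dz}+kPf$; $D$ acts on $\mathcal{H}(k,\rho,\upsilon)$ componentwise as $D_k$, $D^n=D_{k+2(n-1)}\circ\cdots\circ D_k$. An MLDE of order $n$ in weight $k$ is $D_k^nf+M_4D_k^{n-2}f+\cdots+M_{2n}f=0$, $M_{2j}\in\mathcal{M}_{2j}$; rewriting it as $q^n\frac{d^nf}{dq^n}+\sum_{j<n}q^jg_j(q)\frac{d^jf}{dq^j}=0$ with $g_j$ holomorphic at $0$, its indicial roots are the roots of $r(r-1)\cdots(r-n+1)+\sum_{j<n}g_j(0)r(r-1)\cdots(r-j+1)$. Setting: write the (distinct) eigenvalues of $\rho(T)$ as $\mathbf{e}(r_1),\dots,\mathbf{e}(r_4)$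 with $0\le r_1<\dots<r_4<1$; let $\lambda_j\in[0,1)$ with $\lambda_j\equiv r_j+\frac{m}{12}\pmod{\mathbb{Z}}$, $\lambda_0=\sum_j\lambda_j$, $k_0=3\lambda_0-3$, $k_1=k_0+1$. Fix $i\in\{1,2,3,4\}$ with $\lambda_i\neq\frac{k_1}{12}$. Let $L[f]=0$ be the unique fourth order MLDE (in weight $k_0+3$) with indicial roots $\lambda_j+\delta_{i,j}$, $j=1,\dots,4$; it has a fundamental system $f_j=q^{\lambda_j+\delta_{i,j}}(1+\sum_{n\ge1}b_j(n)q^n)$. Put $F_1=(f_1,\dots,f_4)^t$ and let $\rho_1:\Gamma\to GL_4(\mathbb{C})$ be the representation with $F_1|_{k_0+3}^\upsilon\gamma=\rho_1(\gamma)F_1$ for all $\gamma$. *)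

(* Defs.v *)
(* Complex numbers are C := R[i]
   (mathcomp-real-closed "complex") over Stdlib's reals R (a realType). *)
From mathcomp Require Import all_boot all_order all_algebra.
From mathcomp Require Import all_classical all_reals all_analysis.
From mathcomp Require Import complex.
From mathcomp Require Import Rstruct Rstruct_topology.
Set Implicit Arguments. Unset Strict Implicit. Unset Printing Implicit Defensive.
Import Order.TTheory GRing.Theory Num.Theory numFieldNormedType.Exports.
Local Open Scope ring_scope.
Local Open Scope classical_set_scope.

Notation R := Rdefinitions.R.
Definition C : Type := (Rdefinitions.R)[i]%C.
Definition rC (x : R) : C := (x%:C)%C.
Definition iC : C := ('i)%C.
Definition ReC (z : C) : R := complex.Re z.
Definition ImC (z : C) : R := complex.Im z.

(* the upper half-plane *)
Definition Hp (z : C) : Prop := 0 < ImC z.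

(* complex exponential, e(r) = exp(2 pi i r) *)
Definition cexp (z : C) : C :=
  rC (expR (ReC z)) * (rC (cos (ImC z)) + iC * rC (sin (ImC z))).
Definition ee (r : C) : C := cexp (rC (2 * pi) * iC * r).

(* principal argument in (-pi, pi] and principal logarithm *)
Definition Arg (w : C) : R :=
  let x := ReC w in let y := ImC w in
  if 0 < x then atan (y / x)
  else if x < 0 then (if 0 <= y then atan (y / x) + pi else atan (y / x) - pi)
  else if 0 < y then pi / 2 else if y < 0 then - (pi / 2) else 0.
Definition Logc (w : C) : C :=
  rC (ln (Num.sqrt (ReC w ^+ 2 + ImC w ^+ 2))) + iC * rC (Arg w).
(* complex power w^s, s real, principal branch (w <> 0) *)
Definition cpow (w : C) (s : R) : C := if w == 0 then 0 else cexp (rC s * Logc w).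

(* Gamma = SL(2,Z), elements represented as integer 2x2 matrices of det 1 *)
Definition SL2 (g : 'M[int]_2) : Prop := \det g = 1.
Definition ga (g : 'M[int]_2) : C := (g 0 0)%:~R.
Definition gb (g : 'M[int]_2) : C := (g 0 1)%:~R.
Definition gc (g : 'M[int]_2) : C := (g 1 0)%:~R.
Definition gd (g : 'M[int]_2) : C := (g 1 1)%:~R.
Definition jac (g : 'M[int]_2) (z : C) : C := gc g * z + gd g.
Definition mob (g : 'M[int]_2) (z : C) : C := (ga g * z + gb g) / jac g z.
Definition Tm : 'M[int]_2 := \matrix_(i < 2, j < 2) (if (i == 1) && (j == 0) then 0 else 1).

(* multiplier systems of weight k *)
Definition nu (k : R) (v : 'M[int]_2 -> C) (g : 'M[int]_2) (z : C) : C :=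
  v g * cpow (jac g z) k.
Definition is_multiplier (k : R) (v : 'M[int]_2 -> C) : Prop :=
  (forall g, SL2 g -> `|v g| = 1) /\
  (forall g s z, SL2 g -> SL2 s -> Hp z ->
     nu k v (g *m s) z = nu k v g (mob s z) * nu k v s z).
(* cusp parameter m in [0,12) with v(T) = e(m/12) *)
Definition cusp_parameter (v : 'M[int]_2 -> C) (m : R) : Prop :=
  0 <= m < 12 /\ v Tm = ee (rC (m / 12)).

(* representations Gamma -> GL_n(C) *)
Definition is_rep n (rho : 'M[int]_2 -> 'M[C]_n) : Prop :=
  (forall g, SL2 g -> rho g \in unitmx) /\
  (forall g h, SL2 g -> SL2 h -> rho (g *m h) = rho g *m rho h).
(* invariant subspaces of C^n (column vectors), encoded as row spaces of
   matrices whose rows are the transposes of the vectors *)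
Definition stable n (rho : 'M[int]_2 -> 'M[C]_n) (U : 'M[C]_n) : Prop :=
  forall g, SL2 g -> (U *m (rho g)^T <= U)%MS.
Definition irreducible_rep n (rho : 'M[int]_2 -> 'M[C]_n) : Prop :=
  (0 < n)%N /\ forall U : 'M[C]_n, stable rho U -> U = 0 \/ row_full U.
Definition decomposable_rep n (rho : 'M[int]_2 -> 'M[C]_n) : Prop :=
  exists U V : 'M[C]_n, [/\ U != 0, V != 0, stable rho U, stable rho V &
    ((U :&: V)%MS == 0) && (U + V == 1%:M)%MS].
Definition indecomposable_rep n (rho : 'M[int]_2 -> 'M[C]_n) : Prop :=
  (0 < n)%N /\ ~ decomposable_rep rho.
Definition T_determined n (rho : 'M[int]_2 -> 'M[C]_n) : Prop :=
  irreducible_rep rho /\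
  forall rho' : 'M[int]_2 -> 'M[C]_n, is_rep rho' -> indecomposable_rep rho' ->
    (forall a, eigenvalue (rho' Tm) a = eigenvalue (rho Tm) a) ->
    irreducible_rep rho'.
Definition unitary_mx n (U : 'M[C]_n) : Prop :=
  U *m (map_mx (fun x : C => (x^*)%C) U)^T = 1%:M.
Definition T_unitarizable n (rho : 'M[int]_2 -> 'M[C]_n) : Prop :=
  exists P : 'M[C]_n, P \in unitmx /\ unitary_mx (P *m rho Tm *m invmx P).

(* analysis on the upper half-plane *)
Definition cderiv (f : C -> C) (z : C) : C := 'D_1 (f : C^o -> C^o) z.
Definition holo (f : C -> C) : Prop :=
  forall z, Hp z -> derivable (f : C^o -> C^o) z 1.
Definition compo n (F : C -> 'cV[C]_n) (j : 'I_n) : C -> C := fun z => F z j 0.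
Definition moderate n (F : C -> 'cV[C]_n) : Prop :=
  exists (N : nat) (c : R), forall z, c < ImC z -> forall j, `|F z j 0| <= rC (ImC z ^+ N).
Definition slash n (k : R) (v : 'M[int]_2 -> C) (g : 'M[int]_2) (F : C -> 'cV[C]_n)
  : C -> 'cV[C]_n := fun z => ((v g)^-1 * (cpow (jac g z) k)^-1) *: F (mob g z).

(* H(k, rho, v) *)
Definition HH n (k : R) (rho : 'M[int]_2 -> 'M[C]_n) (v : 'M[int]_2 -> C)
  (F : C -> 'cV[C]_n) : Prop :=
  [/\ forall j, holo (compo F j), moderate F &
      forall g, SL2 g -> forall z, Hp z -> slash k v g F z = rho g *m F z].

(* M_k : holomorphic integral weight modular forms, trivial multiplier *)
Definition MF (k : int) (f : C -> C) : Prop :=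
  [/\ holo f, moderate (fun z => (f z)%:M : 'cV[C]_1) &
      forall g, SL2 g -> forall z, Hp z -> f (mob g z) = jac g z ^ k * f z].
(* M = (+)_k M_k, elements = finite sums of homogeneous forms (on H) *)
Definition MM (f : C -> C) : Prop :=
  exists (d : nat) (w : 'I_d -> int) (fs : 'I_d -> C -> C),
    (forall i, MF (w i) (fs i)) /\ forall z, Hp z -> f z = \sum_i fs i z.
(* H(rho, v) = (+)_{n in Z} H(k+n, rho, v) *)
Definition HHsum n (k : R) (rho : 'M[int]_2 -> 'M[C]_n) (v : 'M[int]_2 -> C)
  (F : C -> 'cV[C]_n) : Prop :=
  exists (d : nat) (w : 'I_d -> int) (Fs : 'I_d -> C -> 'cV[C]_n),
    (forall i, HH (k + (w i)%:~R) rho v (Fs i)) /\ forall z, Hp z -> F z = \sum_i Fs i z.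

(* free M-module with given basis *)
Definition free_M_basis n (S : (C -> 'cV[C]_n) -> Prop) (d : nat)
  (B : 'I_d -> C -> 'cV[C]_n) : Prop :=
  [/\ forall i, S (B i),
      forall F, S F -> exists ms : 'I_d -> C -> C,
        (forall i, MM (ms i)) /\ forall z, Hp z -> F z = \sum_i ms i z *: B i z &
      forall ms : 'I_d -> C -> C, (forall i, MM (ms i)) ->
        (forall z, Hp z -> \sum_i ms i z *: B i z = 0) ->
        forall i z, Hp z -> ms i z = 0].
(* complex dimension of a space of functions on H *)
Definition has_dim n (S : (C -> 'cV[C]_n) -> Prop) (d : nat) : Prop :=
  exists B : 'I_d -> C -> 'cV[C]_n,
    [/\ forall i, S (B i),
        forall c : 'I_d -> C, (forall z, Hp z -> \sum_i c i *: B i z = 0) -> forall i, c i = 0 &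
        forall F, S F -> exists c : 'I_d -> C, forall z, Hp z -> F z = \sum_i c i *: B i z].

(* eta, P and the modular derivative *)
Definition eta (z : C) : C :=
  ee (z / 24%:R) *
  lim ((fun N : nat => (\prod_(1 <= n < N.+1) (1 - ee (n%:R * z)) : C^o)) @ \oo).
Definition Pfun (z : C) : C := iC / rC pi * (cderiv eta z / eta z).
Definition Dk (k : R) (f : C -> C) : C -> C :=
  fun z => (rC (2 * pi) * iC)^-1 * cderiv f z + rC k * Pfun z * f z.
Fixpoint Dkn (k : R) (n : nat) (f : C -> C) : C -> C :=
  match n with 0 => f | n'.+1 => Dk (k + 2 * n'%:R) (Dkn k n' f) end.
Definition Dvec n (k : R) (F : C -> 'cV[C]_n) : C -> 'cV[C]_n :=
  fun z => \col_j Dk k (compo F j) z.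

(* fourth order MLDE in weight k: D^4 f + M4 D^2 f + M6 D f + M8 f *)
Definition mlde4 (k : R) (M4 M6 M8 : C -> C) (f : C -> C) : C -> C :=
  fun z => Dkn k 4 f z + M4 z * Dkn k 2 f z + M6 z * Dkn k 1 f z + M8 z * f z.
(* value at the cusp: lim_{y -> +oo} f(iy) *)
Definition cusp_val (f : C -> C) : C :=
  lim ((fun y : R => (f (rC y * iC) : C^o)) @ +oo%R).
(* indicial polynomial of the MLDE (leading q-term of the operator on q^r) *)
Definition indicial4 (k : R) (M4 M6 M8 : C -> C) : {poly C} :=
  let c t := ((rC k + 2 * t%:R) * cusp_val Pfun)%:P in
  \prod_(t < 4) ('X + c t) + (cusp_val M4)%:P * \prod_(t < 2) ('X + c t)
  + (cusp_val M6)%:P * ('X + c 0%N) + (cusp_val M8)%:P.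

(* fractional part *)
Definition fracR (x : R) : R := x - (Num.floor x)%:~R.

(* Main.v *)
(* Substituting gamma z into L[f] = 0 and comparing coefficients with L[f] = 0 itself shows that P is
   quasimodular, so D raises weights by 2, eta^24 = Delta has weight 12, and P generates E4 and E6.
   As Delta has no zeros, dividing by it reduces every modular form to weight below 12, which replaces
   the valence formula.  The Wronskian W of F1 solves a first order linear equation, so it has no
   zeros, and for four vector-valued forms B the multipliers cancel in Delta det(B) / W, a scalar
   modular form of weight sum(weights) - 8 relative to k1.  Comparing such determinants at the cusp
   shows that rho1 is indecomposable, hence irreducible since rho is T-determined, hence the
   Wronskian of a nonzero form does not vanish identically.  For {G, DG, F1, D^2 G} the weight is 0, so the
   ratio is a constant; it is nonzero, and Cramer's rule then gives coordinates in M. *)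
Require Import Defs.
From mathcomp Require Import all_boot all_order all_algebra.
From mathcomp Require Import all_classical all_reals all_analysis.
From mathcomp Require Import complex ring lra zify perm.
From mathcomp Require Import Rstruct Rstruct_topology.
From Coquelicot Require Hierarchy Continuity Derive RInt RInt_analysis.
Set Implicit Arguments. Unset Strict Implicit. Unset Printing Implicit Defensive.
Import Order.TTheory GRing.Theory Num.Theory numFieldNormedType.Exports.
Local Open Scope ring_scope.
Local Open Scope classical_set_scope.

(** * Complex differentiation *)

(** Analysis rests on means of 1-periodic functions over one period of a horizontal line. In the
    variable [ee z] these are circle integrals, so Goursat's theorem on rectangles yields Cauchy's
    formula in the disc, Fourier expansions and locally uniform limits without curved contours. The
    source of modularity is the existence of [rho1]: were P not quasimodular, the difference of the
    two forms of the equation would be an equation of order at most three with four independent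
    solutions. The exponents [ex] have a sum one larger than the [lam], and the simple zero of Delta
    supplies this missing power of q in Delta det(B) / W; forms with exponents [ex] therefore gain a
    zero at the cusp, which is what excludes a splitting of [rho1]. The hypothesis on [lam i] enters
    because D multiplies the leading coefficient of the component j of G by lam j - k1 / 12, whereas
    component i of F1 starts one power of q later: it keeps DG and F1 apart at i. *)

Definition cabs (z : C) : R := Normc.normc z.

Lemma cabsM x y : cabs (x * y) = cabs x * cabs y. Proof. exact: Normc.normcM. Qed.
Lemma cabsD x y : cabs (x + y) <= cabs x + cabs y. Proof. exact: le_normcD. Qed.
Lemma cabsN x : cabs (- x) = cabs x. Proof. exact: normcN. Qed.
Lemma cabs0 : cabs 0 = 0. Proof. exact: Normc.normc0. Qed.
Lemma cabs1 : cabs 1 = 1. Proof. exact: Normc.normc1. Qed.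
Lemma cabsV x : cabs x^-1 = (cabs x)^-1. Proof. exact: Normc.normcV. Qed.
Lemma cabs_ge0 x : 0 <= cabs x.
Proof. by case: x => a b; rewrite /cabs /= sqrtr_ge0. Qed.
Lemma cabs_eq0 x : (cabs x == 0) = (x == 0).
Proof.
apply/eqP/eqP => [|->]; [exact: Normc.eq0_normc|exact: cabs0].
Qed.
Lemma cabs_gt0 x : (0 < cabs x) = (x != 0).
Proof. by rewrite lt_neqAle cabs_ge0 andbT eq_sym cabs_eq0. Qed.
Lemma cabsX x n : cabs (x ^+ n) = cabs x ^+ n.
Proof. by elim: n => [|n IH]; rewrite ?expr0 ?cabs1 // !exprS cabsM IH. Qed.
Lemma cabsB x y : cabs (x - y) = cabs (y - x).
Proof. by rewrite -cabsN opprB. Qed.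
Lemma cabsB_ge x y : cabs x - cabs y <= cabs (x - y).
Proof. by have := cabsD (x - y) y; rewrite subrK; lra. Qed.
Lemma cabs_rC (x : R) : cabs (rC x) = `|x|.
Proof. by rewrite /cabs /= expr0n /= addr0 sqrtr_sqr. Qed.
Lemma cabs_iC : cabs iC = 1.
Proof. by rewrite /cabs /= expr0n /= add0r expr1n sqrtr1. Qed.
Lemma cabs_norm (z : C) : `|z| = rC (cabs z). Proof. by case: z. Qed.
Lemma cabs_nat n : cabs n%:R = n%:R.
Proof.
have -> : (n%:R : C) = rC n%:R by rewrite /rC rmorph_nat.
by rewrite cabs_rC ger0_norm.
Qed.

Lemma rCD x y : rC (x + y) = rC x + rC y. Proof. exact: rmorphD. Qed.
Lemma rCB x y : rC (x - y) = rC x - rC y. Proof. exact: rmorphB. Qed.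
Lemma rCN x : rC (- x) = - rC x. Proof. exact: rmorphN. Qed.
Lemma rCM x y : rC (x * y) = rC x * rC y. Proof. exact: rmorphM. Qed.
Lemma rCV x : rC x^-1 = (rC x)^-1. Proof. exact: fmorphV. Qed.
Lemma rC_nat n : rC n%:R = n%:R. Proof. exact: rmorph_nat. Qed.
Lemma rC0 : rC 0 = 0. Proof. by []. Qed.
Lemma rC1 : rC 1 = 1. Proof. by []. Qed.
Lemma rC_inj : injective rC. Proof. exact: complexI. Qed.
Lemma rC_eq0 x : (rC x == 0) = (x == 0).
Proof. by apply/eqP/eqP => [[]|->]. Qed.
Lemma iC2 : iC * iC = -1. Proof. by rewrite -expr2 sqr_i. Qed.
Lemma iC_neq0 : iC != 0. Proof. by rewrite -cabs_eq0 cabs_iC oner_eq0. Qed.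

Lemma CE (z : C) : z = rC (ReC z) + iC * rC (ImC z).
Proof. exact: complexE. Qed.
Lemma ReCD x y : ReC (x + y) = ReC x + ReC y. Proof. by case: x; case: y. Qed.
Lemma ImCD x y : ImC (x + y) = ImC x + ImC y. Proof. by case: x; case: y. Qed.
Lemma ReCN x : ReC (- x) = - ReC x. Proof. by case: x. Qed.
Lemma ImCN x : ImC (- x) = - ImC x. Proof. by case: x. Qed.
Lemma ReCM x y : ReC (x * y) = ReC x * ReC y - ImC x * ImC y.
Proof. by case: x; case: y. Qed.
Lemma ImCM x y : ImC (x * y) = ReC x * ImC y + ImC x * ReC y.
Proof. by case: x => a b; case: y => c d /=; rewrite addrC [b * c]mulrC [a * d]mulrC; ring. Qed.
Lemma ReC_rC x : ReC (rC x) = x. Proof. by []. Qed.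
Lemma ImC_rC x : ImC (rC x) = 0. Proof. by []. Qed.
Lemma ReC_iC : ReC iC = 0. Proof. by []. Qed.
Lemma ImC_iC : ImC iC = 1. Proof. by []. Qed.
Lemma eqReIm x y : ReC x = ReC y -> ImC x = ImC y -> x = y.
Proof. by case: x => a b; case: y => c d /= -> ->. Qed.

Lemma cabs2 z : cabs z ^+ 2 = ReC z ^+ 2 + ImC z ^+ 2.
Proof. by case: z => a b; rewrite /cabs /= sqr_sqrtr // addr_ge0 ?sqr_ge0. Qed.
Lemma ReC_le z : `|ReC z| <= cabs z.
Proof.
rewrite -[leLHS]ger0_norm // -[leRHS]ger0_norm ?cabs_ge0 // -ler_sqr ?nnegrE //.
by rewrite !real_normK ?num_real // cabs2; have := sqr_ge0 (ImC z); lra.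
Qed.
Lemma ImC_le z : `|ImC z| <= cabs z.
Proof.
rewrite -[leLHS]ger0_norm // -[leRHS]ger0_norm ?cabs_ge0 // -ler_sqr ?nnegrE //.
by rewrite !real_normK ?num_real // cabs2; have := sqr_ge0 (ReC z); lra.
Qed.
Lemma cabs_le z : cabs z <= `|ReC z| + `|ImC z|.
Proof.
rewrite {1}(CE z); apply: (le_trans (cabsD _ _)).
by rewrite cabsM cabs_iC mul1r !cabs_rC.
Qed.

Definition ccont (f : C -> C) (z : C) : Prop :=
  forall e : R, 0 < e -> exists2 d : R, 0 < d &
    forall w, cabs (w - z) < d -> cabs (f w - f z) < e.
(* Caratheodory's form of the complex derivative: composition becomes algebra. *)
Definition cd (f : C -> C) (z d : C) : Prop :=
  exists phi : C -> C, [/\ forall w, f w = f z + phi w * (w - z), ccont phi z & phi z = d].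

Lemma ccont_cst c z : ccont (fun=> c) z.
Proof. by move=> e e0; exists 1 => // w _; rewrite subrr cabs0. Qed.
Lemma ccont_id z : ccont id z.
Proof. by move=> e e0; exists e. Qed.
Lemma ccontD f g z : ccont f z -> ccont g z -> ccont (fun w => f w + g w) z.
Proof.
move=> cf cg e e0.
have [d d0 hd] := cf (e / 2) ltac:(lra).
have [d' d'0 hd'] := cg (e / 2) ltac:(lra).
exists (Num.min d d'); first by rewrite lt_min d0.
move=> w; rewrite lt_min => /andP[/hd h1 /hd' h2].
have -> : f w + g w - (f z + g z) = (f w - f z) + (g w - g z) by ring.
by have := cabsD (f w - f z) (g w - g z); lra.
Qed.
Lemma ccontM f g z : ccont f z -> ccont g z -> ccont (fun w => f w * g w) z.
Proof.
move=> cf cg e e0.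
pose A := cabs (f z) + cabs (g z) + 1.
have A1 : 1 <= A by rewrite /A; have := cabs_ge0 (f z); have := cabs_ge0 (g z); lra.
have A0 : 0 < A by lra.
pose e' := Num.min 1 (e / (2 * A)).
have e'0 : 0 < e' by rewrite lt_min ltr01 divr_gt0 // mulr_gt0.
have [d d0 hd] := cf e' e'0.
have [d' d'0 hd'] := cg e' e'0.
exists (Num.min d d'); first by rewrite lt_min d0.
move=> w; rewrite lt_min => /andP[/hd h1 /hd' h2].
have -> : f w * g w - f z * g z = (f w - f z) * (g w - g z)
  + (f w - f z) * g z + f z * (g w - g z) by ring.
have e'1 : e' <= 1 by rewrite ge_min lexx.
have e'e : e' * (2 * A) <= e.
  by rewrite -ler_pdivlMr ?mulr_gt0 // ge_min lexx orbT.
have := cabsD ((f w - f z) * (g w - g z) + (f w - f z) * g z) (f z * (g w - g z)).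
have := cabsD ((f w - f z) * (g w - g z)) ((f w - f z) * g z).
rewrite !cabsM.
have := cabs_ge0 (f w - f z). have := cabs_ge0 (g w - g z).
have := cabs_ge0 (f z). have := cabs_ge0 (g z).
move: e'e; rewrite /A.
move: (cabs (f w - f z)) (cabs (g w - g z)) h1 h2 (cabs (f z)) (cabs (g z)) => a b ha hb F G.
move=> h G0 F0 b0 a0.
have : a * b <= e' by nra.
have : a * G <= e' * G by nra.
have : F * b <= F * e' by nra.
nra.
Qed.
Lemma ccont_comp f g z : ccont f z -> ccont g (f z) -> ccont (fun w => g (f w)) z.
Proof.
move=> cf cg e e0; have [d d0 hd] := cg e e0; have [d' d'0 hd'] := cf d d0.
by exists d' => // w /hd' /hd.
Qed.
Lemma ccont_near f g z d : 0 < d -> (forall w, cabs (w - z) < d -> f w = g w) ->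
  ccont f z -> ccont g z.
Proof.
move=> d0 fg cf e e0; have [d' d'0 hd'] := cf e e0.
exists (Num.min d d'); first by rewrite lt_min d0.
move=> w; rewrite lt_min => /andP[wd /hd'].
by rewrite !fg // subrr cabs0.
Qed.
Lemma ccont_inv z : z != 0 -> ccont (fun w => w^-1) z.
Proof.
move=> z0 e e0.
have a0 : 0 < cabs z by rewrite cabs_gt0.
exists (Num.min (cabs z / 2) (e * cabs z ^+ 2 / 2)).
  by rewrite lt_min !divr_gt0 // mulr_gt0 // exprn_gt0.
move=> w; rewrite lt_min => /andP[h1 h2].
have hw : cabs z / 2 < cabs w by have := cabsB_ge z w; rewrite cabsB in h1; lra.
have w0 : w != 0 by rewrite -cabs_gt0; lra.
have -> : w^-1 - z^-1 = - ((w - z) / (w * z)) by field; rewrite w0 z0.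
rewrite cabsN cabsM cabsV cabsM ltr_pdivrMr ?mulr_gt0 ?cabs_gt0 //.
move: h2; rewrite ltr_pdivlMr // expr2 => h2.
have := cabs_ge0 (w - z).
nra.
Qed.

Lemma cd_cont f z d : cd f z d -> ccont f z.
Proof.
move=> [phi [h c _]].
have : ccont (fun w => f z + phi w * (w - z)) z.
  apply: ccontD; first exact: ccont_cst.
  apply: ccontM => //; apply: ccontD; [exact: ccont_id|exact: ccont_cst].
by apply: (@ccont_near _ _ _ 1) => // w _; rewrite -h.
Qed.
Lemma cd_eq f z d d' : cd f z d -> d = d' -> cd f z d'. Proof. by move=> ? <-. Qed.
Lemma cd_cst c z : cd (fun=> c) z 0.
Proof. by exists (fun=> 0); split => [w||//]; [rewrite mul0r addr0|exact: ccont_cst]. Qed.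
Lemma cd_id z : cd id z 1.
Proof. by exists (fun=> 1); split => [w||//]; [rewrite mul1r addrC subrK|exact: ccont_cst]. Qed.
Lemma cdD f g z a b : cd f z a -> cd g z b -> cd (fun w => f w + g w) z (a + b).
Proof.
move=> [p [hp cp <-]] [q [hq cq <-]].
by exists (fun w => p w + q w); split => [w||//]; [rewrite (hp w) (hq w); ring|exact: ccontD].
Qed.
Lemma cdM f g z a b : cd f z a -> cd g z b ->
  cd (fun w => f w * g w) z (a * g z + f z * b).
Proof.
move=> cf cg; have ccg := cd_cont cg; move: cf cg => [p [hp cp <-]] [q [hq cq <-]].
exists (fun w => p w * g w + f z * q w); split => [w||//].
  by rewrite (hp w) (hq w); ring.
by apply: ccontD; apply: ccontM => //; exact: ccont_cst.
Qed.
Lemma cd_comp f g z a b : cd f z a -> cd g (f z) b -> cd (fun w => g (f w)) z (b * a).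
Proof.
move=> cf cg; have ccf := cd_cont cf; move: cf cg => [p [hp cp <-]] [q [hq cq <-]].
exists (fun w => q (f w) * p w); split => [w||//].
  rewrite (hq (f w)); have -> : f w - f z = p w * (w - z) by rewrite (hp w); ring.
  by ring.
by apply: ccontM => //; exact: (ccont_comp ccf cq).
Qed.
Lemma cd_inv z : z != 0 -> cd (fun w => w^-1) z (- z ^- 2).
Proof.
move=> z0; exists (fun w => if w == 0 then z ^- 2 else - (w^-1 * z^-1)); split.
- move=> w; case: eqP => [->|/eqP w0]; first by rewrite invr0; field.
  by field; rewrite z0.
- apply: (@ccont_near (fun w => -1 * (w^-1 * z^-1)) _ _ (cabs z)).
  + by rewrite cabs_gt0.
  + move=> w; case: eqP => [->|_ _]; last by rewrite mulN1r.
    by rewrite sub0r cabsN ltxx.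
  + apply: ccontM; first exact: ccont_cst.
    by apply: ccontM; [exact: ccont_inv|exact: ccont_cst].
- by rewrite (negbTE z0); field.
Qed.

Lemma cdP f z d : cd f z d <->
  (forall e : R, 0 < e -> exists2 dl : R, 0 < dl &
    forall w, cabs (w - z) < dl -> cabs (f w - f z - d * (w - z)) <= e * cabs (w - z)).
Proof.
split.
  move=> [p [hp cp <-]] e e0; have [dl dl0 h] := cp e e0; exists dl => // w /h hw.
  have -> : f w - f z - p z * (w - z) = (p w - p z) * (w - z) by rewrite (hp w); ring.
  by rewrite cabsM ler_wpM2r ?cabs_ge0 // ltW.
move=> h; exists (fun w => if w == z then d else (f w - f z) / (w - z)); split.
- move=> w; case: eqP => [->|/eqP wz]; first by rewrite subrr mulr0 addr0.
  by rewrite divfK ?subr_eq0 // addrC subrK.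
- move=> e e0; have [dl dl0 hdl] := h (e / 2) ltac:(lra); exists dl => // w wd.
  rewrite eqxx; case: eqP => [_|/eqP wz]; first by rewrite subrr cabs0.
  have wz' : w - z != 0 by rewrite subr_eq0.
  have -> : (f w - f z) / (w - z) - d = (f w - f z - d * (w - z)) / (w - z) by field.
  rewrite cabsM cabsV ltr_pdivrMr ?cabs_gt0 //.
  apply: (le_lt_trans (hdl _ wd)); rewrite -cabs_gt0 in wz'; nra.
- by rewrite eqxx.
Qed.

Lemma cd_near f g z a d : 0 < d -> (forall w, cabs (w - z) < d -> f w = g w) ->
  cd f z a -> cd g z a.
Proof.
move=> d0 fg /cdP h; apply/cdP => e e0; have [d' d'0 h'] := h e e0.
exists (Num.min d d'); first by rewrite lt_min d0.
move=> w; rewrite lt_min => /andP[wd /h'].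
by rewrite !fg // subrr cabs0.
Qed.
Lemma cd_ext f g z a : (forall w, f w = g w) -> cd f z a -> cd g z a.
Proof. by move=> fg; apply: (@cd_near _ _ _ _ 1). Qed.

Lemma cd_uniq f z a b : cd f z a -> cd f z b -> a = b.
Proof.
move=> /cdP ha /cdP hb; apply/eqP; rewrite -subr_eq0 -cabs_eq0 eq_le cabs_ge0 andbT.
rewrite leNgt; apply/negP => h.
have [d d0 hd] := ha (cabs (a - b) / 4) ltac:(lra).
have [d' d'0 hd'] := hb (cabs (a - b) / 4) ltac:(lra).
pose t := Num.min d d' / 2.
have t0 : 0 < t by rewrite divr_gt0 // lt_min d0.
have td : t < d by rewrite /t; have := ge_min d d d'; rewrite lexx /= => ?; lra.
have td' : t < d' by rewrite /t; have := ge_min d' d d'; rewrite lexx orbT /= => ?; lra.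
have hw : cabs (z + rC t - z) = t by rewrite addrC addKr cabs_rC gtr0_norm.
have := hd (z + rC t); have := hd' (z + rC t); rewrite hw => /(_ td') h1 /(_ td) h2.
have e : (a - b) * rC t = (f (z + rC t) - f z - b * (z + rC t - z))
   - (f (z + rC t) - f z - a * (z + rC t - z)) by ring.
have := congr1 cabs e; rewrite cabsM cabs_rC gtr0_norm // => e'.
have := cabsD (f (z + rC t) - f z - b * (z + rC t - z))
   (- (f (z + rC t) - f z - a * (z + rC t - z))).
rewrite cabsN -e'; nra.
Qed.

Lemma cdN f z a : cd f z a -> cd (fun w => - f w) z (- a).
Proof.
move=> h; apply: (cd_ext (f := fun w => -1 * f w)); first by move=> w; rewrite mulN1r.
by apply: cd_eq (cdM (cd_cst (-1) z) h) _; ring.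
Qed.
Lemma cdB f g z a b : cd f z a -> cd g z b -> cd (fun w => f w - g w) z (a - b).
Proof. by move=> h /cdN k; exact: cdD. Qed.
Lemma cdZ c f z a : cd f z a -> cd (fun w => c * f w) z (c * a).
Proof. by move=> h; apply: cd_eq (cdM (cd_cst c z) h) _; ring. Qed.
Lemma cdV f z a : f z != 0 -> cd f z a -> cd (fun w => (f w)^-1) z (- a / f z ^+ 2).
Proof. by move=> f0 h; apply: cd_eq (cd_comp h (cd_inv f0)) _; rewrite mulNr mulrC mulNr. Qed.
Lemma cdX f z a n : cd f z a -> cd (fun w => f w ^+ n) z (n%:R * f z ^+ n.-1 * a).
Proof.
move=> h; elim: n => [|n IH]; first by rewrite !mul0r; exact: cd_cst.
apply: (cd_ext (f := fun w => f w * f w ^+ n)) => [w|]; first by rewrite exprS.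
apply: cd_eq (cdM h IH) _; case: n {IH} => [|n] /=; first by ring.
by rewrite !exprS -!natr1; ring.
Qed.
Lemma cd_sum I (s : seq I) (P : pred I) (F : I -> C -> C) (a : I -> C) z :
  (forall i, P i -> cd (F i) z (a i)) ->
  cd (fun w => \sum_(i <- s | P i) F i w) z (\sum_(i <- s | P i) a i).
Proof.
move=> h; elim: s => [|i s IH].
  by apply: (cd_ext (f := fun=> 0)) => [w|]; rewrite big_nil //; exact: cd_cst.
have [Pi|Pi] := boolP (P i).
  apply: (cd_ext (f := fun w => F i w + \sum_(j <- s | P j) F j w)) => [w|].
    by rewrite big_cons Pi.
  by rewrite big_cons Pi; apply: cdD => //; exact: h.
apply: (cd_ext (f := fun w => \sum_(j <- s | P j) F j w)) => [w|].
  by rewrite big_cons (negbTE Pi).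
by rewrite big_cons (negbTE Pi).
Qed.

(** Bridge to the limit behind [cderiv] and [holo], the notions of the theorem; all later
    computations use [cd]. *)
Lemma cderivP (f : C -> C) z d : cd f z d <->
  derivable (f : C^o -> C^o) z 1 /\ cderiv f z = d.
Proof.
have key : cd f z d <->
    ((fun h : C^o => h^-1 *: ((f : C^o -> C^o) (h *: (1 : C^o) + z) - f z)) @ 0^' --> (d : C^o)).
  rewrite cdP; split.
    move=> h; apply/cvgrPdist_le => /= e e0.
    (* In the partial order of [C], 0 < e forces e to be real. *)
    have [e1 ee] : exists e1, e = rC e1.
      exists (ReC e); apply: eqReIm => //.
      by move: e0; rewrite ltcE /= => /andP[/eqP].
    have e10 : 0 < e1 by move: e0; rewrite ee ltcR.
    have [dl dl0 hd] := h e1 e10.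
    exists (rC dl) => /=; first by rewrite ltcR.
    move=> t /=; rewrite sub0r normrN cabs_norm ltcR => td t0.
    have := hd (t + z); rewrite addrK => /(_ td) hh.
    rewrite ee cabs_norm lecR [t *: (1 : C^o)]mulr1 cabsB.
    have -> : (t^-1 *: (f (t + z) - f z : C^o) - d : C) = (f (t + z) - f z - d * t) / t.
      by rewrite /GRing.scale /=; field.
    by rewrite cabsM cabsV ler_pdivrMr ?cabs_gt0.
  move=> /cvgrPdist_le h e e0.
  have /h [dl /= dl0 hd] : (0 : C) < rC e by rewrite ltcR.
  have [d1 dd] : exists d1, dl = rC d1.
    exists (ReC dl); apply: eqReIm => //.
    by move: dl0; rewrite ltcE /= => /andP[/eqP].
  exists d1; first by move: dl0; rewrite dd ltcR.
  move=> w wd; have [->|/eqP wz] := eqVneq w z.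
    by rewrite !subrr mulr0 subr0 cabs0 mulr0.
  have wz' : w - z != 0 by rewrite subr_eq0; apply/eqP.
  have := hd (w - z); rewrite /= sub0r normrN cabs_norm dd ltcR => /(_ wd wz').
  rewrite [(w - z) *: (1 : C^o)]mulr1 subrK cabs_norm lecR.
  rewrite [X in cabs X](_ : _ = - ((f w - f z - d * (w - z)) / (w - z))); last first.
    by rewrite /GRing.scale /=; field.
  rewrite cabsN.
  by rewrite cabsM cabsV ler_pdivrMr ?cabs_gt0.
rewrite key; split.
  move=> h; split; first by apply/cvg_ex; exists d.
  exact: (cvg_lim (@norm_hausdorff _ _) h).
by move=> [h <-]; exact: h.
Qed.

(** * Cauchy's theorem on rectangles *)
Definition rcont (f : R -> R) (x : R) : Prop :=
  forall e : R, 0 < e -> exists2 d : R, 0 < d &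
    forall y, `|y - x| < d -> `|f y - f x| < e.

(** Integration is taken from Coquelicot; the module confines its topological notions, so that they
    do not shadow those of MathComp. *)
Module Riemann.
Import Hierarchy Continuity RInt RInt_analysis.

Definition rint (f : R -> R) (a b : R) : R := @RInt R_CompleteNormedModule f a b.

Lemma rcont_continuous (f : R -> R) (x : R) :
  rcont f x -> @continuous R_UniformSpace R_UniformSpace f x.
Proof.
move=> h; apply/continuity_pt_filterlim => e /RltP e0.
have [d d0 hd] := h e e0; exists d; split; first exact/RltP.
move=> y [_ /RltP]; rewrite /= RdistE => /hd; rewrite -RdistE => /RltP; exact.
Qed.

Lemma rcont_ex (f : R -> R) (a b : R) : a <= b ->
  (forall x, a <= x <= b -> rcont f x) -> @ex_RInt R_NormedModule f a b.
Proof.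
move=> ab h; apply: (@ex_RInt_continuous R_CompleteNormedModule) => z.
rewrite RminE RmaxE (min_l ab) (max_r ab) => -[/RleP az /RleP zb].
by apply: rcont_continuous; apply: h; rewrite az.
Qed.

Lemma rint_ext (f g : R -> R) (a b : R) : a <= b ->
  (forall x, a <= x <= b -> f x = g x) -> rint f a b = rint g a b.
Proof.
move=> ab h; apply: RInt_ext => x; rewrite RminE RmaxE (min_l ab) (max_r ab).
by move=> [/RltP ax /RltP xb]; apply: h; rewrite !ltW.
Qed.

Lemma rintD (f g : R -> R) (a b : R) : a <= b ->
  (forall x, a <= x <= b -> rcont f x) -> (forall x, a <= x <= b -> rcont g x) ->
  rint (fun x => f x + g x) a b = rint f a b + rint g a b.
Proof.
by move=> ab /(rcont_ex ab) hf /(rcont_ex ab) hg; exact: (RInt_plus f g a b hf hg).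
Qed.

Lemma rintZ (f : R -> R) (a b l : R) : a <= b ->
  (forall x, a <= x <= b -> rcont f x) ->
  rint (fun x => l * f x) a b = l * rint f a b.
Proof. by move=> ab /(rcont_ex ab) hf; exact: (RInt_scal f a b l hf). Qed.

Lemma rint_chasles (f : R -> R) (a b c : R) : a <= b -> b <= c ->
  (forall x, a <= x <= c -> rcont f x) ->
  rint f a b + rint f b c = rint f a c.
Proof.
move=> ab bc h; apply: (RInt_Chasles f a b c); apply: rcont_ex => // x /andP[h1 h2].
  by apply: h; rewrite h1 (le_trans h2).
by apply: h; rewrite h2 (le_trans ab).
Qed.

Lemma rint_bound (f : R -> R) (a b M : R) : a <= b ->
  (forall x, a <= x <= b -> rcont f x) ->
  (forall x, a <= x <= b -> `|f x| <= M) -> `|rint f a b| <= (b - a) * M.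
Proof.
move=> ab /(rcont_ex ab) hf hM; rewrite -RabsE; apply/RleP.
apply: (abs_RInt_le_const f a b M _ hf); first exact/RleP.
by move=> t [/RleP h1 /RleP h2]; rewrite RabsE; apply/RleP; apply: hM; rewrite h1.
Qed.

Lemma rint_cst (c a b : R) : rint (fun=> c) a b = (b - a) * c.
Proof. exact: (@RInt_const R_CompleteNormedModule a b c). Qed.

Lemma rint_id (a b : R) : rint id a b = (b ^+ 2 - a ^+ 2) / 2.
Proof.
have h : @is_RInt R_NormedModule id a b ((b ^+ 2 / 2) - (a ^+ 2 / 2)).
  apply: (@is_RInt_derive R_CompleteNormedModule (fun x => x ^+ 2 / 2) id a b) => x _.
    apply/Derive.is_derive_Reals => e e0; exists (RIneq.mkposreal e e0) => t /eqP t0 te.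
    apply/RltP; rewrite RabsE; apply: le_lt_trans (_ : `|t| < e); last first.
      by rewrite -RabsE; apply/RltP; exact: te.
    rewrite RminusE RminusE RdivE RplusE.
    have -> : ((x + t) ^+ 2 / 2 - x ^+ 2 / 2) / t - x = t / 2 by field.
    by rewrite normrM ger_pMr ?normr_gt0 // ger0_norm ?invr_ge0 ?ler0n //; lra.
  exact: Continuity.continuous_id.
rewrite /rint (is_RInt_unique _ _ _ _ h).
by rewrite mulrBl.
Qed.

Lemma unif_cont2 (f : R -> R -> R) (a b c d : R) :
  (forall x y, a <= x <= b -> c <= y <= d ->
    forall e, 0 < e -> exists2 dl, 0 < dl &
      forall u v, `|u - x| < dl -> `|v - y| < dl -> `|f u v - f x y| < e) ->
  forall e, 0 < e -> exists2 dl, 0 < dl &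
    forall x y v, a <= x <= b -> c <= y <= d -> c <= v <= d -> `|v - y| < dl ->
      `|f x v - f x y| < e.
Proof.
move=> h e e0; have e0' : Rdefinitions.Rlt 0 e by exact/RltP.
have [|dl hd] := @uniform_continuity_2d f a b c d _ (RIneq.mkposreal e e0').
  move=> x y [/RleP ax /RleP xb] [/RleP cy /RleP yd] [e' e'0].
  have /= e'1 : 0 < e' by exact/RltP.
  have axb : a <= x <= b by rewrite ax.
  have cyd : c <= y <= d by rewrite cy.
  have [dl dl0 hdl] := h x y axb cyd e' e'1.
  have dl1 : Rdefinitions.Rlt 0 dl by exact/RltP.
  exists (RIneq.mkposreal dl dl1) => u v /= /RltP hu /RltP hv; apply/RltP.
  by move: hu hv; rewrite !RabsE; exact: hdl.
exists (RIneq.pos dl); first by apply/RltP; case: dl {hd}.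
move=> x y v /andP[/RleP h1 /RleP h2] /andP[/RleP h3 /RleP h4] /andP[/RleP h5 /RleP h6] hv.
have := hd x y x v (conj h1 h2) (conj h3 h4) (conj h1 h2) (conj h5 h6).
rewrite !RabsE => H; apply/RltP; apply: H; last exact/RltP.
by apply/RltP; rewrite RminusE subrr normr0; apply/RltP; case: (dl).
Qed.
End Riemann.
Import Riemann.

Definition pcont (f : R -> C) (x : R) : Prop :=
  forall e : R, 0 < e -> exists2 d : R, 0 < d &
    forall y, `|y - x| < d -> cabs (f y - f x) < e.
Definition cint (f : R -> C) (a b : R) : C :=
  rC (rint (fun t => ReC (f t)) a b) + iC * rC (rint (fun t => ImC (f t)) a b).
Definition pcont_on (f : R -> C) (a b : R) := forall x, a <= x <= b -> pcont f x.

Lemma pcont_Re f x : pcont f x -> rcont (fun t => ReC (f t)) x.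
Proof.
move=> h e e0; have [d d0 hd] := h e e0; exists d => // y /hd; apply: le_lt_trans.
by rewrite -ReCN -ReCD ReC_le.
Qed.
Lemma pcont_Im f x : pcont f x -> rcont (fun t => ImC (f t)) x.
Proof.
move=> h e e0; have [d d0 hd] := h e e0; exists d => // y /hd; apply: le_lt_trans.
by rewrite -ImCN -ImCD ImC_le.
Qed.
Lemma rcontZ c f x : rcont f x -> rcont (fun t => c * f t) x.
Proof.
move=> h e e0; have c0 : 0 < `|c| + 1 by have := normr_ge0 c; lra.
have [d d0 hd] := h (e / (`|c| + 1)) ltac:(by rewrite divr_gt0).
exists d => // y /hd; rewrite ltr_pdivlMr // -mulrBr normrM.
have := normr_ge0 (f y - f x); nra.
Qed.

Lemma cint_ext f g a b : a <= b -> (forall x, a <= x <= b -> f x = g x) ->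
  cint f a b = cint g a b.
Proof.
by move=> ab h; rewrite /cint; congr (rC _ + iC * rC _); apply: rint_ext => // x /h ->.
Qed.
Lemma cintD f g a b : a <= b -> pcont_on f a b -> pcont_on g a b ->
  cint (fun t => f t + g t) a b = cint f a b + cint g a b.
Proof.
move=> ab hf hg; rewrite /cint.
rewrite (@rint_ext _ (fun t => ReC (f t) + ReC (g t))) //; last by move=> x _; rewrite ReCD.
rewrite rintD //; [|by move=> x /hf /pcont_Re|by move=> x /hg /pcont_Re].
rewrite (@rint_ext (fun t => ImC (f t + g t)) (fun t => ImC (f t) + ImC (g t))) //; last first.
  by move=> x _; rewrite ImCD.
rewrite rintD //; [|by move=> x /hf /pcont_Im|by move=> x /hg /pcont_Im].
by rewrite !rCD; ring.
Qed.
Lemma cintZ c f a b : a <= b -> pcont_on f a b ->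
  cint (fun t => c * f t) a b = c * cint f a b.
Proof.
move=> ab hf; have hr : forall x, a <= x <= b -> rcont (fun t => ReC (f t)) x.
  by move=> x /hf /pcont_Re.
have hi : forall x, a <= x <= b -> rcont (fun t => ImC (f t)) x by move=> x /hf /pcont_Im.
rewrite /cint.
rewrite (@rint_ext _ (fun t => ReC c * ReC (f t) + (- ImC c) * ImC (f t))) //; last first.
  by move=> x _; rewrite ReCM mulNr.
rewrite rintD //; [|by move=> x /hr /rcontZ|by move=> x /hi /rcontZ].
rewrite (@rint_ext (fun t => ImC (c * f t))
  (fun t => ReC c * ImC (f t) + ImC c * ReC (f t))) //; last first.
  by move=> x _; rewrite ImCM.
rewrite rintD //; [|by move=> x /hi /rcontZ|by move=> x /hr /rcontZ].
rewrite !rintZ // [in RHS](CE c) !rCD !rCM rCN.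
set u := rC _; set A := rC _; set v := rC _; set B := rC _.
have -> : (u + iC * v) * (A + iC * B) = u * A + iC * iC * (v * B) + iC * (u * B + v * A) by ring.
by rewrite iC2; ring.
Qed.
(** The factor 2 comes from bounding the real and imaginary parts separately; it only changes
    constants in later estimates. *)
Lemma cint_bound f a b M : a <= b -> pcont_on f a b ->
  (forall x, a <= x <= b -> cabs (f x) <= M) -> cabs (cint f a b) <= 2 * ((b - a) * M).
Proof.
move=> ab hf hM; apply: le_trans (cabsD _ _) _.
rewrite cabsM cabs_iC mul1r !cabs_rC.
have h1 : `|rint (fun t => ReC (f t)) a b| <= (b - a) * M.
  apply: rint_bound => // x hx; first exact/pcont_Re/hf.
  exact: le_trans (ReC_le _) (hM _ hx).
have h2 : `|rint (fun t => ImC (f t)) a b| <= (b - a) * M.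
  apply: rint_bound => // x hx; first exact/pcont_Im/hf.
  exact: le_trans (ImC_le _) (hM _ hx).
lra.
Qed.
Lemma cint_chasles f a b c : a <= b -> b <= c -> pcont_on f a c ->
  cint f a b + cint f b c = cint f a c.
Proof.
move=> ab bc h; rewrite /cint.
rewrite -(@rint_chasles (fun t => ReC (f t)) a b c) //; last by move=> x /h /pcont_Re.
rewrite -(@rint_chasles (fun t => ImC (f t)) a b c) //; last by move=> x /h /pcont_Im.
by rewrite !rCD; ring.
Qed.
Lemma cint_cst c a b : cint (fun=> c) a b = rC (b - a) * c.
Proof. by rewrite /cint !rint_cst [in RHS](CE c) !rCM; ring. Qed.
Lemma pcont_rC x : pcont rC x.
Proof. by move=> e e0; exists e => // y; rewrite -rCB cabs_rC. Qed.
Lemma pcont_cst c x : pcont (fun=> c) x.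
Proof. by move=> e e0; exists 1 => // y _; rewrite subrr cabs0. Qed.
Lemma pcont_comp (g : C -> C) (f : R -> C) x :
  pcont f x -> ccont g (f x) -> pcont (fun t => g (f t)) x.
Proof.
move=> cf cg e e0; have [d d0 hd] := cg e e0; have [d' d'0 hd'] := cf d d0.
by exists d' => // w /hd' /hd.
Qed.
Lemma pcontZ c f x : pcont f x -> pcont (fun t => c * f t) x.
Proof.
move=> h; apply: (@pcont_comp (fun w => c * w)) => //.
by apply: ccontM; [exact: ccont_cst|exact: ccont_id].
Qed.
Lemma pcontD f g x : pcont f x -> pcont g x -> pcont (fun w => f w + g w) x.
Proof.
move=> cf cg e e0.
have [d d0 hd] := cf (e / 2) ltac:(lra).
have [d' d'0 hd'] := cg (e / 2) ltac:(lra).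
exists (Num.min d d'); first by rewrite lt_min d0.
move=> w; rewrite lt_min => /andP[/hd h1 /hd' h2].
have -> : f w + g w - (f x + g x) = (f w - f x) + (g w - g x) by ring.
by have := cabsD (f w - f x) (g w - g x); lra.
Qed.
Lemma cint_aff c0 c1 a b : a <= b ->
  cint (fun t => c0 + c1 * rC t) a b = rC (b - a) * c0 + c1 * rC ((b ^+ 2 - a ^+ 2) / 2).
Proof.
move=> ab; rewrite cintD //; [|by move=> *; exact: pcont_cst|by move=> *; apply/pcontZ/pcont_rC].
rewrite cint_cst cintZ //; last by move=> *; exact: pcont_rC.
by rewrite /cint rint_id rint_cst mulr0 rC0 mulr0 addr0.
Qed.

Definition Mk (u v : R) : C := rC u + iC * rC v.
Lemma Mk_Re u v : ReC (Mk u v) = u.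
Proof. by rewrite /Mk ReCD ReCM !ReC_rC ImC_rC ReC_iC; ring. Qed.
Lemma Mk_Im u v : ImC (Mk u v) = v.
Proof. by rewrite /Mk ImCD ImCM !ImC_rC ReC_rC ReC_iC ImC_iC; ring. Qed.
Lemma MkE z : Mk (ReC z) (ImC z) = z. Proof. by rewrite /Mk -CE. Qed.
Lemma MkB u v u' v' : Mk u v - Mk u' v' = Mk (u - u') (v - v').
Proof. by rewrite /Mk !rCB; ring. Qed.
Lemma cabs_Mk u v : cabs (Mk u v) <= `|u| + `|v|.
Proof. by have := cabs_le (Mk u v); rewrite Mk_Re Mk_Im. Qed.
Lemma pcont_h g u v : ccont g (Mk u v) -> pcont (fun t => g (Mk t v)) u.
Proof.
move=> h; apply: (@pcont_comp g) => // e e0; exists e => // y hy.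
by rewrite MkB subrr /Mk rC0 mulr0 addr0 cabs_rC.
Qed.
Lemma pcont_v g u v : ccont g (Mk u v) -> pcont (fun t => g (Mk u t)) v.
Proof.
move=> h; apply: (@pcont_comp g) => // e e0; exists e => // y hy.
by rewrite MkB subrr /Mk rC0 add0r cabsM cabs_iC mul1r cabs_rC.
Qed.

Definition rect (x y s t : R) (z : C) : Prop :=
  x <= ReC z <= x + s /\ y <= ImC z <= y + t.
(** The contour integral of g dz around the rectangle, counterclockwise. *)
Definition bint (g : C -> C) (x y s t : R) : C :=
  cint (fun u => g (Mk u y)) x (x + s) - cint (fun u => g (Mk u (y + t))) x (x + s)
  + iC * (cint (fun v => g (Mk (x + s) v)) y (y + t) - cint (fun v => g (Mk x v)) y (y + t)).

Section Bint.
Variables (x y s t : R) (s0 : 0 <= s) (t0 : 0 <= t).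
Let xs : x <= x + s. Proof. by rewrite lerDl. Qed.
Let yt : y <= y + t. Proof. by rewrite lerDl. Qed.

Lemma sides g : (forall z, rect x y s t z -> ccont g z) ->
  [/\ pcont_on (fun u => g (Mk u y)) x (x + s), pcont_on (fun u => g (Mk u (y + t))) x (x + s),
      pcont_on (fun v => g (Mk (x + s) v)) y (y + t) & pcont_on (fun v => g (Mk x v)) y (y + t)].
Proof.
move=> h; split=> u hu; [apply: pcont_h|apply: pcont_h|apply: pcont_v|apply: pcont_v];
  by apply: h; rewrite /rect Mk_Re Mk_Im ?hu ?lexx ?xs ?yt.
Qed.
Lemma bintD f g : (forall z, rect x y s t z -> ccont f z) ->
  (forall z, rect x y s t z -> ccont g z) ->
  bint (fun z => f z + g z) x y s t = bint f x y s t + bint g x y s t.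
Proof.
by move=> /sides[a b c d] /sides[a' b' c' d']; rewrite /bint !cintD //; ring.
Qed.
Lemma bint_bound g M : (forall z, rect x y s t z -> ccont g z) ->
  (forall z, rect x y s t z -> cabs (g z) <= M) ->
  cabs (bint g x y s t) <= 4 * (s + t) * M.
Proof.
move=> /sides[a b c d] hM; rewrite /bint.
have k : forall u v, x <= u <= x + s -> y <= v <= y + t -> cabs (g (Mk u v)) <= M.
  by move=> u v hu hv; apply: hM; rewrite /rect Mk_Re Mk_Im.
have h1 := @cint_bound _ _ _ M xs a; have h2 := @cint_bound _ _ _ M xs b.
have h3 := @cint_bound _ _ _ M yt c; have h4 := @cint_bound _ _ _ M yt d.
move: (h1 ltac:(move=> u hu; apply: k => //; rewrite lexx yt //)).
move: (h2 ltac:(move=> u hu; apply: k => //; rewrite lexx yt //)).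
move: (h3 ltac:(move=> u hu; apply: k => //; rewrite lexx xs //)).
move: (h4 ltac:(move=> u hu; apply: k => //; rewrite lexx xs //)).
move: (cint _ x _) (cint _ x _) (cint _ y _) (cint _ y _) => A B D E.
move=> i1 i2 i3 i4.
have := cabsD (A - B) (iC * (D - E)); have := cabsD A (- B); have := cabsD D (- E).
by rewrite cabsM cabs_iC mul1r !cabsN; lra.
Qed.
(** Disposes of the linear approximation that Goursat's argument subtracts. *)
Lemma bint_aff c0 c1 : bint (fun z => c0 + c1 * z) x y s t = 0.
Proof.
have e1 v : cint (fun u => c0 + c1 * Mk u v) x (x + s) =
   cint (fun u => (c0 + c1 * iC * rC v) + c1 * rC u) x (x + s).
  by apply: cint_ext => // u _; rewrite /Mk; ring.
have e2 u : cint (fun v => c0 + c1 * Mk u v) y (y + t) =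
   cint (fun v => (c0 + c1 * rC u) + (c1 * iC) * rC v) y (y + t).
  by apply: cint_ext => // v _; rewrite /Mk; ring.
rewrite /bint !e1 !e2 !cint_aff //.
have -> : x + s - x = s by ring.
have -> : y + t - y = t by ring.
rewrite !rCD.
by ring.
Qed.
End Bint.

(** Rectangles are written as squares stretched vertically by [h], so that the bisection of squares
    in [bisect2] serves every aspect ratio. The integrals over inner sides cancel. *)
Lemma bint_split g x y s : 0 <= s -> forall h, 0 <= h ->
  (forall z, rect x (h * y) s (h * s) z -> ccont g z) ->
  bint g x (h * y) s (h * s) =
   bint g x (h * y) (s / 2) (h * (s / 2)) + bint g (x + s / 2) (h * y) (s / 2) (h * (s / 2))
   + bint g x (h * (y + s / 2)) (s / 2) (h * (s / 2))
   + bint g (x + s / 2) (h * (y + s / 2)) (s / 2) (h * (s / 2)).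
Proof.
move=> s0 h h0 hg.
have e1 : x + s / 2 + s / 2 = x + s by field.
have e2 : h * y + h * (s / 2) = h * (y + s / 2) by ring.
have e3 : h * (y + s / 2) + h * (s / 2) = h * y + h * s by field.
have hs0 : 0 <= h * s by rewrite mulr_ge0.
rewrite /bint !e1 !e2 !e3.
have k1 v : h * y <= v <= h * y + h * s -> cint (fun u => g (Mk u v)) x (x + s / 2) +
    cint (fun u => g (Mk u v)) (x + s / 2) (x + s) = cint (fun u => g (Mk u v)) x (x + s).
  move=> hv; apply: cint_chasles; [lra|lra|] => u hu; apply/pcont_h/hg.
  by rewrite /rect Mk_Re Mk_Im.
have k2 u : x <= u <= x + s -> cint (fun v => g (Mk u v)) (h * y) (h * (y + s / 2)) +
    cint (fun v => g (Mk u v)) (h * (y + s / 2)) (h * y + h * s) =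
    cint (fun v => g (Mk u v)) (h * y) (h * y + h * s).
  move=> hu; apply: cint_chasles; [nra|nra|] => v hv; apply/pcont_v/hg.
  by rewrite /rect Mk_Re Mk_Im.
rewrite -(k1 (h * y)); last by rewrite lexx; lra.
rewrite -(k1 (h * y + h * s)); last by rewrite lexx; lra.
rewrite -(k2 x); last by rewrite lexx; lra.
rewrite -(k2 (x + s)); last by rewrite lexx; lra.
by ring.
Qed.

(* repeated bisection of a square on which P fails closes in on a point *)
Lemma bisect2 (P : R -> R -> R -> Prop) :
  (forall x y s, 0 < s -> P x y (s / 2) -> P (x + s / 2) y (s / 2) ->
     P x (y + s / 2) (s / 2) -> P (x + s / 2) (y + s / 2) (s / 2) -> P x y s) ->
  forall x y s, 0 < s ->
  (forall p q, x <= p <= x + s -> y <= q <= y + s ->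
    exists2 d, 0 < d & forall x' y' s', 0 < s' < d -> x <= x' -> x' + s' <= x + s ->
      y <= y' -> y' + s' <= y + s -> x' <= p <= x' + s' -> y' <= q <= y' + s' -> P x' y' s') ->
  P x y s.
Proof.
move=> HP x0 y0 s0 s00 Hloc; apply: contrapT => nP0.
pose sz n : R := s0 / 2 ^+ n.
have sz0 n : 0 < sz n by rewrite divr_gt0 // exprn_gt0.
have szS n : sz n.+1 = sz n / 2.
  by rewrite /sz exprS invfM [2^-1 * _]mulrC mulrA.
have next (c : R * R) (s : R) : exists c' : R * R, 0 < s -> ~ P c.1 c.2 s ->
   [/\ ~ P c'.1 c'.2 (s / 2), c.1 <= c'.1 <= c.1 + s / 2 & c.2 <= c'.2 <= c.2 + s / 2].
  have [[sp nP]|?] := pselect (0 < s /\ ~ P c.1 c.2 s); last first.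
    by exists c => ? ?; exfalso; auto.
  have [h1|h1] := pselect (P c.1 c.2 (s / 2)); last first.
    by exists (c.1, c.2) => _ _; split => //=; lra.
  have [h2|h2] := pselect (P (c.1 + s / 2) c.2 (s / 2)); last first.
    by exists (c.1 + s / 2, c.2) => _ _; split => //=; lra.
  have [h3|h3] := pselect (P c.1 (c.2 + s / 2) (s / 2)); last first.
    by exists (c.1, c.2 + s / 2) => _ _; split => //=; lra.
  have [h4|h4] := pselect (P (c.1 + s / 2) (c.2 + s / 2) (s / 2)); last first.
    by exists (c.1 + s / 2, c.2 + s / 2) => _ _; split => //=; lra.
  by exfalso; apply: nP; apply: HP.
pose nx c s := sval (cid (next c s)).
pose fix u n : R * R := if n is m.+1 then nx (u m) (sz m) else (x0, y0).
have uP n : ~ P (u n).1 (u n).2 (sz n).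
  elim: n => [|n IH]; first by rewrite /sz expr0 divr1.
  by rewrite /= szS /nx; case: cid => c' /= /(_ (sz0 n) IH) [].
have uS n : (u n).1 <= (u n.+1).1 <= (u n).1 + sz n / 2 /\
            (u n).2 <= (u n.+1).2 <= (u n).2 + sz n / 2.
  by rewrite /= /nx; case: cid => c' /= /(_ (sz0 n) (uP n)) [].
have mono k n : [/\ (u n).1 <= (u (n + k)%N).1, (u (n + k)%N).1 + sz (n + k)%N <= (u n).1 + sz n,
    (u n).2 <= (u (n + k)%N).2 & (u (n + k)%N).2 + sz (n + k)%N <= (u n).2 + sz n].
  elim: k => [|k [i1 i2 i3 i4]]; first by rewrite addn0.
  by rewrite addnS; have [] := uS (n + k)%N; rewrite szS => a b; split; lra.
have cmp n k : (u n).1 <= (u k).1 + sz k /\ (u n).2 <= (u k).2 + sz k.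
  case: (leqP n k) => nk.
    have [h1 _ h2 _] := mono (k - n)%N n; rewrite subnKC // in h1 h2.
    by have := sz0 k; split; lra.
  have [_ h1 _ h2] := mono (n - k)%N k; rewrite subnKC ?(ltnW nk) // in h1 h2.
  by have := sz0 n; split; lra.
pose X := [set (u n).1 | n in setT]; pose Y := [set (u n).2 | n in setT].
have hX k n : (u n).1 <= sup X <= (u k).1 + sz k.
  apply/andP; split.
    apply: sup_upper_bound; last by exists n.
    by split; [exists (u 0%N).1; exists 0%N|exists ((u k).1 + sz k) => _ [m _ <-]; exact: (cmp m k).1].
  apply: sup_le_ub; first by exists (u 0%N).1; exists 0%N.
  by move=> _ [m _ <-]; exact: (cmp m k).1.
have hY k n : (u n).2 <= sup Y <= (u k).2 + sz k.
  apply/andP; split.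
    apply: sup_upper_bound; last by exists n.
    by split; [exists (u 0%N).2; exists 0%N|exists ((u k).2 + sz k) => _ [m _ <-]; exact: (cmp m k).2].
  apply: sup_le_ub; first by exists (u 0%N).2; exists 0%N.
  by move=> _ [m _ <-]; exact: (cmp m k).2.
have sz00 : sz 0%N = s0 by rewrite /sz expr0 divr1.
have := hX 0%N 0%N; have := hY 0%N 0%N; rewrite sz00 /= => hy hx.
have [d d0 hd] := Hloc _ _ hx hy.
have [n hn] : exists n, sz n < d.
  exists (Num.truncn (s0 / d)); rewrite /sz ltr_pdivrMr ?exprn_gt0 //.
  have h := truncnS_gt (s0 / d); rewrite ltr_pdivrMr // in h.
  apply: (lt_le_trans h); rewrite mulrC ler_pM2l //.
  by rewrite -natrX ler_nat ltn_expl.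
have [a1 a2 a3 a4] := mono n 0%N; rewrite add0n sz00 /= in a1 a2 a3 a4.
by apply: (uP n); apply: hd => //; rewrite sz0.
Qed.

(** The bound by e times the squared side adds up exactly under bisection into four squares. On
    small squares around a point it holds because only the error of the linear approximation
    contributes. *)
Lemma goursat g (x y s t : R) : 0 < s -> 0 < t ->
  (forall z, rect x y s t z -> exists d, cd g z d) -> bint g x y s t = 0.
Proof.
move=> s0 t0 hg; apply/eqP; rewrite -cabs_eq0 eq_le cabs_ge0 andbT.
pose h := t / s; have h0 : 0 < h by rewrite divr_gt0.
have eh u : h * (u / h) = u by rewrite mulrC divfK // gt_eqF.
have es : h * s = t by rewrite /h divfK // gt_eqF.
have hc z : rect x y s t z -> ccont g z by move=> /hg[d /cd_cont].
suff main e : 0 < e -> cabs (bint g x y s t) <= e * s ^+ 2.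
  rewrite leNgt; apply/negP => hp.
  have := main (cabs (bint g x y s t) / (2 * s ^+ 2)) _.
  rewrite divr_gt0 ?mulr_gt0 ?exprn_gt0 // => /(_ isT).
  have -> : cabs (bint g x y s t) / (2 * s ^+ 2) * s ^+ 2 = cabs (bint g x y s t) / 2.
    by field; rewrite gt_eqF.
  lra.
move=> e0.
pose P x' y' s' := x <= x' -> x' + s' <= x + s -> y / h <= y' -> y' + s' <= y / h + s ->
  cabs (bint g x' (h * y') s' (h * s')) <= e * s' ^+ 2.
have sub x' y' s' z : 0 < s' -> x <= x' -> x' + s' <= x + s -> y / h <= y' -> y' + s' <= y / h + s ->
    rect x' (h * y') s' (h * s') z -> rect x y s t z.
  move=> s'0 i1 i2 i3 i4 [/andP[j1 j2] /andP[j3 j4]].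
  have k1 : y <= h * y' by rewrite -(eh y) ler_pM2l.
  have k2 : h * y' + h * s' <= y + t.
    by move: i4; rewrite -(ler_pM2l h0) !mulrDr eh es.
  by split; apply/andP; split; lra.
have Pall : P x (y / h) s.
  apply: bisect2 => //.
    move=> x' y' s' s'0 p1 p2 p3 p4 i1 i2 i3 i4.
    rewrite bint_split ?(ltW s'0) ?(ltW h0) //; last by move=> z /sub /hc; apply; lra.
    have q1 := p1 ltac:(lra) ltac:(lra) ltac:(lra) ltac:(lra).
    have q2 := p2 ltac:(lra) ltac:(lra) ltac:(lra) ltac:(lra).
    have q3 := p3 ltac:(lra) ltac:(lra) ltac:(lra) ltac:(lra).
    have q4 := p4 ltac:(lra) ltac:(lra) ltac:(lra) ltac:(lra).
    move: q1 q2 q3 q4.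
     move: (bint _ _ _ _ _) (bint _ _ _ _ _) (bint _ _ _ _ _) (bint _ _ _ _ _) => E D B A.
     have := cabsD (A + B + D) E; have := cabsD (A + B) D; have := cabsD A B.
     have -> : e * (s' / 2) ^+ 2 = e * s' ^+ 2 / 4 by field.
     by move=> *; lra.
   move=> p q hp hq.
  have [d hd] : exists d, cd g (Mk p (h * q)) d.
    apply: hg; rewrite /rect Mk_Re Mk_Im; split => //; move: hq => /andP[h1 h2].
    by move: h2; rewrite -(ler_pM2l h0) mulrDr eh es => ->; rewrite andbT -(eh y) ler_pM2l.
  (* The factor 4 (1 + h) s' of [bint_bound] times the error e' (1 + h) s' is then exactly e
     s'^2. *)
  pose e' := e / (4 * (1 + h) ^+ 2).
  have h1 : 0 < 1 + h by lra.
  have e'0 : 0 < e' by rewrite divr_gt0 // mulr_gt0 // exprn_gt0.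
  have [dl dl0 hdl] := (cdP _ _ _).1 hd e' e'0.
  exists (dl / (1 + h)); first by rewrite divr_gt0.
  move=> x' y' s' /andP[s'0 s'd] i1 i2 i3 i4 j1 j2 _ _ _ _.
  rewrite ltr_pdivlMr // in s'd.
  set p0 := Mk p (h * q) in hd hdl.
  pose r z := g z - g p0 - d * (z - p0).
  have hs'0 : 0 < h * s' by rewrite mulr_gt0.
  have rc z : rect x' (h * y') s' (h * s') z -> ccont r z.
    move=> /(sub _ _ _ _ s'0 i1 i2 i3 i4) /hg [dz /cd_cont cz].
    apply: (@ccont_near (fun z => g z + ((- g p0 + d * p0) + (- d) * z)) _ _ 1) => //.
      by move=> w _; rewrite /r; ring.
    apply: ccontD => //; apply: ccontD; first exact: ccont_cst.
    by apply: ccontM; [exact: ccont_cst|exact: ccont_id].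
  have -> : bint g x' (h * y') s' (h * s') = bint r x' (h * y') s' (h * s').
    have -> : bint g x' (h * y') s' (h * s') =
       bint (fun z => r z + ((g p0 - d * p0) + d * z)) x' (h * y') s' (h * s').
      congr (bint _ _ _ _ _); apply: funext => z; rewrite /r; ring.
    rewrite bintD ?(ltW s'0) ?(ltW hs'0) //; first by rewrite bint_aff ?(ltW s'0) ?(ltW hs'0) // addr0.
    move=> z _; apply: ccontD; first exact: ccont_cst.
    by apply: ccontM; [exact: ccont_cst|exact: ccont_id].
  have bd : cabs (bint r x' (h * y') s' (h * s')) <= 4 * (s' + h * s') * (e' * (s' * (1 + h))).
    apply: bint_bound; rewrite ?(ltW s'0) ?(ltW hs'0) //.
    move=> z [hz1 hz2].
    have zp : cabs (z - p0) <= s' * (1 + h).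
      rewrite -(MkE z) MkB; apply: (le_trans (cabs_Mk _ _)).
      have : `|ReC z - p| <= s' by rewrite ler_norml; lra.
      have : `|ImC z - h * q| <= h * s'.
        have : h * y' <= h * q <= h * (y' + s') by rewrite !ler_pM2l.
        by rewrite ler_norml mulrDr; lra.
      by lra.
    apply: le_trans (hdl _ _) _; first by apply: le_lt_trans s'd.
    by rewrite ler_pM2l.
  apply: (le_trans bd); rewrite le_eqVlt; apply/orP; left; apply/eqP.
  by rewrite /e'; field; rewrite gt_eqF.
have := Pall (lexx _) (lexx _) (lexx _) (lexx _).
by rewrite eh es.
Qed.

(** For g of period 1, the integral of g dq / (2 pi i q) over the circle of radius exp(- 2 pi y),
    where q = [ee w]. *)
Definition mean (g : C -> C) (y : R) : C := cint (fun u => g (Mk u y)) 0 1.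

(** The vertical sides of a period rectangle cancel, so Goursat's theorem compares the horizontal
    ones. *)
Lemma mean_strip g (y1 y2 : R) : y1 <= y2 ->
  (forall z, g (z + 1) = g z) ->
  (forall z, y1 <= ImC z <= y2 -> exists d, cd g z d) -> mean g y1 = mean g y2.
Proof.
rewrite le_eqVlt => /orP[/eqP -> //|y12] per hg.
have : bint g 0 y1 1 (y2 - y1) = 0.
  apply: goursat => //; first by rewrite subr_gt0.
  move=> z [_ h]; apply: hg; by rewrite addrC subrK in h.
have -> : bint g 0 y1 1 (y2 - y1) = mean g y1 - mean g y2
    + iC * (cint (fun v => g (Mk 1 v)) y1 y2 - cint (fun v => g (Mk 0 v)) y1 y2).
  by rewrite /bint add0r (_ : y1 + (y2 - y1) = y2) //; ring.
rewrite (@cint_ext (fun v => g (Mk 1 v)) (fun v => g (Mk 0 v))) ?(ltW y12) //; last first.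
  by move=> x _; rewrite -(per (Mk 0 x)); congr g; rewrite /Mk rC0 rC1; ring.
by rewrite subrr mulr0 addr0 => /eqP; rewrite subr_eq0 => /eqP.
Qed.

(** * The exponential function and the argument *)
Lemma is_derive_eps (f : R -> R) (x d : R) : is_derive (x : R^o) (1 : R^o) (f : R^o -> R^o) d ->
  forall e, 0 < e -> exists2 dl, 0 < dl &
    forall h, `|h| < dl -> `|f (x + h) - f x - d * h| <= e * `|h|.
Proof.
move=> [df ed] e e0.
have /cvgrPdist_le /= /(_ _ e0) [dl /= dl0 hd] := df.
have eL : lim _ = d := ed; rewrite {}eL in hd.
exists dl => // h hh; have [->|h0] := eqVneq h 0.
  by rewrite addr0 subrr mulr0 subr0 normr0 mulr0.
have := hd h; rewrite /= sub0r normrN => /(_ hh h0).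
rewrite [h *: _]mulr1 -normrN opprB => hq.
have -> : f (x + h) - f x - d * h = (h^-1 * (f (h + x) - f x) - d) * h.
  by rewrite [h + x]addrC; field.
by rewrite normrM ler_wpM2r.
Qed.

Lemma cexp_Re z : ReC (cexp z) = expR (ReC z) * cos (ImC z).
Proof. rewrite /cexp ReCM ReCD ReCM ImCD ImCM !ReC_rC !ImC_rC ReC_iC ImC_iC; ring. Qed.
Lemma cexp_Im z : ImC (cexp z) = expR (ReC z) * sin (ImC z).
Proof. rewrite /cexp ImCM ReCD ReCM ImCD ImCM !ReC_rC !ImC_rC ReC_iC ImC_iC; ring. Qed.
Lemma cexpD z w : cexp (z + w) = cexp z * cexp w.
Proof.
apply: eqReIm; rewrite ?(ReCM (cexp z)) ?(ImCM (cexp z)) !cexp_Re !cexp_Im ReCD ImCD exp.expRD ?trigo.cosD ?trigo.sinD; ring.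
Qed.
Lemma cexp0 : cexp 0 = 1.
Proof. by apply: eqReIm; rewrite ?cexp_Re ?cexp_Im exp.expR0 ?cos0 ?sin0 mul1r. Qed.
Lemma cabs_cexp z : cabs (cexp z) = expR (ReC z).
Proof.
apply/eqP; rewrite -(eqrXn2 (n := 2)) ?cabs_ge0 ?expR_ge0 //; apply/eqP.
rewrite cabs2 cexp_Re cexp_Im !exprMn -mulrDr cos2Dsin2; ring.
Qed.
Lemma cexp_neq0 z : cexp z != 0.
Proof. by rewrite -cabs_eq0 cabs_cexp expR_eq0. Qed.
Lemma cexpN z : cexp (- z) = (cexp z)^-1.
Proof. by apply: (mulfI (cexp_neq0 z)); rewrite -cexpD subrr cexp0 mulfV ?cexp_neq0. Qed.
Lemma cexp_nat n z : cexp (n%:R * z) = cexp z ^+ n.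
Proof.
elim: n => [|n IH]; first by rewrite mul0r cexp0.
by rewrite -natr1 mulrDl mul1r cexpD IH exprSr.
Qed.

Lemma cd_cexp0 : cd cexp 0 1.
Proof.
apply/cdP => e e0.
(* The errors [i1], [i4], [i5] and [i6] below add up to 6 e1 |w|. *)
pose e1 := Num.min 1 (e / 6); have e10 : 0 < e1 by rewrite lt_min ltr01 divr_gt0.
have e1e : 6 * e1 <= e by rewrite mulrC -ler_pdivlMr // ge_min lexx orbT.
have e11 : e1 <= 1 by rewrite ge_min lexx.
have [d1 d10 h1] := is_derive_eps (is_derive_expR 0) e10.
have [d2 d20 h2] := is_derive_eps (is_derive_cos 0) e10.
have [d3 d30 h3] := is_derive_eps (is_derive_sin 0) e10.
pose d := Num.min (Num.min d1 (Num.min d2 d3)) (e1 / 2).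
have d0 : 0 < d by rewrite !lt_min d10 d20 d30 divr_gt0.
exists d => // w; rewrite subr0 cexp0 mul1r !lt_min => /andP[/and3P[k1 k2 k3] k4].
set a := ReC w; set b := ImC w.
have ha : `|a| <= cabs w := ReC_le w; have hb : `|b| <= cabs w := ImC_le w.
have := h1 a (le_lt_trans ha k1); have := h2 b (le_lt_trans hb k2).
have := h3 b (le_lt_trans hb k3).
rewrite !add0r exp.expR0 cos0 sin0 !(mul0r, mul1r, oppr0, addr0) => g3 g2 g1.
have g0 : `|expR a| <= 2 /\ `|expR a - 1| <= 2 * `|a|.
  have hh : `|expR a - 1| <= 2 * `|a|.
    have -> : expR a - 1 = (expR a - 1 - a) + a by ring.
    by apply: (le_trans (ler_normD _ _)); have := normr_ge0 a; nra.
  split => //; have -> : expR a = (expR a - 1) + 1 by ring.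
  by apply: (le_trans (ler_normD _ _)); rewrite normr1; lra.
apply: (le_trans (cabs_le _)).
rewrite ReCD ReCD !ReCN ImCD ImCD !ImCN cexp_Re cexp_Im -/a -/b.
have -> : ReC 1 = 1 by []. have -> : ImC 1 = 0 by [].
have -> : expR a * cos b - 1 - a = (expR a - 1 - a) + expR a * (cos b - 1) by ring.
have -> : expR a * sin b - 0 - b = expR a * (sin b - b) + (expR a - 1) * b by ring.
have := ler_normD (expR a - 1 - a) (expR a * (cos b - 1)).
have := ler_normD (expR a * (sin b - b)) ((expR a - 1) * b).
rewrite !normrM.
case: g0 => g0 g0'.
have w0 := cabs_ge0 w.
have i1 : `|expR a - 1 - a| <= e1 * cabs w by apply: (le_trans g1); rewrite ler_pM2l.
have i2 : `|cos b - 1| <= e1 * cabs w by apply: (le_trans g2); rewrite ler_pM2l.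
have i3 : `|sin b - b| <= e1 * cabs w by apply: (le_trans g3); rewrite ler_pM2l.
have i4 : `|expR a| * `|cos b - 1| <= 2 * (e1 * cabs w) by apply: ler_pM.
have i5 : `|expR a| * `|sin b - b| <= 2 * (e1 * cabs w) by apply: ler_pM.
have i6 : `|expR a - 1| * `|b| <= e1 * cabs w.
  by apply: ler_pM => //; apply: (le_trans g0'); lra.
have : 6 * e1 * cabs w <= e * cabs w by rewrite ler_wpM2r.
move=> *; lra.
Qed.
Lemma cd_cexp z : cd cexp z (cexp z).
Proof.
have h : cd (fun w => w - z) z 1.
  by apply: cd_eq (cdB (cd_id z) (cd_cst z z)) _; rewrite subr0.
have h2 := cd_comp (g := cexp) h; rewrite subrr in h2.
apply: (cd_ext (f := fun w => cexp z * cexp (w - z))).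
  by move=> w; rewrite -cexpD addrC subrK.
by apply: cd_eq (cdZ (cexp z) (h2 _ cd_cexp0)) _; rewrite !mulr1.
Qed.

Lemma pi0 : 0 < (pi : R). Proof. exact: pi_gt0. Qed.
Lemma twopi_mul_eq0 (x : R) : 2 * pi * x = 0 -> x = 0.
Proof.
move/eqP; rewrite mulf_eq0 => /orP[/eqP h|/eqP //]; have := pi0; lra.
Qed.
Definition tpi : C := rC (2 * pi) * iC.
Lemma tpi_neq0 : tpi != 0.
Proof. by rewrite mulf_neq0 ?iC_neq0 // rC_eq0 gt_eqF // mulr_gt0 ?pi0. Qed.
Lemma eeE z : ee z = cexp (tpi * z). Proof. by []. Qed.
Lemma eeD z w : ee (z + w) = ee z * ee w. Proof. by rewrite !eeE mulrDr cexpD. Qed.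
Lemma ee0 : ee 0 = 1. Proof. by rewrite eeE mulr0 cexp0. Qed.
Lemma ee_neq0 z : ee z != 0. Proof. exact: cexp_neq0. Qed.
Lemma eeN z : ee (- z) = (ee z)^-1. Proof. by rewrite eeE mulrN cexpN. Qed.
Lemma ee_nat n z : ee (n%:R * z) = ee z ^+ n.
Proof. by rewrite !eeE mulrCA cexp_nat. Qed.
Lemma tpi_Re z : ReC (tpi * z) = - (2 * pi * ImC z).
Proof. by rewrite ReCM /tpi ReCM ImCM !ReC_rC !ImC_rC ReC_iC ImC_iC; ring. Qed.
Lemma tpi_Im z : ImC (tpi * z) = 2 * pi * ReC z.
Proof. by rewrite ImCM /tpi ReCM ImCM !ReC_rC !ImC_rC ReC_iC ImC_iC; ring. Qed.
Lemma cabs_ee z : cabs (ee z) = expR (- (2 * pi * ImC z)).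
Proof. by rewrite eeE cabs_cexp tpi_Re. Qed.
Lemma ee1 : ee 1 = 1.
Proof.
rewrite eeE; have -> : tpi * 1 = Mk 0 (2 * pi) by rewrite /tpi /Mk rC0; ring.
apply: eqReIm; rewrite ?cexp_Re ?cexp_Im Mk_Re Mk_Im exp.expR0 mul1r.
  by rewrite mulr_natl cos2pi.
by rewrite mulr_natl sin2pi.
Qed.
Lemma eeD1 z : ee (z + 1) = ee z. Proof. by rewrite eeD ee1 mulr1. Qed.
Lemma ee_int n : ee n%:~R = 1.
Proof.
have h (k : nat) : ee k%:R = 1 by rewrite -[k%:R]mulr1 ee_nat ee1 expr1n.
case: n => k; first exact: h.
by rewrite NegzE mulrNz eeN h invr1.
Qed.
Lemma cd_ee z : cd ee z (tpi * ee z).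
Proof.
by apply: cd_eq (cd_comp (cdZ tpi (cd_id z)) (cd_cexp _)) _; rewrite mulr1 mulrC.
Qed.
Lemma cd_eeZ a z : cd (fun z => ee (a * z)) z (tpi * a * ee (a * z)).
Proof. by apply: cd_eq (cd_comp (cdZ a (cd_id z)) (cd_ee _)) _; ring. Qed.
Lemma cabs_ee_lt1 z : (cabs (ee z) < 1) = (0 < ImC z).
Proof. by rewrite cabs_ee expR_lt1 oppr_lt0 pmulr_rgt0 // mulr_gt0 ?pi0. Qed.

Lemma ee_eq1 z : ee z = 1 -> exists n : int, z = n%:~R.
Proof.
move=> h; have im : ImC z = 0.
  have := cabs_ee z; rewrite h cabs1 => e1; have /eqP : - (2 * pi * ImC z) = 0.
    by apply: expR_inj; rewrite exp.expR0.
  by rewrite oppr_eq0 => /eqP /twopi_mul_eq0.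
have zr : z = rC (ReC z) by rewrite {1}(CE z) im rC0 mulr0 addr0.
pose n := Num.floor (ReC z); pose t := ReC z - n%:~R.
have t01 : 0 <= t < 1.
  by rewrite /t subr_ge0 floor_le_tmp ltrBlDl -[1]/(1%:~R) -intrD floorD1_gt.
suff t0 : t = 0.
  exists n; rewrite zr; have -> : ReC z = n%:~R by apply/eqP; rewrite -subr_eq0 -/t t0.
  by rewrite /rC rmorph_int.
have et : ee (rC t) = 1.
  rewrite /t rCB eeD -zr h mul1r eeN.
  by rewrite /rC rmorph_int ee_int invr1.
have ct : cos (2 * pi * t) = 1.
  have := congr1 ReC et; rewrite eeE cexp_Re tpi_Re tpi_Im ImC_rC mulr0 oppr0 exp.expR0 mul1r.
  exact.
case/andP: t01 => t0 t1; have p0 := pi0.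
(* [cos] is injective on [0, pi] only; a fractional part above 1/2 is reflected to 1 - t. *)
have [th|th] := leP t 2^-1.
  have : 2 * pi * t = 0.
    apply: cos_inj; rewrite ?ct ?cos0 // !in_itv /= ?lexx ?pi_ge0 //; nra.
  exact: twopi_mul_eq0.
have : 2 * pi * (1 - t) = 0.
  apply: cos_inj; rewrite ?cos0 ?in_itv /= ?lexx ?pi_ge0 //; first by nra.
  have -> : 2 * pi * (1 - t) = - (2 * pi * t) + pi *+ 2 by rewrite mulr2n; ring.
  by rewrite cosD2pi cosN ct.
by move/twopi_mul_eq0; lra.
Qed.

Lemma atanV t : 0 < t -> atan t^-1 = pi / 2 - atan t :> R.
Proof.
move=> t0; have p0 := pi0.
have a0 : 0 < atan t by rewrite -atan0 lt_atan.
have a1 := atan_ltpi2 t.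
have c0 : cos (atan t) != 0 by rewrite gt_eqF // cos_gt0_pihalf //; apply/andP; split; lra.
rewrite -[RHS]tanK ?in_itv /=; last by apply/andP; split; lra.
congr atan; rewrite /tan sinB cosB sin_pihalf cos_pihalf !mul0r !mul1r subr0 add0r.
by rewrite -[t in LHS]atanK /tan invf_div.
Qed.

Lemma cos_atan_div (x y : R) : 0 < x ->
  Num.sqrt (x ^+ 2 + y ^+ 2) * cos (atan (y / x)) = x /\
  Num.sqrt (x ^+ 2 + y ^+ 2) * sin (atan (y / x)) = y.
Proof.
move=> x0; have xn : x != 0 by rewrite gt_eqF.
have e : Num.sqrt (x ^+ 2 + y ^+ 2) = x * Num.sqrt (1 + (y / x) ^+ 2).
  have -> : x ^+ 2 + y ^+ 2 = x ^+ 2 * (1 + (y / x) ^+ 2) by field.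
  by rewrite sqrtrM ?sqr_ge0 // sqrtr_sqr gtr0_norm.
have s0 : Num.sqrt (1 + (y / x) ^+ 2) != 0.
  by rewrite gt_eqF // sqrtr_gt0; have := sqr_ge0 (y / x); lra.
have c : Num.sqrt (x ^+ 2 + y ^+ 2) * cos (atan (y / x)) = x by rewrite e cos_atan mulfK.
split => //.
have c0 : cos (atan (y / x)) != 0 by rewrite cos_atan invr_neq0.
have -> : sin (atan (y / x)) = y / x * cos (atan (y / x)).
  by rewrite -{2}[y / x]atanK /tan divfK.
by rewrite mulrCA c divfK.
Qed.

Lemma Logc_Re w : ReC (Logc w) = ln (cabs w).
Proof. by case: w => x y; rewrite /Logc ReCD ReCM !ReC_rC ImC_rC ReC_iC /cabs /=; ring. Qed.
Lemma Logc_Im w : ImC (Logc w) = Arg w.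
Proof. by rewrite /Logc ImCD ImCM !ReC_rC !ImC_rC ReC_iC ImC_iC /=; ring. Qed.

Lemma Arg_polar w : w != 0 -> cabs w * cos (Arg w) = ReC w /\ cabs w * sin (Arg w) = ImC w.
Proof.
case: w => x y w0; rewrite /cabs /Arg /=.
have [x0|] := ltP 0 x; first exact: cos_atan_div.
rewrite le_eqVlt => /orP[/eqP xe|x0].
  move: w0; rewrite xe ltxx => w0.
  have y0 : y != 0 by apply: contra w0 => /eqP ->.
  rewrite expr0n add0r sqrtr_sqr.
  have [yp|] := ltP 0 y; first by rewrite cos_pihalf sin_pihalf mulr0 mulr1 gtr0_norm.
  rewrite le_eqVlt (negbTE y0) /= => yn; rewrite yn cosN sinN cos_pihalf sin_pihalf mulr0.
  by rewrite ltr0_norm // mulrNN mulr1.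
have [h1 h2] := @cos_atan_div (- x) (- y) ltac:(lra).
rewrite !sqrrN divrNN in h1 h2; rewrite x0.
case: ifP => _; first by rewrite cosDpi sinDpi !mulrN h1 h2 !opprK.
rewrite cosB sinB cospi sinpi !mulr0 subr0 addr0 !mulrN1 !mulrN h1 h2 !opprK.
by [].
Qed.
Lemma cexp_Logc w : w != 0 -> cexp (Logc w) = w.
Proof.
move=> w0; have [h1 h2] := Arg_polar w0.
by apply: eqReIm; rewrite ?cexp_Re ?cexp_Im Logc_Re Logc_Im lnK ?posrE ?cabs_gt0.
Qed.
Lemma ee_surj w : w != 0 -> exists z, ee z = w.
Proof.
move=> w0; exists (Logc w / tpi).
by rewrite eeE mulrC divfK ?tpi_neq0 // cexp_Logc.
Qed.

(** Off the real axis the branches of [Arg] collapse into one formula, visibly continuous across the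
    imaginary axis. This covers [jac g z], which is nonreal on the half-plane unless c = 0. *)
Lemma Arg_nonreal w : ImC w != 0 ->
  Arg w = (if 0 < ImC w then pi / 2 else - (pi / 2)) - atan (ReC w / ImC w).
Proof.
case: w => x y /= y0; rewrite /Arg /=.
have inv : forall t : R, 0 < t -> atan t^-1 = pi / 2 - atan t by exact: atanV.
have yn : ~~ (0 < y) -> y < 0 by rewrite -leNgt le_eqVlt (negbTE y0).
have [x0|] := ltP 0 x.
  case: ifPn => [yp|/yn yn'].
    have := inv (x / y) ltac:(by rewrite divr_gt0); rewrite invf_div => ->; ring.
  have := inv (x / - y) ltac:(by rewrite divr_gt0 // oppr_gt0).
  rewrite invf_div mulNr invrN mulrN !atanN => h; lra.
rewrite le_eqVlt => /orP[/eqP xe|x0].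
  rewrite xe ltxx mul0r atan0 subr0; case: ifPn => // /yn ->; ring.
rewrite x0 le_eqVlt eq_sym (negbTE y0) /=.
case: ifPn => [yp|/yn yn'].
  have := inv (- x / y) ltac:(by rewrite divr_gt0 // oppr_gt0).
  rewrite invf_div invrN mulrN mulNr !atanN => h; lra.
have := inv (x / y) ltac:(by rewrite nmulr_lgt0 // invr_lt0).
rewrite invf_div => h; lra.
Qed.

Lemma eps_eq0 (c : C) : (forall e, 0 < e -> cabs c <= e) -> c = 0.
Proof.
move=> h; apply/eqP; rewrite -cabs_eq0 eq_le cabs_ge0 andbT leNgt; apply/negP => c0.
by have := h (cabs c / 2) ltac:(lra); lra.
Qed.

Lemma line_bound (u : C -> C) y : (forall t, ccont u (Mk t y)) ->
  exists2 M, 0 < M & forall t, 0 <= t <= 1 -> cabs (u (Mk t y)) <= M.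
Proof.
move=> hu; pose f t := cabs (u (Mk t y)).
have cf : continuous (f : R^o -> R^o).
  move=> t; apply/cvgrPdist_lt => /= e e0.
  have [d d0 hd] := pcont_h (hu t) e0.
  exists d => // s /=; rewrite distrC => /hd hs; apply: le_lt_trans hs.
  rewrite ler_norml /f; have := cabsB_ge (u (Mk t y)) (u (Mk s y)).
  have := cabsB_ge (u (Mk s y)) (u (Mk t y)).
  by rewrite [cabs (u (Mk t y) - _)]cabsB; move=> *; apply/andP; split; lra.
have [c _ hc] := @EVT_max _ (f : R^o -> R^o) 0 1 ler01 (continuous_subspaceT cf).
exists (f c + 1); first by have := cabs_ge0 (u (Mk c y)); rewrite -/(f c); lra.
by move=> t ht; have := hc t; rewrite in_itv /= => /(_ ht); rewrite /f; lra.
Qed.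

Lemma mean_bound g y M : (forall u, ccont g (Mk u y)) ->
  (forall u, 0 <= u <= 1 -> cabs (g (Mk u y)) <= M) -> cabs (mean g y) <= 2 * M.
Proof.
move=> cg hM; have := @cint_bound (fun u => g (Mk u y)) 0 1 M ler01.
by rewrite subr0 mul1r; apply => // u _; exact: pcont_h.
Qed.
Lemma meanD f g y : (forall u, ccont f (Mk u y)) -> (forall u, ccont g (Mk u y)) ->
  mean (fun w => f w + g w) y = mean f y + mean g y.
Proof. by move=> hf hg; apply: cintD => // u _; exact: pcont_h. Qed.
Lemma meanZ c f y : (forall u, ccont f (Mk u y)) -> mean (fun w => c * f w) y = c * mean f y.
Proof. by move=> hf; apply: cintZ => // u _; exact: pcont_h. Qed.
Lemma mean_cst c y : mean (fun=> c) y = c.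
Proof. by rewrite /mean cint_cst subr0 rC1 mul1r. Qed.
Lemma mean_ext f g y : (forall u, f (Mk u y) = g (Mk u y)) -> mean f y = mean g y.
Proof. by move=> h; apply: cint_ext. Qed.

(** Carries a mean across a height at which the function is known to be continuous but not
    differentiable, as in [cauchy_H]; the proof is uniform continuity on a period rectangle. *)
Lemma mean_cont g c d : (forall z, c <= ImC z <= d -> ccont g z) ->
  forall y e, c <= y <= d -> 0 < e -> exists2 dl, 0 < dl &
    forall v, c <= v <= d -> `|v - y| < dl -> cabs (mean g v - mean g y) <= e.
Proof.
move=> hg y e hy e0.
have aux (p : C -> R) : (forall z w, `|p z - p w| <= cabs (z - w)) ->
    exists2 dl, 0 < dl & forall x v, 0 <= x <= 1 -> c <= v <= d -> `|v - y| < dl ->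
      `|p (g (Mk x v)) - p (g (Mk x y))| < e / 4.
  move=> hp; have [|dl dl0 hdl] := @unif_cont2 (fun x v => p (g (Mk x v))) 0 1 c d _ (e / 4) ltac:(lra).
    move=> x v hx hv e' e'0.
    have [|dl dl0 hdl] := hg (Mk x v) _ e' e'0; first by rewrite Mk_Im.
    exists (dl / 2); first by rewrite divr_gt0.
    move=> u v' hu hv'; apply: (le_lt_trans (hp _ _)); apply: hdl.
    by rewrite MkB; apply: (le_lt_trans (cabs_Mk _ _)); lra.
  by exists dl => // x v hx hv hvy; apply: hdl.
have [d1 d10 h1] := aux ReC (fun z w => ltac:(rewrite -ReCN -ReCD; exact: ReC_le)).
have [d2 d20 h2] := aux ImC (fun z w => ltac:(rewrite -ImCN -ImCD; exact: ImC_le)).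
exists (Num.min d1 d2); first by rewrite lt_min d10.
move=> v hv; rewrite lt_min => /andP[k1 k2].
have cv w : c <= w <= d -> forall u, ccont g (Mk u w).
  by move=> hw u; apply: hg; rewrite Mk_Im.
have -> : mean g v - mean g y = cint (fun u => g (Mk u v) + -1 * g (Mk u y)) 0 1.
  rewrite cintD //; [rewrite cintZ // ?mulN1r //| |] => u _; rewrite -/(mean g y);
    [exact/pcont_h/cv|exact/pcont_h/cv|exact/pcontZ/pcont_h/cv].
apply: (le_trans (@cint_bound _ 0 1 (e / 2) ler01 _ _)); last lra.
  by move=> u _; apply: pcontD; [exact/pcont_h/cv|exact/pcontZ/pcont_h/cv].
move=> u hu; rewrite mulN1r; apply: (le_trans (cabs_le _)).
rewrite ReCD ReCN ImCD ImCN.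
have := h1 u v hu hv k1; have := h2 u v hu hv k2; lra.
Qed.

(** * Cauchy's formula in the half-plane and in the disc *)
Definition holH (f : C -> C) := forall z, Hp z -> exists d, cd f z d.
Definition per1 (f : C -> C) := forall z, f (z + 1) = f z.
(** In q = [ee z] this says that q f tends to 0 at the cusp, the condition for a removable
    singularity. *)
Definition decay (f : C -> C) := forall e, 0 < e ->
  exists Y, forall z, Y < ImC z -> cabs (ee z * f z) <= e.

Lemma per1_int f (n : int) z : per1 f -> f (z + n%:~R) = f z.
Proof.
move=> h; have hn (k : nat) w : f (w + k%:R) = f w.
  by elim: k => [|k IH]; rewrite ?addr0 // -natr1 addrA h.
case: n => k; first exact: hn.
by rewrite -[in RHS](subrK k.+1%:R z) hn NegzE mulrNz.
Qed.

Lemma expR_small (e : R) : 0 < e -> exists2 Y : R, 0 < Y & forall y, Y < y -> expR (- (2 * pi * y)) < e.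
Proof.
move=> e0; exists (Num.max 1 (e^-1)); first by rewrite lt_max ltr01.
move=> y; rewrite gt_max => /andP[y1 ye].
have p2 : 2 <= pi :> R by exact: pi_ge2.
have h : y < expR (2 * pi * y).
  apply: lt_le_trans (expR_ge1Dx _); nra.
rewrite expRN -[e]invrK ltf_pV2 ?posrE ?expR_gt0 ?invr_gt0 //.
exact: lt_trans ye h.
Qed.
Lemma ee_small (e : R) : 0 < e -> exists2 Y : R, 0 < Y & forall z, Y < ImC z -> cabs (ee z) < e.
Proof.
by move=> /expR_small[Y Y0 h]; exists Y => // z /h; rewrite cabs_ee.
Qed.
Lemma ee_large (A : R) : exists Y : R, forall z, ImC z < Y -> A < cabs (ee z).
Proof.
exists (- (Num.max 1 A)) => z hz; have p2 : 2 <= pi :> R by exact: pi_ge2.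
have h1 : 1 <= Num.max 1 A by rewrite le_max lexx.
have h2 : A <= Num.max 1 A by rewrite le_max lexx orbT.
rewrite cabs_ee; apply: lt_le_trans (expR_ge1Dx _).
have : pi * ImC z < - pi * Num.max 1 A by rewrite mulNr -mulrN ltr_pM2l ?pi0.
have : 2 * Num.max 1 A <= pi * Num.max 1 A by rewrite ler_pM2r //; lra.
rewrite -mulrA; lra.
Qed.

Lemma ee_ImE z w : ee z = ee w -> ImC z = ImC w.
Proof.
move=> h; have : cabs (ee z) = cabs (ee w) by rewrite h.
rewrite !cabs_ee => /expR_inj; have := pi0 => p0 h'.
have : 2 * pi * (ImC z - ImC w) = 0 by lra.
by move/twopi_mul_eq0; lra.
Qed.

(** Lowering the line towards minus infinity meets no pole, and there [ee w] dominates, so the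
    kernel tends to 1. *)
Lemma mean_kernel w0 y : y < ImC w0 -> mean (fun w => ee w / (ee w - ee w0)) y = 1.
Proof.
move=> hy; pose k w := ee w / (ee w - ee w0).
have kn w : ImC w < ImC w0 -> ee w - ee w0 != 0.
  by move=> h; rewrite subr_eq0; apply/eqP => /ee_ImE e; rewrite e ltxx in h.
have kd w : ImC w < ImC w0 -> exists d, cd k w d.
  move=> h; eexists; apply: cdM; first exact: cd_ee.
  by apply: cdV; [exact: kn|apply: cdB; [exact: cd_ee|exact: cd_cst]].
have kc w : ImC w < ImC w0 -> ccont k w by move=> /kd[d /cd_cont].
have kper : per1 k by move=> z; rewrite /k eeD1.
apply/eqP; rewrite -subr_eq0; apply/eqP/eps_eq0 => e e0.
have E0 : 0 < cabs (ee w0) by rewrite cabs_gt0 ee_neq0.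
have [Y hY] := ee_large (cabs (ee w0) + cabs (ee w0) * 2 / e).
pose y' := Num.min y (Y - 1).
have y'y : y' <= y by rewrite ge_min lexx.
have y'Y : y' < Y.
  have h1 : y' <= Y - 1 by rewrite ge_min lexx orbT.
  lra.
have -> : mean k y = mean k y'.
  apply/esym/mean_strip => // z /andP[_ hz]; apply: kd; exact: le_lt_trans hz hy.
have hy' : y' < ImC w0 by exact: le_lt_trans hy.
have cc u : ccont k (Mk u y') by apply: kc; rewrite Mk_Im.
have -> : mean k y' - 1 = mean (fun w => k w + -1) y'.
  by rewrite meanD ?mean_cst // => u; exact: ccont_cst.
apply: (le_trans (@mean_bound _ _ (e / 2) _ _)); last lra.
  by move=> u; apply: ccontD => //; exact: ccont_cst.
move=> u _; have hu := hY (Mk u y'); rewrite Mk_Im in hu; have {}hu := hu y'Y.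
have n0 : ee (Mk u y') - ee w0 != 0 by apply: kn; rewrite Mk_Im.
have -> : k (Mk u y') + -1 = ee w0 / (ee (Mk u y') - ee w0) by rewrite /k; field.
rewrite cabsM cabsV ler_pdivrMr ?cabs_gt0 //.
have := cabsB_ge (ee (Mk u y')) (ee w0).
move: hu E0; set A := cabs (ee w0); set B := cabs (ee (Mk u y')); set D := cabs (_ - _) => h1 h2 h3.
have h4 : A * 2 / e < D by lra.
have : A * 2 < D * e by move: h4; rewrite ltr_pdivrMr.
lra.
Qed.

Section CauchyH.
Variables (f : C -> C) (w0 : C).
Hypotheses (fh : holH f) (fper : per1 f) (fdec : decay f) (hw0 : Hp w0).

(** The difference quotient [h] of f with respect to [ee] has a removable singularity at [w0]. Its
    mean is 0 high up, by [decay], and stays the same on the way down: Goursat's theorem applies on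
    each side of the line through [w0], and [mean_cont] crosses that line. The value f w0 then comes
    from [mean_kernel]. *)
Lemma cauchy_H y : 0 < y < ImC w0 ->
  mean (fun w => f w * (ee w / (ee w - ee w0))) y = f w0.
Proof.
move=> /andP[y0 yw].
have [f' df] := fh hw0.
pose h w := ee w * (if ee w == ee w0 then f' / (tpi * ee w0) else (f w - f w0) / (ee w - ee w0)).
have hper : per1 h by move=> z; rewrite /h eeD1 fper.
have hd w : Hp w -> ee w != ee w0 -> exists d, cd h w d.
  move=> hw hn; have hn' : ee w - ee w0 != 0 by rewrite subr_eq0.
  have [fw dfw] := fh hw.
  have [dl dl0 hdl] := cd_cont (cd_ee w) (ltac:(by rewrite cabs_gt0) : 0 < cabs (ee w - ee w0)).
  eexists; apply: (@cd_near (fun w => ee w * ((f w - f w0) / (ee w - ee w0))) _ _ _ dl) => //.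
    move=> v hv; rewrite /h; case: eqP => // ev.
    by have := hdl v hv; rewrite ev cabsB ltxx.
  apply: cdM; first exact: cd_ee.
  apply: cdM; first by apply: cdB; [exact: dfw|exact: cd_cst].
  by apply: cdV => //; apply: cdB; [exact: cd_ee|exact: cd_cst].
have hc0 : ccont h w0.
  move: df (cd_ee w0) => [p [hp cp ep]] [q [hq cq eq]].
  have q0 : q w0 != 0 by rewrite eq mulf_neq0 ?tpi_neq0 ?ee_neq0.
  have [dl dl0 hdl] := cq _ (ltac:(by rewrite cabs_gt0) : 0 < cabs (q w0)).
  have qn v : cabs (v - w0) < dl -> q v != 0.
    by move=> hv; apply/eqP => ev; have := hdl v hv; rewrite ev sub0r cabsN ltxx.
  (* Near [w0] the difference quotient is the quotient of the two Caratheodory slopes, hence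
     continuous. *)
  apply: (@ccont_near (fun w => ee w * (p w * (q w)^-1)) _ _ dl) => //.
    move=> v hv; rewrite /h; congr (_ * _); have [->|vw] := eqVneq v w0.
      by rewrite eqxx ep eq.
    have vw' : v - w0 != 0 by rewrite subr_eq0.
    have ev : ee v - ee w0 = q v * (v - w0) by rewrite hq addrC addKr.
    case: eqP => [e|_]; first by move/eqP: ev; rewrite e subrr eq_sym mulf_eq0 (negbTE (qn _ hv)) (negbTE vw').
    rewrite ev hp [f w0 + _]addrC addrK; field.
    by rewrite vw' qn.
  apply: ccontM; first exact: cd_cont (cd_ee w0).
  by apply: ccontM => //; apply: ccont_comp => //; exact: ccont_inv.
have hcw w : Hp w -> ccont h w.
  move=> hw; have [e|/(hd _ hw)[d /cd_cont //]] := eqVneq (ee w) (ee w0).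
  have /ee_eq1[n en] : ee (w - w0) = 1 by rewrite eeD eeN e mulfV ?ee_neq0.
  move=> e' e'0; have [dl dl0 hdl] := hc0 _ e'0; exists dl => // v hv.
  have ew : w = w0 + n%:~R by rewrite -en addrC subrK.
  have -> : h v = h (v - n%:~R) by rewrite -{1}(subrK n%:~R v) per1_int.
  have -> : h w = h w0 by rewrite ew per1_int.
  apply: hdl; move: hv; rewrite ew; congr (cabs _ < _); ring.
pose Y0 := ImC w0.
have Hline v u : 0 < v -> Hp (Mk u v) by rewrite /Hp Mk_Im.
have up v : Y0 < v -> mean h v = 0.
  move=> hv; apply: eps_eq0 => e e0.
  have E0 : 0 < cabs (ee w0) by rewrite cabs_gt0 ee_neq0.
  pose A := cabs (ee w0); pose B := cabs (f w0) + 1.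
  have B0 : 0 < B by rewrite /B; have := cabs_ge0 (f w0); lra.
  pose e1 := e * A / 8.
  have e10 : 0 < e1 by rewrite /e1 divr_gt0 // mulr_gt0.
  have [Y1 hY1] := fdec e10.
  have A0 : 0 < A := E0.
  have mAB : 0 < Num.min (A / 2) (e1 / B) by rewrite lt_min; apply/andP; split; apply: divr_gt0.
  have [Y2 Y20 hY2] := ee_small mAB.
  pose v' := Num.max v (Num.max (Y1 + 1) (Y2 + 1)).
  have v'v : v <= v' by rewrite le_max lexx.
  have v'1 : Y1 < v' by rewrite !lt_max ltrDl ltr01 !orbT.
  have v'2 : Y2 < v' by rewrite !lt_max ltrDl ltr01 !orbT.
  have v0 : 0 < v by apply: lt_trans hv.
  have -> : mean h v = mean h v'.
    apply: mean_strip => // z /andP[hz _]; apply: hd; first exact: lt_le_trans v0 hz.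
    by apply/eqP => /ee_ImE e2; move: hv; rewrite /Y0 -e2 ltNge hz.
  apply: (le_trans (@mean_bound _ _ (e / 2) _ _)); last lra.
    by move=> u; apply/hcw/Hline; apply: lt_le_trans v'v.
  move=> u _; set w := Mk u v'.
  have hw1 : cabs (ee w * f w) <= e1 by apply: hY1; rewrite Mk_Im.
  have := hY2 w; rewrite Mk_Im => /(_ v'2); rewrite lt_min => /andP[hw2 hw3].
  have D2 : A / 2 < cabs (ee w - ee w0).
    by have := cabsB_ge (ee w0) (ee w); rewrite cabsB -/A; lra.
  rewrite /h; case: eqP => [ev|_]; first by rewrite ev subrr cabs0 in D2; move: E0; rewrite -/A; lra.
  have -> : ee w * ((f w - f w0) / (ee w - ee w0)) = (ee w * f w - ee w * f w0) / (ee w - ee w0).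
    by rewrite mulrA mulrBr.
  rewrite cabsM cabsV ler_pdivrMr; last by lra.
  have := cabsD (ee w * f w) (- (ee w * f w0)); rewrite cabsN [cabs (ee w * f w0)]cabsM.
  have : cabs (ee w) * cabs (f w0) <= e1.
    move: hw3; rewrite ltr_pdivlMr // => hw3.
    have : cabs (ee w) * cabs (f w0) <= cabs (ee w) * B by rewrite ler_wpM2l ?cabs_ge0 // /B; lra.
    lra.
  have : e / 2 * (A / 2) <= e / 2 * cabs (ee w - ee w0) by rewrite ler_pM2l ?divr_gt0 // ltW.
  rewrite /e1 in hw1 *; lra.
have W0 : 0 < Y0 by [].
have hcs c z : 0 < c -> c <= ImC z -> ccont h z.
  by move=> c0 hz; apply: hcw; exact: lt_le_trans c0 hz.
have mc : forall e, 0 < e -> exists2 dl, 0 < dl &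
    forall v, Y0 / 2 <= v <= Y0 * 2 -> `|v - Y0| < dl -> cabs (mean h v - mean h Y0) <= e.
  move=> e e0; apply: mean_cont => //; last lra.
  by move=> z /andP[hz _]; apply: (hcs (Y0 / 2)) => //; lra.
have at0 : mean h Y0 = 0.
  apply: eps_eq0 => e e0; have [dl dl0 hdl] := mc e e0.
  pose v := Y0 + Num.min (dl / 2) (Y0 / 2).
  have m0 : 0 < Num.min (dl / 2) (Y0 / 2) by rewrite lt_min !divr_gt0.
  have m1 : Num.min (dl / 2) (Y0 / 2) <= dl / 2 by rewrite ge_min lexx.
  have m2 : Num.min (dl / 2) (Y0 / 2) <= Y0 / 2 by rewrite ge_min lexx orbT.
  have := hdl v; rewrite up; last by rewrite /v; lra.
  rewrite sub0r cabsN; apply; first by rewrite /v; lra.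
  by rewrite /v addrC addKr gtr0_norm //; lra.
have low v : 0 < v < Y0 -> mean h v = 0.
  move=> /andP[v0 v1]; apply: eps_eq0 => e e0; have [dl dl0 hdl] := mc e e0.
  pose t := Num.min (Num.min (dl / 2) (Y0 / 2)) (Y0 - v).
  have m0 : 0 < t by rewrite !lt_min !divr_gt0 // subr_gt0.
  have m1 : t <= dl / 2 by rewrite !ge_min lexx.
  have m2 : t <= Y0 / 2 by rewrite !ge_min lexx orbT.
  have m3 : t <= Y0 - v by rewrite !ge_min lexx orbT.
  have -> : mean h v = mean h (Y0 - t).
    apply: mean_strip => //; first lra.
    move=> z /andP[z1 z2]; apply: hd; first exact: lt_le_trans v0 z1.
    by apply/eqP => /ee_ImE e2; move: z2; rewrite e2 -/Y0; lra.
  have := hdl (Y0 - t); rewrite at0 subr0; apply; first by lra.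
  by rewrite [Y0 - t]addrC addrK normrN gtr0_norm //; lra.
pose k w := ee w / (ee w - ee w0).
have kn u : ee (Mk u y) != ee w0.
  by apply/eqP => /ee_ImE; rewrite Mk_Im => e; rewrite e ltxx in yw.
have kc u : ccont k (Mk u y).
  apply: ccontM; first exact: cd_cont (cd_ee _).
  apply: (@ccont_comp (fun w => ee w - ee w0)); last by apply: ccont_inv; rewrite subr_eq0.
  by apply: ccontD; [exact: cd_cont (cd_ee _)|exact: ccont_cst].
have fc u : ccont f (Mk u y) by have [d /cd_cont] := fh (Hline y u y0).
have := low y; rewrite y0 yw => /(_ isT) => m0.
have e1 : mean (fun w => f w * k w) y = mean (fun w => h w + f w0 * k w) y.
  by apply: mean_ext => u; rewrite /h (negbTE (kn u)) /k; ring.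
rewrite -/k e1 meanD; [|by move=> u; exact/hcw/Hline|by move=> u; apply: ccontM => //; exact: ccont_cst].
by rewrite meanZ // m0 mean_kernel // mulr1 add0r.
Qed.
End CauchyH.

Definition eerad (y : R) : R := expR (- (2 * pi * y)).
Lemma cabs_eeMk t y : cabs (ee (Mk t y)) = eerad y. Proof. by rewrite cabs_ee Mk_Im. Qed.
Lemma eerad_gt0 y : 0 < eerad y. Proof. exact: expR_gt0. Qed.
Lemma eerad_lt1 y : 0 < y -> eerad y < 1.
Proof. by move=> y0; rewrite expR_lt1 oppr_lt0 mulr_gt0 // mulr_gt0 ?pi0. Qed.
Lemma eerad_small r : r < 1 -> exists2 Y : R, 0 < Y & forall y, 0 < y < Y -> r < eerad y.
Proof.
move=> r1; have p0 := pi0; exists ((1 - r) / (2 * pi)).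
  by rewrite divr_gt0 ?mulr_gt0 // subr_gt0.
move=> y /andP[y0]; rewrite ltr_pdivlMr ?mulr_gt0 // => h.
by apply: lt_le_trans (expR_ge1Dx _); lra.
Qed.
Lemma eerad_exists r : r < 1 -> exists2 y : R, 0 < y & r < eerad y.
Proof.
move=> /eerad_small[Y Y0 h]; exists (Y / 2); first by rewrite divr_gt0.
by apply: h; lra.
Qed.

Lemma mean_param (K : C -> C -> C) (K' : C -> C) y q0 r B : 0 < r -> 0 <= B ->
  (forall q, cabs (q - q0) < r -> forall t, ccont (K q) (Mk t y)) ->
  (forall t, ccont K' (Mk t y)) ->
  (forall q, cabs (q - q0) < r -> forall t, 0 <= t <= 1 ->
    cabs (K q (Mk t y) - K q0 (Mk t y) - K' (Mk t y) * (q - q0)) <= B * cabs (q - q0) ^+ 2) ->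
  cd (fun q => mean (K q) y) q0 (mean K' y).
Proof.
move=> r0 B0 Kc K'c hB; apply/cdP => e e0.
have hB1 : 0 < 2 * B + 1 by lra.
exists (Num.min r (e / (2 * B + 1))); first by rewrite lt_min r0 divr_gt0.
move=> q; rewrite lt_min => /andP[q1 q2].
have q00 : cabs (q0 - q0) < r by rewrite subrr cabs0.
have c1 := Kc q q1; have c2 := Kc q0 q00.
have c3 t : ccont (fun w => -1 * K q0 w) (Mk t y) by apply: ccontM => //; exact: ccont_cst.
have c4 t : ccont (fun w => - (q - q0) * K' w) (Mk t y) by apply: ccontM => //; exact: ccont_cst.
have c5 t : ccont (fun w => -1 * K q0 w + - (q - q0) * K' w) (Mk t y) by exact: ccontD.
have -> : mean (K q) y - mean (K q0) y - mean K' y * (q - q0) =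
    mean (fun w => K q w + (-1 * K q0 w + - (q - q0) * K' w)) y.
  by rewrite !meanD // !meanZ //; ring.
apply: (le_trans (@mean_bound _ _ (B * cabs (q - q0) ^+ 2) _ _)).
- by move=> t; exact: ccontD.
- move=> t ht; apply: le_trans (hB q q1 t ht); rewrite le_eqVlt; apply/orP; left.
  by apply/eqP; congr cabs; ring.
move: q2; rewrite ltr_pdivlMr // expr2; have := cabs_ge0 (q - q0); nra.
Qed.

Lemma ccont_ee z : ccont ee z. Proof. exact: cd_cont (cd_ee z). Qed.
Lemma ccont_eeB q z : ccont (fun w => ee w - q) z.
Proof. by apply: ccontD; [exact: ccont_ee|exact: ccont_cst]. Qed.

Section Kernel.
Variables (u : C -> C) (y : R) (q0 : C).
Hypotheses (uc : forall t, ccont u (Mk t y)) (hq0 : cabs q0 < eerad y).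
Let D := eerad y - cabs q0.
Let D0 : 0 < D. Proof. by rewrite subr_gt0. Qed.

Lemma kernel_bnd q t : cabs (q - q0) < D / 2 -> D / 2 <= cabs (ee (Mk t y) - q).
Proof.
move=> hq; have h1 := cabsB_ge (ee (Mk t y)) q; rewrite cabs_eeMk in h1.
have := cabsB_ge q q0; rewrite /D in hq *; lra.
Qed.
Lemma kernel_bnd0 t : D <= cabs (ee (Mk t y) - q0).
Proof. by have := cabsB_ge (ee (Mk t y)) q0; rewrite cabs_eeMk. Qed.
Lemma kernel_cont q n t : cabs (q - q0) < D / 2 ->
  ccont (fun w => u w * ((ee w - q) ^+ n)^-1) (Mk t y).
Proof.
move=> /(kernel_bnd t) h; apply: ccontM => //.
have n0 : ee (Mk t y) - q != 0 by rewrite -cabs_gt0; have := D0; lra.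
apply: (@ccont_comp (fun w => (ee w - q) ^+ n)); last exact/ccont_inv/expf_neq0.
elim: n => [|n IH]; first by apply: (@ccont_near (fun=> 1) _ _ 1) => //; exact: ccont_cst.
apply: (@ccont_near (fun w => (ee w - q) * (ee w - q) ^+ n) _ _ 1) => //.
  by move=> w _; rewrite exprS.
by apply: ccontM => //; exact: ccont_eeB.
Qed.

(** The case n = 1 differentiates a Cauchy integral; the case n = 2 shows that the derivative is
    again differentiable, which is what [dhol_der] needs. *)
Lemma kernel_diff n : (n == 1%N) || (n == 2%N) ->
  cd (fun q => mean (fun w => u w * ((ee w - q) ^+ n)^-1) y) q0
     (mean (fun w => n%:R * (u w * ((ee w - q0) ^+ n.+1)^-1)) y).
Proof.
move=> hn; have D0' := D0; have [M M0 hM] := line_bound uc.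
have d2 : 0 < D / 2 by lra.
have q00 : cabs (q0 - q0) < D / 2 by rewrite subrr cabs0.
(* Bounds for the explicit Taylor remainders below, from |a| >= D and |a - s| >= D / 2. *)
pose B := if n == 1%N then M * (2 / D ^+ 3) else M * (8 / D ^+ 4).
have B0 : 0 <= B by rewrite /B; case: ifP => _; rewrite mulr_ge0 ?(ltW M0) // divr_ge0 // exprn_ge0 // ltW.
apply: (mean_param (r := D / 2) (B := B)) => //.
- by move=> q hq t; exact: kernel_cont.
- by move=> t; apply: ccontM; [exact: ccont_cst|exact: kernel_cont].
move=> q hq t ht; have h1 := kernel_bnd t hq; have h2 := kernel_bnd0 t.
set a := ee (Mk t y) - q0; set s := q - q0; set U := u (Mk t y).
have -> : ee (Mk t y) - q = a - s by rewrite /a /s; ring.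
have a0 : a != 0 by rewrite -cabs_gt0; rewrite -/a in h2; lra.
have e1 : ee (Mk t y) - q = a - s by rewrite /a /s; ring.
rewrite e1 in h1; rewrite -/a in h2.
have as0 : a - s != 0 by rewrite -cabs_gt0; lra.
have i1 : (cabs a)^-1 <= D^-1 by rewrite lef_pV2 // posrE; lra.
have i2 : (cabs (a - s))^-1 <= 2 / D.
  by rewrite -[2 / D]invf_div lef_pV2 // posrE; lra.
have i10 : 0 <= (cabs a)^-1 by rewrite invr_ge0 cabs_ge0.
have i20 : 0 <= (cabs (a - s))^-1 by rewrite invr_ge0 cabs_ge0.
have j0 : 0 <= D^-1 by rewrite invr_ge0 ltW.
have UM : cabs U <= M by exact: hM.
have U0 := cabs_ge0 U; have S0 := cabs_ge0 s.
have p2 : (cabs a)^-1 * (cabs a)^-1 <= D^-1 * D^-1 by exact: ler_pM.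
have p20 : 0 <= (cabs a)^-1 * (cabs a)^-1 by exact: mulr_ge0.
case/orP: hn => /eqP hn; rewrite /B hn /= ?expr1.
- have -> : U * (a - s)^-1 - U * a^-1 - 1%:R * (U * (a ^+ 2)^-1) * s
     = s ^+ 2 * (U * (a^-1 * a^-1 * (a - s)^-1)) by field; rewrite a0 as0.
  rewrite (cabsM (s ^+ 2)) cabsX mulrC ler_wpM2r ?exprn_ge0 // !cabsM !cabsV.
  apply: ler_pM => //; first by rewrite !mulr_ge0.
  have -> : 2 / D ^+ 3 = D^-1 * D^-1 * (2 / D) by field; rewrite gt_eqF.
  exact: ler_pM.
have -> : U * ((a - s) ^+ 2)^-1 - U * (a ^+ 2)^-1 - 2%:R * (U * (a ^+ 3)^-1) * s
     = s ^+ 2 * (U * (a^-1 * a^-1 * ((a - s)^-1 * ((a - s)^-1 + 2%:R * a^-1)))).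
  by field; rewrite a0 as0.
rewrite (cabsM (s ^+ 2)) cabsX mulrC ler_wpM2r ?exprn_ge0 // !cabsM !cabsV.
apply: ler_pM => //; first by rewrite !mulr_ge0 // cabs_ge0.
have -> : 8 / D ^+ 4 = D^-1 * D^-1 * (2 / D * (2 / D + 2 / D)) by field; rewrite gt_eqF.
apply: ler_pM => //; first by rewrite mulr_ge0 // cabs_ge0.
apply: ler_pM => //; first exact: cabs_ge0.
apply: (le_trans (cabsD _ _)); rewrite cabsM !cabsV cabs_nat; lra.
Qed.
End Kernel.

Definition dhol (phi : C -> C) := forall q, cabs q < 1 -> exists d, cd phi q d.
Definition dder (phi : C -> C) : C -> C := fun q => cderiv phi q.

Lemma dder_eq phi q d : cd phi q d -> dder phi q = d.
Proof. by move=> /cderivP[]. Qed.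
Lemma dderP phi q : dhol phi -> cabs q < 1 -> cd phi q (dder phi q).
Proof. by move=> h /h[d hd]; rewrite (dder_eq hd). Qed.
Lemma dhol_cont phi q : dhol phi -> cabs q < 1 -> ccont phi q.
Proof. by move=> h /h[d /cd_cont]. Qed.

Lemma ccont_eq_pt f g z d : 0 < d -> ccont f z -> ccont g z ->
  (forall w, w != z -> cabs (w - z) < d -> f w = g w) -> f z = g z.
Proof.
move=> d0 cf cg h; apply/eqP; rewrite -subr_eq0; apply/eqP/eps_eq0 => e e0.
have [d1 d10 h1] := cf (e / 2) ltac:(lra).
have [d2 d20 h2] := cg (e / 2) ltac:(lra).
pose t := Num.min d (Num.min d1 d2) / 2.
have m0 : 0 < Num.min d (Num.min d1 d2) by rewrite !lt_min d0 d10.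
have m1 : Num.min d (Num.min d1 d2) <= d by rewrite ge_min lexx.
have m2 : Num.min d (Num.min d1 d2) <= d1 by rewrite !ge_min lexx orbT.
have m3 : Num.min d (Num.min d1 d2) <= d2 by rewrite !ge_min lexx !orbT.
have hw : cabs (z + rC t - z) = t.
  by rewrite addrC addKr cabs_rC gtr0_norm // /t; lra.
have wz : z + rC t != z.
  by rewrite -subr_eq0 -cabs_eq0 hw gt_eqF // /t; lra.
have e1 := h1 (z + rC t); have e2 := h2 (z + rC t); rewrite hw /t in e1 e2.
have {}e1 := e1 ltac:(lra); have {}e2 := e2 ltac:(lra).
have e3 : f (z + rC t) = g (z + rC t) by apply: h => //; rewrite hw /t; lra.
have -> : f z - g z = (g (z + rC t) - g z) - (f (z + rC t) - f z) by rewrite e3; ring.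
have := cabsD (g (z + rC t) - g z) (- (f (z + rC t) - f z)); rewrite cabsN /t; lra.
Qed.

Lemma Im_gt_eerad y z : (cabs (ee z) < eerad y) = (y < ImC z).
Proof. by rewrite cabs_ee ltr_expR ltrN2 ltr_pM2l // mulr_gt0 ?pi0. Qed.

Lemma holH_cont f z : holH f -> Hp z -> ccont f z.
Proof. by move=> h /h[d /cd_cont]. Qed.

Lemma kernel1_diff u y q0 : (forall t, ccont u (Mk t y)) -> cabs q0 < eerad y ->
  exists d, cd (fun q => mean (fun w => u w * (ee w / (ee w - q))) y) q0 d.
Proof.
move=> uc hq; eexists.
have uc' t : ccont (fun w => u w * ee w) (Mk t y) by apply: ccontM => //; exact: ccont_ee.
apply: cd_ext (kernel_diff uc' hq (n := 1) isT) => q.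
by apply: mean_ext => t; rewrite expr1 mulrA.
Qed.

(** Riemann's removable singularity theorem at the cusp. The value at q = 0 is chosen as the mean of
    f, its constant Fourier coefficient; Cauchy's formula then represents [phi] on each disc, origin
    included, and the kernel integral is differentiable in q. *)
Theorem q_expansion f : holH f -> per1 f -> decay f ->
  exists2 phi, dhol phi & forall z, Hp z -> f z = phi (ee z).
Proof.
move=> fh fper fdec.
pose lg q := Logc q / tpi.
have lgE q : q != 0 -> ee (lg q) = q.
  by move=> q0; rewrite /lg eeE mulrC divfK ?tpi_neq0 // cexp_Logc.
pose phi q := if q == 0 then mean f 1 else f (lg q).
have fc y t : 0 < y -> ccont f (Mk t y) by move=> y0; apply: holH_cont => //; rewrite /Hp Mk_Im.
have key y q : 0 < y -> cabs q < eerad y -> phi q = mean (fun w => f w * (ee w / (ee w - q))) y.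
  move=> y0 hq; rewrite /phi; case: eqP => [->|/eqP q0].
    rewrite (@mean_ext (fun w => f w * _) f); last by move=> u; rewrite subr0 divff ?ee_neq0 // mulr1.
    have [h|/ltW h] := leP 1 y; [|symmetry]; apply: mean_strip => // z /andP[hz _]; apply: fh.
      exact: lt_le_trans hz.
    exact: lt_le_trans hz.
  have iy : y < ImC (lg q) by rewrite -Im_gt_eerad lgE.
  by rewrite -{2}(lgE _ q0) cauchy_H // /Hp ?y0 // (lt_trans y0).
exists phi.
  move=> q /eerad_exists[y y0 hq].
  have [d hd] := kernel1_diff (fc y ^~ y0) hq.
  exists d; apply: (@cd_near _ phi q d (eerad y - cabs q)) hd; first by rewrite subr_gt0.
  move=> w hw; rewrite -key //; have := cabsB_ge w q; lra.
move=> z hz; rewrite /phi (negbTE (ee_neq0 _)).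
have /ee_eq1[n en] : ee (lg (ee z) - z) = 1 by rewrite eeD eeN lgE ?ee_neq0 // mulfV ?ee_neq0.
by rewrite -(per1_int n z fper) -en addrC subrK.
Qed.

Lemma comp_ee_hol phi : dhol phi -> [/\ holH (fun z => phi (ee z)), per1 (fun z => phi (ee z)) &
  decay (fun z => phi (ee z))].
Proof.
move=> h; split.
- move=> z hz; have [d hd] := h (ee z) (ltac:(by rewrite cabs_ee_lt1)).
  by eexists; apply: cd_comp hd; exact: cd_ee.
- by move=> z; rewrite eeD1.
- move=> e e0; have c0 : ccont phi 0 by apply: dhol_cont => //; rewrite cabs0.
  have [d d0 hd] := c0 1 ltr01.
  pose B := cabs (phi 0) + 1; have B0 : 0 < B by rewrite /B; have := cabs_ge0 (phi 0); lra.
  have m0 : 0 < Num.min d (e / B) by rewrite lt_min d0 divr_gt0.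
  have [Y Y0 hY] := ee_small m0; exists Y => z /hY; rewrite lt_min => /andP[h1].
  rewrite ltr_pdivlMr // cabsM => h2.
  have := hd (ee z); rewrite subr0 => /(_ h1) h3.
  have : cabs (phi (ee z)) <= B by have := cabsB_ge (phi (ee z)) (phi 0); rewrite /B; lra.
  have := cabs_ge0 (ee z); nra.
Qed.

(** Away from 0 this is [cauchy_H] pulled back by [ee]. The point 0 is not a value of [ee]; there
    both sides are continuous. *)
Theorem cauchy_disc phi y q : dhol phi -> 0 < y -> cabs q < eerad y ->
  phi q = mean (fun w => phi (ee w) * (ee w / (ee w - q))) y.
Proof.
move=> h y0; have [fh fp fd] := comp_ee_hol h.
have fc t : ccont (fun w => phi (ee w)) (Mk t y) by apply: holH_cont => //; rewrite /Hp Mk_Im.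
have main p : p != 0 -> cabs p < eerad y -> phi p = mean (fun w => phi (ee w) * (ee w / (ee w - p))) y.
  move=> p0 hp; have [z ez] := ee_surj p0.
  have iy : y < ImC z by rewrite -Im_gt_eerad ez.
  by rewrite -ez (@cauchy_H (fun w => phi (ee w)) z) // /Hp ?y0 // (lt_trans y0).
move=> hq; have [q0|q0] := eqVneq q 0; last exact: main.
rewrite {}q0 in hq *.
have [d hd] := kernel1_diff fc hq.
apply: (@ccont_eq_pt phi (fun q => mean (fun w => phi (ee w) * (ee w / (ee w - q))) y) 0
  (eerad y) (eerad_gt0 y)).
- by apply: dhol_cont => //; rewrite cabs0.
- exact: cd_cont hd.
- by move=> w w0; rewrite subr0; exact: main.
Qed.

Lemma dhol_der phi : dhol phi -> dhol (dder phi).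
Proof.
move=> h q /eerad_exists[y y0 hq].
have [fh fp fd] := comp_ee_hol h.
have uc t : ccont (fun w => phi (ee w) * ee w) (Mk t y).
  by apply: ccontM; [apply: holH_cont => //; rewrite /Hp Mk_Im|exact: ccont_ee].
have loc p : cabs p < eerad y -> dder phi p = mean (fun w => phi (ee w) * ee w * ((ee w - p) ^+ 2)^-1) y.
  move=> hp; apply: dder_eq.
  have := kernel_diff uc hp (n := 1) isT; rewrite (@mean_ext _
     (fun w => phi (ee w) * ee w * ((ee w - p) ^+ 2)^-1)); last by move=> t; rewrite mul1r.
  apply: (@cd_near _ _ _ _ (eerad y - cabs p)); first by rewrite subr_gt0.
  move=> w hw; rewrite (@cauchy_disc phi y w) //; last by have := cabsB_ge w p; lra.
  by apply: mean_ext => t; rewrite expr1 mulrA.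
eexists; apply: (@cd_near _ (dder phi) q _ (eerad y - cabs q) _ _ (kernel_diff uc hq (n := 2) isT)).
  by rewrite subr_gt0.
by move=> w hw; rewrite loc //; have := cabsB_ge w q; lra.
Qed.

Lemma kernel_le y q t : cabs q < eerad y -> 
  cabs (ee (Mk t y) / (ee (Mk t y) - q)) <= eerad y / (eerad y - cabs q).
Proof.
move=> hq; rewrite cabsM cabsV cabs_eeMk ler_pM2l ?eerad_gt0 //.
have := cabsB_ge (ee (Mk t y)) q; rewrite cabs_eeMk => h.
by rewrite lef_pV2 // posrE; lra.
Qed.

Lemma cauchy_le phi y q M : dhol phi -> 0 < y -> cabs q < eerad y ->
  (forall t, 0 <= t <= 1 -> cabs (phi (ee (Mk t y))) <= M) ->
  cabs (phi q) <= 2 * (M * (eerad y / (eerad y - cabs q))).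
Proof.
move=> h y0 hq hM; rewrite (cauchy_disc h y0 hq).
have [fh fp fd] := comp_ee_hol h.
apply: mean_bound.
  move=> t; apply: ccontM; first by apply: holH_cont => //; rewrite /Hp Mk_Im.
  apply: ccontM; first exact: ccont_ee.
  apply: (@ccont_comp (fun w => ee w - q)); first exact: ccont_eeB.
  by apply: ccont_inv; rewrite subr_eq0; apply/eqP => e; rewrite -e cabs_eeMk ltxx in hq.
move=> t ht; rewrite cabsM; apply: ler_pM; rewrite ?cabs_ge0 ?hM //.
exact: kernel_le.
Qed.

(** * Closure properties, limits and zeros of holomorphic functions on the disc *)

Lemma dhol_cst c : dhol (fun=> c). Proof. by move=> q _; exists 0; exact: cd_cst. Qed.
Lemma dhol_id : dhol id. Proof. by move=> q _; exists 1; exact: cd_id. Qed.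
Lemma dholD f g : dhol f -> dhol g -> dhol (fun q => f q + g q).
Proof. by move=> hf hg q hq; have [a ha] := hf q hq; have [b hb] := hg q hq; exists (a + b); exact: cdD. Qed.
Lemma dholM f g : dhol f -> dhol g -> dhol (fun q => f q * g q).
Proof. by move=> hf hg q hq; have [a ha] := hf q hq; have [b hb] := hg q hq; eexists; exact: cdM ha hb. Qed.
Lemma dholZ c f : dhol f -> dhol (fun q => c * f q).
Proof. by move=> hf; apply: dholM => //; exact: dhol_cst. Qed.
Lemma dholX f n : dhol f -> dhol (fun q => f q ^+ n).
Proof. by move=> hf q hq; have [a ha] := hf q hq; eexists; exact: cdX ha. Qed.
Lemma dholV f : dhol f -> (forall q, cabs q < 1 -> f q != 0) -> dhol (fun q => (f q)^-1).
Proof. by move=> hf h0 q hq; have [a ha] := hf q hq; eexists; apply: cdV ha; exact: h0. Qed.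
Lemma dhol_ext f g : (forall q, f q = g q) -> dhol f -> dhol g.
Proof. by move=> fg hf q /hf[d hd]; exists d; exact: cd_ext hd. Qed.
Lemma dhol_sum I (s : seq I) (P : pred I) (F : I -> C -> C) :
  (forall i, dhol (F i)) -> dhol (fun q => \sum_(i <- s | P i) F i q).
Proof.
move=> h q hq; exists (\sum_(i <- s | P i) dder (F i) q); apply: cd_sum => i _.
exact: dderP.
Qed.
Lemma dhol_prod I (s : seq I) (P : pred I) (F : I -> C -> C) :
  (forall i, dhol (F i)) -> dhol (fun q => \prod_(i <- s | P i) F i q).
Proof.
move=> h; elim: s => [|i s IH].
  by apply: dhol_ext (dhol_cst 1) => q; rewrite big_nil.
case Pi : (P i); last by apply: dhol_ext IH => q; rewrite big_cons Pi.
by apply: dhol_ext (dholM (h i) IH) => q; rewrite big_cons Pi.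
Qed.
Lemma dhol_det n (M : C -> 'M[C]_n) : (forall i j, dhol (fun q => M q i j)) ->
  dhol (fun q => \det (M q)).
Proof.
move=> h; apply: dhol_sum => s; apply: dholZ.
by apply: dhol_prod => i; exact: h.
Qed.

(** Weierstrass: Cauchy's formula on a circle passes to the uniform limit, and a Cauchy integral is
    differentiable in q. *)
Lemma dhol_unif (F : nat -> C -> C) phi : (forall N, dhol (F N)) ->
  (forall r e, r < 1 -> 0 < e -> exists N0, forall N, (N0 <= N)%N ->
     forall q, cabs q <= r -> cabs (F N q - phi q) <= e) -> dhol phi.
Proof.
move=> hF hu.
have pc q : cabs q < 1 -> ccont phi q.
  move=> hq e e0; pose r := (1 + cabs q) / 2.
  have [N /(_ N (leqnn N)) hN] := hu r (e / 4) ltac:(rewrite /r; lra) ltac:(lra).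
  have [d d0 hd] := dhol_cont (hF N) hq (ltac:(lra) : 0 < e / 4).
  exists (Num.min d ((1 - cabs q) / 2)); first by rewrite lt_min d0 divr_gt0 // subr_gt0.
  move=> w; rewrite lt_min => /andP[/hd h1 h2].
  have w1 : cabs w <= r by have := cabsB_ge w q; rewrite /r; lra.
  have q1 : cabs q <= r by rewrite /r; lra.
  have -> : phi w - phi q = - (F N w - phi w) + (F N w - F N q) + (F N q - phi q) by ring.
  have := hN w w1; have := hN q q1.
  have := cabsD (- (F N w - phi w) + (F N w - F N q)) (F N q - phi q).
  by have := cabsD (- (F N w - phi w)) (F N w - F N q); rewrite cabsN; lra.
move=> q /eerad_exists[y y0 hq].
have uc t : ccont (fun w => phi (ee w)) (Mk t y).
  apply: ccont_comp; first exact: ccont_ee.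
  by apply: pc; rewrite cabs_eeMk eerad_lt1.
have kc p : cabs p < eerad y -> forall t, ccont (fun w => ee w / (ee w - p)) (Mk t y).
  move=> hp t; apply: ccontM; first exact: ccont_ee.
  apply: (@ccont_comp (fun w => ee w - p)); first exact: ccont_eeB.
  by apply: ccont_inv; rewrite subr_eq0; apply/eqP => e; rewrite -e cabs_eeMk ltxx in hp.
have loc p : cabs p < eerad y -> phi p = mean (fun w => phi (ee w) * (ee w / (ee w - p))) y.
  move=> hp; apply/eqP; rewrite -subr_eq0; apply/eqP/eps_eq0 => e e0.
  pose A := eerad y / (eerad y - cabs p); have A0 : 0 < A by rewrite divr_gt0 ?eerad_gt0 // subr_gt0.
  pose e1 := e / (1 + 2 * A); have e10 : 0 < e1 by rewrite divr_gt0 // ; lra.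
  have e1E : e1 * (1 + 2 * A) = e by rewrite /e1 divfK // gt_eqF //; lra.
  have [N /(_ N (leqnn N)) hN] := hu (eerad y) e1 (eerad_lt1 y0) e10.
  have h1 := hN p (ltW hp).
  have fN := cauchy_disc (hF N) y0 hp.
  have [fh _ _] := comp_ee_hol (hF N).
  have c1 t : ccont (fun w => F N (ee w)) (Mk t y) by apply: holH_cont => //; rewrite /Hp Mk_Im.
  have c2 t : ccont (fun w => F N (ee w) * (ee w / (ee w - p))) (Mk t y).
    by apply: ccontM => //; exact: kc.
  have c3 t : ccont (fun w => -1 * (phi (ee w) * (ee w / (ee w - p)))) (Mk t y).
    by apply: ccontM; [exact: ccont_cst|apply: ccontM => //; exact: kc].
  have -> : phi p - mean (fun w => phi (ee w) * (ee w / (ee w - p))) y = - (F N p - phi p) +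
     mean (fun w => F N (ee w) * (ee w / (ee w - p)) + -1 * (phi (ee w) * (ee w / (ee w - p)))) y.
    by rewrite meanD // meanZ -?fN; [ring|move=> t; apply: ccontM => //; exact: kc].
  apply: (le_trans (cabsD _ _)); rewrite cabsN.
  have : cabs (mean (fun w => F N (ee w) * (ee w / (ee w - p)) + -1 * (phi (ee w) * (ee w / (ee w - p)))) y) <= 2 * (e1 * A).
    apply: mean_bound; first by move=> t; exact: ccontD.
    move=> t ht; have -> : F N (ee (Mk t y)) * (ee (Mk t y) / (ee (Mk t y) - p)) +
      -1 * (phi (ee (Mk t y)) * (ee (Mk t y) / (ee (Mk t y) - p))) =
      (F N (ee (Mk t y)) - phi (ee (Mk t y))) * (ee (Mk t y) / (ee (Mk t y) - p)) by ring.
    rewrite cabsM; apply: ler_pM; rewrite ?cabs_ge0 ?kernel_le //.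
    by apply: hN; rewrite cabs_eeMk.
  lra.
have [d hd] := kernel1_diff uc hq.
exists d; apply: (@cd_near _ phi q d (eerad y - cabs q)) hd; first by rewrite subr_gt0.
by move=> w hw; rewrite -loc //; have := cabsB_ge w q; lra.
Qed.

(** Since phi is continuous and vanishes at 0, phi / q satisfies [decay], so [q_expansion] applies
    to it. *)
Lemma dhol_div0 phi : dhol phi -> phi 0 = 0 ->
  exists2 psi, dhol psi & forall q, cabs q < 1 -> phi q = q * psi q.
Proof.
move=> h h0; have [fh fp fd] := comp_ee_hol h.
have [|||psi hpsi e] := @q_expansion (fun z => phi (ee z) * (ee z)^-1).
- move=> z /fh[d hd]; eexists; apply: cdM hd _.
  by apply: cdV; [exact: ee_neq0|exact: cd_ee].
- by move=> z /=; rewrite eeD1.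
- move=> e e0; have c0 : ccont phi 0 by apply: dhol_cont => //; rewrite cabs0.
  have [d d0 hd] := c0 e e0; have [Y Y0 hY] := ee_small d0.
  exists Y => z /hY; rewrite -{1}[ee z]subr0 => /hd.
  by rewrite h0 subr0 mulrCA mulfV ?ee_neq0 // mulr1 => /ltW.
exists psi => // q hq; have [->|q0] := eqVneq q 0; first by rewrite mul0r.
have [z ez] := ee_surj q0; rewrite -ez -e; first by rewrite mulrCA mulfV ?ee_neq0 // mulr1.
by rewrite /Hp -cabs_ee_lt1 ez.
Qed.

(** Cauchy's estimate on circles of radius tending to 1. Through it, negative weight forces a
    modular form to vanish. *)
Lemma dhol_bdry0 phi : dhol phi ->
  (forall e, 0 < e -> exists2 Y, 0 < Y &
     forall z, 0 < ImC z < Y -> cabs (phi (ee z)) <= e) ->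
  forall q, cabs q < 1 -> phi q = 0.
Proof.
move=> h hb q hq; apply: eps_eq0 => e e0.
have d0 : 0 < 1 - cabs q by lra.
have [Y Y0 hY] := hb (e * (1 - cabs q) / 4) ltac:(by rewrite divr_gt0 // mulr_gt0).
have [Y' Y'0 hY'] := @eerad_small ((1 + cabs q) / 2) ltac:(lra).
pose y := Num.min Y Y' / 2.
have m0 : 0 < Num.min Y Y' by rewrite lt_min Y0.
have m1 : Num.min Y Y' <= Y by rewrite ge_min lexx.
have m2 : Num.min Y Y' <= Y' by rewrite ge_min lexx orbT.
have y0 : 0 < y by rewrite /y; lra.
have hr : (1 + cabs q) / 2 < eerad y by apply: hY'; rewrite /y; lra.
have r1 := eerad_lt1 y0.
apply: (le_trans (cauchy_le h y0 (ltac:(lra) : cabs q < eerad y) _)).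
  by move=> t _; apply: hY; rewrite Mk_Im /y; lra.
have i : eerad y / (eerad y - cabs q) <= 2 / (1 - cabs q).
  rewrite ler_pdivrMr; last lra.
  rewrite mulrAC ler_pdivlMr //; nra.
have : e * (1 - cabs q) / 4 * (eerad y / (eerad y - cabs q)) <= e * (1 - cabs q) / 4 * (2 / (1 - cabs q)).
  by rewrite ler_pM2l // divr_gt0 // mulr_gt0.
have -> : e * (1 - cabs q) / 4 * (2 / (1 - cabs q)) = e / 2 by field; rewrite gt_eqF.
lra.
Qed.

(** If division by q never stopped, Cauchy's estimate for phi / q^n on a fixed circle would bound
    |phi q| by a constant times (|q| / radius)^n for every n. *)
Lemma dhol_order phi : dhol phi -> ~ (forall q, cabs q < 1 -> phi q = 0) ->
  exists n psi, [/\ dhol psi, psi 0 != 0 & forall q, cabs q < 1 -> phi q = q ^+ n * psi q].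
Proof.
move=> h hn; apply: contrapT => H; apply: hn => q hq.
have P n : exists2 psi, dhol psi & forall q, cabs q < 1 -> phi q = q ^+ n * psi q.
  elim: n => [|n [psi hpsi e]]; first by exists phi => // p _; rewrite expr0 mul1r.
  have [p0|p0] := eqVneq (psi 0) 0; last by exfalso; apply: H; exists n, psi.
  have [psi' h' e'] := dhol_div0 hpsi p0; exists psi' => // p hp.
  by rewrite e // e' // exprSr mulrA.
have [y y0 qy] := eerad_exists hq.
have [fh _ _] := comp_ee_hol h.
have [t|M M0 hM] := @line_bound (fun w => phi (ee w)) y.
  by apply: holH_cont => //; rewrite /Hp Mk_Im.
have r0 := eerad_gt0 y.
pose A := 2 * (M * (eerad y / (eerad y - cabs q))).
have A0 : 0 < A by rewrite /A !mulr_gt0 // invr_gt0 subr_gt0.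
have bd n : cabs (phi q) <= (cabs q / eerad y) ^+ n * A.
  have [psi hpsi e] := P n; rewrite e // cabsM cabsX.
  rewrite expr_div_n -mulrA ler_wpM2l ?exprn_ge0 ?cabs_ge0 //.
  have := cauchy_le (M := M / eerad y ^+ n) hpsi y0 qy.
  have -> : 2 * (M / eerad y ^+ n * (eerad y / (eerad y - cabs q))) = (eerad y ^+ n)^-1 * A.
    by rewrite /A; field; rewrite !gt_eqF ?exprn_gt0 // subr_gt0.
  apply=> t ht; rewrite ler_pdivlMr ?exprn_gt0 // mulrC -{1}(cabs_eeMk t) -cabsX -cabsM -e ?hM //.
  by rewrite cabs_eeMk eerad_lt1.
apply: eps_eq0 => e e0.
pose x := cabs q / eerad y.
have x0 : 0 <= x by rewrite divr_ge0 ?cabs_ge0 // ltW.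
have x1 : `|x| < 1 by rewrite ger0_norm // ltr_pdivrMr // mul1r.
have /cvgrPdist_lt /(_ (e / A)) [|N _ hN] := cvg_expr x1; first by rewrite divr_gt0.
have := hN N (leqnn N); rewrite /= sub0r normrN ger0_norm ?exprn_ge0 // ltr_pdivlMr // => /ltW.
exact: le_trans.
Qed.

Lemma clim (u : nat -> C) (l : C) :
  (forall e : R, 0 < e -> exists N0, forall N, (N0 <= N)%N -> cabs (u N - l) <= e) <->
  ((u : nat -> C^o) @ \oo --> (l : C^o)).
Proof.
split=> h.
  apply/cvgrPdist_le => /= e e0.
  have [e1 ee] : exists e1, e = rC e1.
    by exists (ReC e); apply: eqReIm => //; move: e0; rewrite ltcE /= => /andP[/eqP].
  have [N0 hN] := h e1 (ltac:(by move: e0; rewrite ee ltcR)).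
  by exists N0 => // N /= /hN; rewrite ee cabs_norm lecR cabsB.
move=> e e0; move/cvgrPdist_le: h => /(_ (rC e)) [|N0 _ hN]; first by rewrite ltcR.
by exists N0 => N /hN /=; rewrite cabs_norm lecR cabsB.
Qed.

Lemma real_complete (u : nat -> R) (b : nat -> R) :
  (forall n k, `|u (n + k)%N - u n| <= b n) ->
  (forall e, 0 < e -> exists n, b n < e) ->
  exists l, forall n, `|l - u n| <= b n.
Proof.
move=> hu hb.
have : Rseries.Cauchy_crit u.
  move=> e /RltP e0'; have e0 : 0 < e := e0'.
  have [N hN] := hb (e / 2) ltac:(lra).
  exists N => n m /ssrnat.leP hn /ssrnat.leP hm; apply/RltP; rewrite RdistE.
  have := hu N (n - N)%N; have := hu N (m - N)%N; rewrite !subnKC // => h1 h2.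
  have -> : u n - u m = (u n - u N) - (u m - u N) by ring.
  have := ler_normB (u n - u N) (u m - u N); lra.
move=> /Stdlib.Reals.Rcomplete.R_complete[l hl]; exists l => n.
rewrite leNgt; apply/negP => h.
have /RltP e0 : 0 < `|l - u n| - b n by rewrite subr_gt0.
have [N hN] := hl _ e0.
have /RltP := hN (n + N)%N (ssrnat.leP (leq_addl _ _)); rewrite RdistE => h1.
have := hu n N; have := ler_normB (l - u n) (u (n + N)%N - u n).
have -> : l - u n - (u (n + N)%N - u n) = - (u (n + N)%N - l) by ring.
have := ler_normD (u (n + N)%N - u n) (- (u (n + N)%N - l)).
have -> : u (n + N)%N - u n - (u (n + N)%N - l) = l - u n by ring.
rewrite !normrN; lra.
Qed.

Lemma geom_telescope (u : nat -> C) B x n : 0 <= B -> 0 <= x < 1 ->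
  (forall N, (n <= N)%N -> cabs (u N.+1 - u N) <= B * x ^+ N) ->
  forall k, cabs (u (n + k)%N - u n) <= B * x ^+ n / (1 - x).
Proof.
move=> B0 /andP[x0 x1] h k.
have h1x : 0 < 1 - x by lra.
suff : cabs (u (n + k)%N - u n) <= B * (x ^+ n - x ^+ (n + k)) / (1 - x).
  move/le_trans; apply; rewrite ler_pM2r ?invr_gt0 // ler_wpM2l //.
  by have := exprn_ge0 (n + k) x0; lra.
elim: k => [|k IH]; first by rewrite addn0 !subrr cabs0 mulr0 mul0r.
rewrite addnS; have := h (n + k)%N (leq_addr _ _).
have -> : u (n + k).+1 - u n = (u (n + k).+1 - u (n + k)%N) + (u (n + k)%N - u n) by ring.
have -> : B * (x ^+ n - x ^+ (n + k).+1) / (1 - x) =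
   B * x ^+ (n + k) + B * (x ^+ n - x ^+ (n + k)) / (1 - x).
  by rewrite exprS; field; rewrite gt_eqF.
have := cabsD (u (n + k).+1 - u (n + k)%N) (u (n + k)%N - u n); lra.
Qed.

Lemma geom_small (B x e : R) : 0 <= x < 1 -> 0 < e ->
  exists N0, forall N, (N0 <= N)%N -> B * x ^+ N < e.
Proof.
move=> /andP[x0 x1] e0.
have x1' : `|x| < 1 by rewrite ger0_norm.
have B0 : 0 < `|B| + 1 by have := normr_ge0 B; lra.
have /cvgrPdist_lt /(_ (e / (`|B| + 1))) [|N _ hN] := cvg_expr x1'; first by rewrite divr_gt0.
exists N => M NM; have := hN M NM; rewrite /= sub0r normrN ger0_norm ?exprn_ge0 // ltr_pdivlMr //.
apply: le_lt_trans; rewrite mulrC ler_wpM2l ?exprn_ge0 //; have := ler_norm B; lra.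
Qed.

(** The limit is chosen pointwise, with an error bound valid for every admissible pair [B], [x], so
    that one limit function serves all radii; [dhol_unif] concludes. *)
Lemma dhol_lim (F : nat -> C -> C) : (forall N, dhol (F N)) ->
  (forall r, 0 <= r < 1 -> exists B x, [/\ 0 <= B, 0 <= x < 1 &
     forall N q, cabs q <= r -> cabs (F N.+1 q - F N q) <= B * x ^+ N]) ->
  exists2 phi, dhol phi & forall q, cabs q < 1 ->
    forall e, 0 < e -> exists N0, forall N, (N0 <= N)%N -> cabs (F N q - phi q) <= e.
Proof.
move=> hF hB.
have lim q : exists l, cabs q < 1 -> forall B x, 0 <= B -> 0 <= x < 1 ->
    (forall N, cabs (F N.+1 q - F N q) <= B * x ^+ N) ->
    forall n, cabs (F n q - l) <= 2 * (B * x ^+ n / (1 - x)).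
  have [q1|] := ltP (cabs q) 1; last by exists 0.
  have [B [x [B0 x01 hx]]] := hB (cabs q) ltac:(by rewrite cabs_ge0).
  have {}hx N := hx N q (lexx _).
  have bd B1 x1 : 0 <= B1 -> 0 <= x1 < 1 -> (forall N, cabs (F N.+1 q - F N q) <= B1 * x1 ^+ N) ->
     forall n k, cabs (F (n + k)%N q - F n q) <= B1 * x1 ^+ n / (1 - x1).
    move=> B0' x0 h n k.
    by apply: (@geom_telescope (fun N => F N q)) => // N _; exact: h.
  have sm : forall e, 0 < e -> exists n, B * x ^+ n / (1 - x) < e.
    move=> e e0; have h1x : 0 < 1 - x by case/andP: x01; lra.
    have [N /(_ N (leqnn N)) h] := geom_small B x01 (ltac:(by rewrite mulr_gt0) : 0 < e * (1 - x)).
    by exists N; rewrite ltr_pdivrMr.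
  have bR n k : `|ReC (F (n + k)%N q) - ReC (F n q)| <= B * x ^+ n / (1 - x).
    by rewrite -ReCN -ReCD; exact: le_trans (ReC_le _) (bd _ _ B0 x01 hx n k).
  have bI n k : `|ImC (F (n + k)%N q) - ImC (F n q)| <= B * x ^+ n / (1 - x).
    by rewrite -ImCN -ImCD; exact: le_trans (ImC_le _) (bd _ _ B0 x01 hx n k).
  have [a ha] := @real_complete (fun N => ReC (F N q)) _ bR sm.
  have [b hb] := @real_complete (fun N => ImC (F N q)) _ bI sm.
  have c1 : forall n, cabs (F n q - Mk a b) <= 2 * (B * x ^+ n / (1 - x)).
    move=> n; rewrite -(MkE (F n q)) MkB; apply: (le_trans (cabs_Mk _ _)).
    have := ha n; have := hb n; rewrite distrC [`|a - _|]distrC; lra.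
  exists (Mk a b) => _ B' x' B0' x01' hx' n.
  rewrite leNgt; apply/negP => hlt.
  set D := 2 * _ in hlt; have [N hN] := sm ((cabs (F n q - Mk a b) - D) / 2) ltac:(lra).
  have := c1 N; have := c1 (n + N)%N; have := bd _ _ B0' x01' hx' n N.
  have : B * x ^+ (n + N) / (1 - x) <= B * x ^+ N / (1 - x).
    case/andP: x01 => x0 x1; rewrite ler_pM2r ?invr_gt0 ?subr_gt0 // ler_wpM2l //.
    by rewrite exprD ler_piMl ?exprn_ge0 // exprn_ile1 // ltW.
  have := cabsD (F n q - F (n + N)%N q) (F (n + N)%N q - Mk a b).
  rewrite addrA subrK [cabs (F n q - _)]cabsB => *.
  have D0 : 0 <= B' * x' ^+ n / (1 - x').
    by case/andP: x01' => x0 x1; rewrite divr_ge0 ?mulr_ge0 ?exprn_ge0 // subr_ge0 ltW.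
  move: hN hlt; rewrite /D; lra.
pose phi q := sval (cid (lim q)).
have hphi q : cabs q < 1 -> forall B x, 0 <= B -> 0 <= x < 1 ->
    (forall N, cabs (F N.+1 q - F N q) <= B * x ^+ N) ->
    forall n, cabs (F n q - phi q) <= 2 * (B * x ^+ n / (1 - x)).
  by rewrite /phi; case: cid.
have U r e : r < 1 -> 0 < e -> exists N0, forall N, (N0 <= N)%N ->
     forall q, cabs q <= r -> cabs (F N q - phi q) <= e.
  move=> r1 e0; have [r0|r0] := ltP r 0.
    by exists 0%N => N _ q hq; have := cabs_ge0 q; lra.
  have [B [x [B0 x01 hx]]] := hB r ltac:(by rewrite r0).
  have h1x : 0 < 1 - x by case/andP: x01; lra.
  have [N hN] := geom_small (2 * B) x01 (ltac:(by rewrite mulr_gt0) : 0 < e * (1 - x)).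
  exists N => M NM q hq; have q1 : cabs q < 1 by lra.
  apply: (le_trans (hphi q q1 B x B0 x01 (fun N => hx N q hq) M)).
  by rewrite mulrA ler_pdivrMr // mulrA ltW // hN.
exists phi; first exact: (dhol_unif hF U).
move=> q hq e e0; have [N hN] := U (cabs q) e hq e0.
by exists N => M NM; apply: hN.
Qed.

(** * Infinite products and the function P *)
Definition hN (N : nat) (q : C) : C := \prod_(1 <= n < N.+1) (1 - q ^+ n).
Lemma hNS N q : hN N.+1 q = hN N q * (1 - q ^+ N.+1).
Proof. by rewrite /hN big_nat_recr. Qed.
Lemma hN0 q : hN 0 q = 1. Proof. by rewrite /hN big_geq. Qed.
Lemma dhol_hN N : dhol (hN N).
Proof.
apply: dhol_prod => n; apply: dholD; first exact: dhol_cst.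
by apply: dhol_ext (dholZ (-1) (dholX n dhol_id)) => q; rewrite mulN1r.
Qed.
Lemma geom_sum_le (r : R) N : 0 <= r < 1 -> \sum_(1 <= n < N.+1) r ^+ n <= (1 - r)^-1.
Proof.
move=> /andP[r0 r1]; have h : 0 < 1 - r by lra.
suff -> : \sum_(1 <= n < N.+1) r ^+ n = (r - r ^+ N.+1) / (1 - r).
  rewrite -[leRHS]mul1r ler_pM2r ?invr_gt0 //; have := exprn_ge0 N.+1 r0; lra.
elim: N => [|N IH]; first by rewrite big_geq // expr1 subrr mul0r.
by rewrite big_nat_recr //= IH [r ^+ N.+2]exprS; field; rewrite gt_eqF.
Qed.
Lemma hN_le N q r : cabs q <= r -> r < 1 -> cabs (hN N q) <= expR ((1 - r)^-1).
Proof.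
move=> hq r1; have r0 : 0 <= r by apply: le_trans hq; exact: cabs_ge0.
apply: (@le_trans _ _ (expR (\sum_(1 <= n < N.+1) r ^+ n))); last first.
  by rewrite ler_expR geom_sum_le // r0.
elim: N => [|N IH]; first by rewrite hN0 cabs1 big_geq // exp.expR0.
rewrite hNS cabsM big_nat_recr //= exp.expRD; apply: ler_pM; rewrite ?cabs_ge0 //.
apply: le_trans (expR_ge1Dx _); apply: (le_trans (cabsD _ _)).
by rewrite cabs1 cabsN cabsX lerD2l lerXn2r // nnegrE cabs_ge0.
Qed.
(** From 1 - x >= exp(- x / (1 - r)) for 0 <= x <= r. Being uniform in N, it keeps the infinite
    product away from 0. *)
Lemma hN_ge N q r : cabs q <= r -> r < 1 -> expR (- ((1 - r)^-1 / (1 - r))) <= cabs (hN N q).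
Proof.
move=> hq r1; have r0 : 0 <= r by apply: le_trans hq; exact: cabs_ge0.
have h1r : 0 < 1 - r by lra.
apply: (@le_trans _ _ (expR (- ((\sum_(1 <= n < N.+1) r ^+ n) / (1 - r))))).
  by rewrite ler_expR lerN2 ler_pM2r ?invr_gt0 // geom_sum_le // r0.
elim: N => [|N IH]; first by rewrite hN0 cabs1 big_geq // mul0r oppr0 exp.expR0.
rewrite hNS cabsM big_nat_recr //= mulrDl opprD exp.expRD; apply: ler_pM; rewrite ?expR_ge0 //.
have rN0 : 0 <= r ^+ N.+1 by rewrite exprn_ge0.
have rNr : r ^+ N.+1 <= r by rewrite exprS ler_piMr // exprn_ile1 // ltW.
have h1N : 0 < 1 - r ^+ N.+1 by lra.
apply: (@le_trans _ _ (1 - r ^+ N.+1)).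
  rewrite expRN -[leRHS]invrK lef_pV2 ?posrE ?expR_gt0 ?invr_gt0 //.
  apply: le_trans (expR_ge1Dx _).
  have i : (1 - r ^+ N.+1)^-1 <= (1 - r)^-1 by rewrite lef_pV2 ?posrE //; lra.
  have e : (1 - r ^+ N.+1)^-1 = 1 + r ^+ N.+1 * (1 - r ^+ N.+1)^-1 by field; rewrite gt_eqF.
  by rewrite e lerD2l ler_wpM2l.
have := cabsB_ge 1 (q ^+ N.+1); rewrite cabs1 cabsX.
have : cabs q ^+ N.+1 <= r ^+ N.+1 by rewrite lerXn2r // nnegrE cabs_ge0.
lra.
Qed.
Lemma hN_step N q r : cabs q <= r -> r < 1 ->
  cabs (hN N.+1 q - hN N q) <= expR ((1 - r)^-1) * cabs q ^+ N.+1.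
Proof.
move=> hq r1; have -> : hN N.+1 q - hN N q = - (hN N q * q ^+ N.+1) by rewrite hNS; ring.
by rewrite cabsN cabsM cabsX ler_wpM2r ?exprn_ge0 ?cabs_ge0 // hN_le.
Qed.

(** The derivative -1 at 0 is recorded because it fixes the q-coefficients of P, E4 and E6, hence
    the constant 1728 in [E4E6_Delta]. *)
Lemma h_exists : exists h : C -> C, [/\ dhol h,
  forall q, cabs q < 1 -> forall e, 0 < e -> exists N0, forall N, (N0 <= N)%N -> cabs (hN N q - h q) <= e,
  forall q, cabs q < 1 -> h q != 0, h 0 = 1 & cd h 0 (-1)].
Proof.
have [|h hh hl] := dhol_lim dhol_hN.
  move=> r /andP[r0 r1]; exists (expR ((1 - r)^-1)), r; split; rewrite ?expR_ge0 ?r0 //.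
  move=> N q hq; apply: (le_trans (hN_step N hq r1)).
  rewrite ler_wpM2l ?expR_ge0 // (@le_trans _ _ (r ^+ N.+1)) //.
    by rewrite lerXn2r // nnegrE ?cabs_ge0.
  by rewrite exprS ler_piMl ?exprn_ge0 // ltW.
have h0 : h 0 = 1.
  apply/eqP; rewrite eq_sym -subr_eq0; apply/eqP/eps_eq0 => e e0.
  have [|N /(_ N (leqnn N))] := hl 0 _ e e0; first by rewrite cabs0.
  suff -> : hN N 0 = 1 by [].
  by elim: N => [|N IH]; rewrite ?hN0 // hNS IH expr0n subr0 mulr1.
exists h; split => //.
  move=> q q1; apply/eqP => hq0.
  have c0 := expR_gt0 (- ((1 - cabs q)^-1 / (1 - cabs q))).
  have [N /(_ N (leqnn N))] := hl q q1 _ (ltac:(by rewrite divr_gt0) : 0 < expR (- ((1 - cabs q)^-1 / (1 - cabs q))) / 2).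
  by rewrite hq0 subr0; have := hN_ge N (lexx (cabs q)) q1; lra.
apply/cdP => e e0; pose B := expR ((1 - 2^-1)^-1) : R; have B0 : 0 < B by exact: expR_gt0.
exists (Num.min 2^-1 (e / (2 * B))); first by rewrite lt_min invr_gt0 ltr0n divr_gt0 // mulr_gt0.
move=> q; rewrite subr0 lt_min => /andP[q1 q2]; rewrite h0.
have q11 : cabs q < 1 by lra.
(* The first partial product 1 - q is the linear part; the later factors change it by O(q^2). *)
have -> : h q - 1 - -1 * q = h q - hN 1 q by rewrite hNS hN0 expr1; ring.
apply: (@le_trans _ _ (2 * B * cabs q ^+ 2)); last first.
  move: q2; rewrite ltr_pdivlMr ?mulr_gt0 // expr2; have := cabs_ge0 q; nra.
have q0 := cabs_ge0 q.
have bd N : cabs (hN (1 + N) q - hN 1 q) <= B * cabs q * cabs q ^+ 1 / (1 - cabs q).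
  apply: (@geom_telescope (fun N => hN N q)); rewrite ?mulr_ge0 ?q0 ?(ltW B0) // => M M1.
  rewrite -mulrA -exprS; exact: (hN_step M (ltW q1) (ltac:(lra) : (2^-1 : R) < 1)).
apply: (@le_trans _ _ (B * cabs q * cabs q ^+ 1 / (1 - cabs q))).
  rewrite leNgt; apply/negP => hlt.
  set A := B * _ * _ / _ in bd hlt; have [N hN'] := hl q q11 (cabs (h q - hN 1 q) - A) ltac:(by rewrite subr_gt0).
  have [N2 hN2] := hl q q11 ((cabs (h q - hN 1 q) - A) / 2) ltac:(by rewrite divr_gt0 // subr_gt0).
  have := hN2 (1 + N2)%N (leq_addl _ _); have := bd N2.
  have := cabsD (h q - hN (1 + N2) q) (hN (1 + N2) q - hN 1 q); rewrite addrA subrK [cabs (h q - hN (1 + N2) q)]cabsB.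
  lra.
rewrite expr1 ler_pdivrMr; last lra.
have : 0 <= B * cabs q * cabs q by rewrite !mulr_ge0 // ltW.
rewrite expr2; nra.
Qed.

Definition hfun : C -> C := sval (cid h_exists).
Lemma hfun_hol : dhol hfun. Proof. by rewrite /hfun; case: cid => h []. Qed.
Lemma hfun_neq0 q : cabs q < 1 -> hfun q != 0. Proof. by rewrite /hfun; case: cid => h [] /= _ _ H _ _; exact: H. Qed.
Lemma hfun0 : hfun 0 = 1. Proof. by rewrite /hfun; case: cid => h []. Qed.
Lemma hfun_cd0 : cd hfun 0 (-1). Proof. by rewrite /hfun; case: cid => h []. Qed.
Lemma eta_hfun z : Hp z -> eta z = ee (z / 24%:R) * hfun (ee z).
Proof.
move=> hz; rewrite /eta; congr (_ * _).
have h : (fun N : nat => (\prod_(1 <= n < N.+1) (1 - ee (n%:R * z)) : C^o)) @ \oo --> (hfun (ee z) : C^o).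
  apply/clim; rewrite /hfun; case: cid => h [] /= _ H _ _ _ e e0.
  have [|N0 hN0] := H (ee z) _ e e0; first by rewrite cabs_ee_lt1.
  exists N0 => N /hN0; rewrite /hN; under [in X in _ -> X]eq_bigr do rewrite ee_nat.
  by [].
exact: (cvg_lim (@norm_hausdorff _ _) h).
Qed.

(** P = - E_2 / 12 as a function of q, from the logarithmic derivative of q^(1/24) h(q). *)
Definition pq (q : C) : C := - (12%:R)^-1 - 2%:R * (q * dder hfun q / hfun q).

Lemma Hp_open z w : cabs (w - z) < ImC z -> Hp w.
Proof.
move=> h; have := ImC_le (w - z); rewrite ImCD ImCN ler_norml /Hp => /andP[]; lra.
Qed.
Lemma cd_nearH f g z d : Hp z -> (forall w, Hp w -> f w = g w) -> cd f z d -> cd g z d.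
Proof. by move=> hz fg; apply: (@cd_near _ _ _ _ (ImC z)) => // w /Hp_open; exact: fg. Qed.
Lemma cderiv_eq f z d : cd f z d -> cderiv f z = d. Proof. by move=> /cderivP[]. Qed.

Lemma Pfun_pq z : Hp z -> Defs.Pfun z = pq (ee z).
Proof.
move=> hz; have q1 : cabs (ee z) < 1 by rewrite cabs_ee_lt1.
have h0 := hfun_neq0 q1.
have d1 : cd eta z ((tpi * (24%:R)^-1 * ee ((24%:R)^-1 * z)) * hfun (ee z) +
    ee ((24%:R)^-1 * z) * (dder hfun (ee z) * (tpi * ee z))).
  apply: (@cd_nearH (fun z => ee ((24%:R)^-1 * z) * hfun (ee z))) => //.
    by move=> w hw; rewrite eta_hfun // mulrC [w / _]mulrC mulrC.
  by apply: cdM; [exact: cd_eeZ|apply: cd_comp (dderP hfun_hol q1); exact: cd_ee].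
rewrite /Defs.Pfun (cderiv_eq d1) eta_hfun // [z / _]mulrC /pq /tpi.
have e0 := ee_neq0 ((24%:R)^-1 * z); have rp : rC pi != 0 by rewrite rC_eq0 gt_eqF ?pi0.
set E := ee (_ * z) in e0 *; set q := ee z; rewrite rCM rC_nat.
move: (rC pi) rp => PI rp.
rewrite [LHS](_ : _ = iC * iC * (2%:R * ((24%:R)^-1 + dder hfun q * q / hfun q))).
  by rewrite iC2; field.
by field; rewrite rp e0 h0.
Qed.
Lemma pq_hol : dhol pq.
Proof.
apply: dholD; first exact: dhol_cst.
apply: dhol_ext (dholZ (-2%:R) (dholM (dholM dhol_id (dhol_der hfun_hol)) (dholV hfun_hol hfun_neq0))) => q.
by rewrite mulNr.
Qed.
Lemma pq0 : pq 0 = - (12%:R)^-1. Proof. by rewrite /pq mul0r mul0r mulr0 subr0. Qed.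
Lemma cabs01 : cabs 0 < 1. Proof. by rewrite cabs0. Qed.
Lemma dder_pq0 : dder pq 0 = 2%:R.
Proof.
apply: dder_eq.
have h1 := dderP (dhol_der hfun_hol) cabs01.
have h2 := cdV (f := hfun) (z := 0) (ltac:(by rewrite hfun0 oner_eq0)) hfun_cd0.
apply: cd_eq (cdB (cd_cst _ 0) (cdZ 2%:R (cdM (cdM (cd_id 0) h1) h2))) _.
rewrite (dder_eq hfun_cd0) hfun0 !mul0r invr1; ring.
Qed.

(** * Expansions at the cusp in fractional powers of q *)

Definition qrep (l : R) (phi f : C -> C) : Prop :=
  dhol phi /\ forall z, Hp z -> f z = ee (rC l * z) * phi (ee z).
(** The operator D_k on q^l phi(q), read on phi alone. At q = 0 it is multiplication by l - k / 12.
    As phi 0 = 0 is allowed in [qrep], l need not be the exact order. *)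
Definition qD (l k : R) (phi : C -> C) : C -> C :=
  fun q => (rC l + rC k * pq q) * phi q + q * dder phi q.
Lemma qrep_cd l phi f z : qrep l phi f -> Hp z ->
  cd f z (tpi * ee (rC l * z) * (rC l * phi (ee z) + ee z * dder phi (ee z))).
Proof.
move=> [h hf] hz; apply: (@cd_nearH (fun z => ee (rC l * z) * phi (ee z))) => //.
  by move=> w hw; rewrite hf.
apply: cd_eq.
  apply: cdM; first exact: cd_eeZ.
  by apply: cd_comp (dderP h _); [exact: cd_ee|rewrite cabs_ee_lt1].
by rewrite /=; ring.
Qed.
Lemma qrep_Dk l k phi f : qrep l phi f -> qrep l (qD l k phi) (Dk k f).
Proof.
move=> hf; have [h e] := hf; split.
  apply: dholD; last by apply: dholM; [exact: dhol_id|exact: dhol_der].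
  by apply: dholM => //; apply: dholD; [exact: dhol_cst|exact/dholZ/pq_hol].
move=> z hz; rewrite /Dk (cderiv_eq (qrep_cd hf hz)) e // Pfun_pq // /qD -/tpi.
by field; exact: tpi_neq0.
Qed.

(** * The modular group *)
Definition mk2 (a b c d : int) : 'M[int]_2 :=
  \matrix_(i < 2, j < 2) (if i == 0 then (if j == 0 then a else b) else (if j == 0 then c else d)).
Lemma mk2E (g : 'M[int]_2) : g = mk2 (g 0 0) (g 0 1) (g 1 0) (g 1 1).
Proof.
apply/matrixP => i j; rewrite mxE.
by case: i => [[|[|//]] hi]; case: j => [[|[|//]] hj] /=; congr (g _ _); apply: val_inj.
Qed.
Lemma mk2M a b c d a' b' c' d' : mk2 a b c d *m mk2 a' b' c' d' =
  mk2 (a * a' + b * c') (a * b' + b * d') (c * a' + d * c') (c * b' + d * d').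
Proof.
apply/matrixP => i j; rewrite !mxE !big_ord_recl big_ord0 !mxE addr0 /=.
by case: i => [[|[|//]] hi]; case: j => [[|[|//]] hj].
Qed.
Lemma mk2_SL2 a b c d : SL2 (mk2 a b c d) <-> a * d - b * c = 1.
Proof.
rewrite /SL2 (expand_det_row _ ord0) !big_ord_recl big_ord0 /cofactor !det_mx11 !mxE /=.
by rewrite expr0 expr1 !mul1r addr0 mulN1r mulrN.
Qed.
Lemma SL2_det g : SL2 g -> g 0 0 * g 1 1 - g 0 1 * g 1 0 = 1.
Proof. by rewrite {1}(mk2E g) mk2_SL2. Qed.
Lemma SL2_detC g : SL2 g -> ga g * gd g - gb g * gc g = 1.
Proof. by move=> /SL2_det h; rewrite /ga /gb /gc /gd -!intrM -intrB h. Qed.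
Lemma SL2_mul g h : SL2 g -> SL2 h -> SL2 (g *m h).
Proof. by rewrite /SL2 det_mulmx => -> ->; rewrite mulr1. Qed.
Lemma SL2_1 : SL2 1%:M. Proof. by rewrite /SL2 det1. Qed.

Lemma int_rC (n : int) : (n%:~R : C) = rC n%:~R. Proof. by rewrite /rC rmorph_int. Qed.
Lemma Re_int (n : int) : ReC (n%:~R : C) = n%:~R. Proof. by rewrite int_rC. Qed.
Lemma Im_int (n : int) : ImC (n%:~R : C) = 0. Proof. by rewrite int_rC. Qed.
Lemma jac_Im g z : ImC (jac g z) = (g 1 0)%:~R * ImC z.
Proof. by rewrite /jac ImCD ImCM /gc /gd !Im_int Re_int mul0r !addr0. Qed.
Lemma jac_Re g z : ReC (jac g z) = (g 1 0)%:~R * ReC z + (g 1 1)%:~R.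
Proof. by rewrite /jac ReCD ReCM /gc /gd !Re_int Im_int mul0r subr0. Qed.
Lemma jac_neq0 g z : SL2 g -> Hp z -> jac g z != 0.
Proof.
move=> /SL2_det hg hz; apply/eqP => h.
have /eqP := congr1 ImC h; rewrite jac_Im mulf_eq0 (gt_eqF hz) orbF intr_eq0 => /eqP c0.
have /eqP := congr1 ReC h; rewrite jac_Re c0 mul0r add0r intr_eq0 => /eqP d0.
by move: hg; rewrite c0 d0 !mulr0.
Qed.
Lemma ga_Re g z : ReC (ga g * z + gb g) = (g 0 0)%:~R * ReC z + (g 0 1)%:~R.
Proof. by rewrite ReCD ReCM /ga /gb !Re_int Im_int mul0r subr0. Qed.
Lemma ga_Im g z : ImC (ga g * z + gb g) = (g 0 0)%:~R * ImC z.
Proof. by rewrite ImCD ImCM /ga /gb !Im_int Re_int mul0r !addr0. Qed.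
Lemma mob_Im g z : SL2 g -> Hp z -> ImC (mob g z) = ImC z / cabs (jac g z) ^+ 2.
Proof.
move=> hg hz; have j0 := jac_neq0 hg hz; have hd := SL2_det hg.
have e : mob g z * jac g z = ga g * z + gb g by rewrite /mob divfK.
have e1 := congr1 ReC e; have e2 := congr1 ImC e.
rewrite ReCM ga_Re in e1; rewrite ImCM ga_Im in e2.
have J0 : cabs (jac g z) ^+ 2 != 0 by rewrite expf_neq0 // cabs_eq0.
apply: (mulIf J0); rewrite divfK // cabs2.
set X := ReC (mob g z) in e1 e2; set Y := ImC (mob g z) in e1 e2 *.
set A := ReC (jac g z) in e1 e2 *; set B := ImC (jac g z) in e1 e2 *.
have -> : Y * (A ^+ 2 + B ^+ 2) = A * (X * B + Y * A) - B * (X * A - Y * B) by ring.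
rewrite e1 e2 /A /B jac_Re jac_Im.
have hd' : (g 0 0)%:~R * (g 1 1)%:~R - (g 0 1)%:~R * (g 1 0)%:~R = 1 :> R.
  by rewrite -!intrM -intrB hd.
transitivity (((g 0 0)%:~R * (g 1 1)%:~R - (g 0 1)%:~R * (g 1 0)%:~R) * ImC z); first by ring.
by rewrite hd' mul1r.
Qed.
Lemma Hp_mob g z : SL2 g -> Hp z -> Hp (mob g z).
Proof.
move=> hg hz; rewrite /Hp mob_Im // divr_gt0 // exprn_gt0 // cabs_gt0 jac_neq0 //.
Qed.
Lemma gM g h : [/\ ga (g *m h) = ga g * ga h + gb g * gc h, gb (g *m h) = ga g * gb h + gb g * gd h,
  gc (g *m h) = gc g * ga h + gd g * gc h & gd (g *m h) = gc g * gb h + gd g * gd h].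
Proof.
have e := mk2M (g 0 0) (g 0 1) (g 1 0) (g 1 1) (h 0 0) (h 0 1) (h 1 0) (h 1 1).
rewrite -!mk2E in e; rewrite /ga /gb /gc /gd e !mxE /=.
by rewrite !intrD !intrM.
Qed.
Lemma jacM g h z : SL2 h -> Hp z -> jac (g *m h) z = jac g (mob h z) * jac h z.
Proof.
move=> hh hz; have j0 := jac_neq0 hh hz.
have e : mob h z * jac h z = ga h * z + gb h by rewrite /mob divfK.
have -> : jac g (mob h z) * jac h z = gc g * (mob h z * jac h z) + gd g * jac h z.
  by rewrite {1}/jac; ring.
by rewrite e /jac; have [_ _ -> ->] := gM g h; ring.
Qed.
Lemma mobM g h z : SL2 g -> SL2 h -> Hp z -> mob (g *m h) z = mob g (mob h z).
Proof.
move=> hg hh hz; have j0 := jac_neq0 hh hz; have j1 := jac_neq0 hg (Hp_mob hh hz).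
have -> : mob (g *m h) z = (ga (g *m h) * z + gb (g *m h)) / (jac g (mob h z) * jac h z).
  by rewrite -jacM.
have -> : mob g (mob h z) = (ga g * mob h z + gb g) / jac g (mob h z) by [].
have [-> -> _ _] := gM g h.
have e : mob h z * jac h z = ga h * z + gb h by rewrite /mob divfK.
have -> : (ga g * ga h + gb g * gc h) * z + (ga g * gb h + gb g * gd h) =
   (ga g * mob h z + gb g) * jac h z.
  by transitivity (ga g * (mob h z * jac h z) + gb g * jac h z); [rewrite e /jac|]; ring.
by field; rewrite j0 j1.
Qed.
Lemma mob1 z : mob 1%:M z = z.
Proof. by rewrite /mob /jac /ga /gb /gc /gd !mxE /= mul1r mul0r addr0 add0r divr1. Qed.
Lemma cd_jac g z : cd (jac g) z (gc g).
Proof.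
by apply: cd_eq (cdD (cdZ (gc g) (cd_id z)) (cd_cst (gd g) z)) _; rewrite mulr1 addr0.
Qed.
Lemma cd_mob g z : SL2 g -> Hp z -> cd (mob g) z ((jac g z) ^- 2).
Proof.
move=> hg hz; have j0 := jac_neq0 hg hz.
apply: cd_eq.
  apply: cdM; last by apply: cdV j0 (cd_jac g z).
  by apply: cdD; [apply: cdZ; exact: cd_id|exact: cd_cst].
have hd := SL2_detC hg; rewrite mulr1 addr0 /=.
have -> : ga g / jac g z + (ga g * z + gb g) * (- gc g / jac g z ^+ 2) =
   (ga g * jac g z - (ga g * z + gb g) * gc g) / jac g z ^+ 2 by field.
have -> : ga g * jac g z - (ga g * z + gb g) * gc g = ga g * gd g - gb g * gc g by rewrite /jac; ring.
by rewrite hd mul1r.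
Qed.

Definition Tn (n : int) := mk2 1 n 0 1.
Definition Sm := mk2 0 (-1) 1 0.
Lemma Tm_Tn : Tm = Tn 1.
Proof.
apply/matrixP => i j; rewrite !mxE.
by case: i => [[|[|//]] hi]; case: j => [[|[|//]] hj].
Qed.
Lemma SL2_Tn n : SL2 (Tn n). Proof. by apply/mk2_SL2; rewrite mulr0 subr0. Qed.
Lemma SL2_Sm : SL2 Sm. Proof. by apply/mk2_SL2. Qed.
Lemma SL2_Tm : SL2 Tm. Proof. by rewrite Tm_Tn; exact: SL2_Tn. Qed.
Lemma jac_Tn n z : jac (Tn n) z = 1.
Proof. by rewrite /jac /gc /gd !mxE /= mul0r add0r. Qed.
Lemma mob_Tn n z : mob (Tn n) z = z + n%:~R.
Proof. by rewrite /mob jac_Tn /ga /gb !mxE /= mul1r divr1. Qed.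
Lemma jac_Tm z : jac Tm z = 1. Proof. by rewrite Tm_Tn jac_Tn. Qed.
Lemma mob_Tm z : mob Tm z = z + 1. Proof. by rewrite Tm_Tn mob_Tn. Qed.
Lemma jac_Sm z : jac Sm z = z.
Proof. by rewrite /jac /gc /gd !mxE /= mul1r addr0. Qed.
Lemma mob_Sm z : mob Sm z = - z^-1.
Proof. by rewrite /mob jac_Sm /ga /gb !mxE /= mul0r add0r mulN1r. Qed.

(** Translate to |Re z| <= 1/2. If still Im z < 1/2, then |z|^2 <= 1/2 and the inversion at least
    doubles the height, so induction on the number of doublings terminates. *)
Lemma reduceH z : Hp z -> exists2 g, SL2 g & 2^-1 <= ImC (mob g z).
Proof.
have main n : forall z, Hp z -> 2^-1 <= 2 ^+ n * ImC z -> exists2 g, SL2 g & 2^-1 <= ImC (mob g z).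
  elim: n => [|n IH] {}z hz.
    by rewrite expr0 mul1r => h; exists 1%:M; [exact: SL2_1|rewrite mob1].
  move=> h; have [h2|h2] := leP 2^-1 (ImC z).
    by exists 1%:M; [exact: SL2_1|rewrite mob1].
  pose k := - Num.floor (ReC z + 2^-1).
  have hk : `|ReC z + k%:~R| <= 2^-1.
    have := floor_le_tmp (ReC z + 2^-1); have := floorD1_gt (ReC z + 2^-1).
    by rewrite /k intrN intrD ler_norml => *; lra.
  set z1 := mob (Tn k) z; have hz1 : Hp z1 by apply: Hp_mob => //; exact: SL2_Tn.
  have r1 : ReC z1 = ReC z + k%:~R by rewrite /z1 mob_Tn ReCD Re_int.
  have i1 : ImC z1 = ImC z by rewrite /z1 mob_Tn ImCD Im_int addr0.
  have hz2 : Hp (mob Sm z1) by apply: Hp_mob => //; exact: SL2_Sm.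
  have n1 : cabs z1 ^+ 2 <= 2^-1.
    rewrite cabs2 r1 i1; move: hk hz h2; rewrite ler_norml /Hp => /andP[]; nra.
  have n0 : 0 < cabs z1 ^+ 2 by rewrite exprn_gt0 // -(jac_Sm z1) cabs_gt0 jac_neq0 //; exact: SL2_Sm.
  have [|g hg hi] := IH _ hz2.
    rewrite mob_Im ?jac_Sm //; last exact: SL2_Sm.
    apply: (le_trans h); rewrite exprSr -mulrA ler_pM2l ?exprn_gt0 // i1 mulrC ler_pM2l //.
    by rewrite -[leLHS]invrK lef_pV2 ?posrE ?invr_gt0.
  exists (g *m (Sm *m Tn k)).
    by apply: SL2_mul => //; apply: SL2_mul; [exact: SL2_Sm|exact: SL2_Tn].
  by rewrite !mobM //; (try exact: SL2_Tn); (try exact: SL2_Sm); apply: SL2_mul; [exact: SL2_Sm|exact: SL2_Tn].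
move=> hz.
apply: (main (Num.truncn (ImC z)^-1).+1) => //.
have h1 := truncnS_gt (ImC z)^-1.
have : (ImC z)^-1 < 2 ^+ (Num.truncn (ImC z)^-1).+1.
  by apply: (lt_trans h1); rewrite -natrX ltr_nat ltn_expl.
rewrite -(ltr_pM2r hz) mulVf ?gt_eqF // => h2.
by apply: ltW; apply: lt_trans h2; rewrite invf_lt1 ?ltr1n.
Qed.

(** Euclid's algorithm on the first column: a translation followed by [Sm] replaces the lower left
    entry by a remainder, of smaller absolute value. *)
Lemma sl2_ind (Q : 'M[int]_2 -> Prop) : (forall n, Q (Tn n)) -> Q Sm ->
  (forall g h, SL2 g -> SL2 h -> Q g -> Q h -> Q (g *m h)) -> forall g, SL2 g -> Q g.
Proof.
move=> QT QS QM g.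
move: {2}(absz (g 1 0)).+1 (ltnSn (absz (g 1 0))) => n; elim: n g => // n IH g hn hg.
have QSS : Q (Sm *m Sm) by apply: (QM _ _) => //; exact: SL2_Sm.
have SSS : SL2 (Sm *m Sm) by apply: SL2_mul; exact: SL2_Sm.
have hd := SL2_det hg.
have [c0|c0] := eqVneq (g 1 0) 0.
  rewrite c0 mulr0 subr0 in hd.
  have : (g 0 0 = 1 /\ g 1 1 = 1) \/ (g 0 0 = -1 /\ g 1 1 = -1).
    have /eqP := congr1 absz hd; rewrite abszM muln_eq1 => /andP[/eqP ea /eqP ed].
    have [a|a] : g 0 0 = 1 \/ g 0 0 = -1 by lia.
      by left; rewrite a mul1r in hd.
    by right; rewrite a mulN1r in hd; split => //; lia.
  case=> -[a d].
    by rewrite (mk2E g) a d c0; exact: QT.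
  have -> : g = Sm *m Sm *m Tn (- g 0 1).
    by rewrite [LHS](mk2E g) a d c0 /Sm /Tn !mk2M; congr mk2; ring.
  by apply: (QM _ _) => //; exact: SL2_Tn.
pose q := divz (g 0 0) (g 1 0).
pose g' : 'M[int]_2 := Sm *m Tn (- q) *m g.
have hg' : SL2 g' by apply: SL2_mul => //; apply: SL2_mul; [exact: SL2_Sm|exact: SL2_Tn].
have e10 : g' 1 0 = modz (g 0 0) (g 1 0).
  rewrite /g' (mk2E g) /Sm /Tn !mk2M !mxE /= /modz -/q; ring.
have Qg' : Q g'.
  apply: IH => //; apply: leq_trans (ltnSE hn).
  rewrite e10; have := modz_ge0 (g 0 0) c0; have := ltz_mod (g 0 0) c0; lia.
(* The cube of [Sm] is its inverse, so g is a product of generators with [g']. *)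
have -> : g = Tn q *m (Sm *m Sm *m (Sm *m g')).
  rewrite /g' [in RHS](mk2E g) /Sm /Tn !mk2M [LHS](mk2E g); congr mk2; ring.
apply: (QM _ _) => //; first exact: SL2_Tn.
  apply: SL2_mul => //; apply: SL2_mul => //; exact: SL2_Sm.
apply: (QM _ _) => //; first by apply: SL2_mul => //; exact: SL2_Sm.
by apply: (QM _ _) => //; exact: SL2_Sm.
Qed.

(** * Principal powers and logarithm of the automorphy factor *)

Lemma cpow_neq0 w s : w != 0 -> cpow w s != 0.
Proof. by move=> w0; rewrite /cpow (negbTE w0) cexp_neq0. Qed.
Lemma cpowD w s t : w != 0 -> cpow w (s + t) = cpow w s * cpow w t.
Proof. by move=> w0; rewrite /cpow (negbTE w0) -cexpD rCD mulrDl. Qed.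
Lemma cpow_nat w n : w != 0 -> cpow w n%:R = w ^+ n.
Proof. by move=> w0; rewrite /cpow (negbTE w0) rC_nat cexp_nat cexp_Logc. Qed.
Lemma cpow_int w (n : int) : w != 0 -> cpow w n%:~R = w ^ n.
Proof.
move=> w0; case: n => n; first exact: cpow_nat.
apply: (mulfI (cpow_neq0 n.+1%:R w0)); rewrite -cpowD // NegzE mulrNz.
rewrite subrr cpow_nat // -exprnN mulfV ?expf_neq0 //.
by rewrite /cpow (negbTE w0) rC0 mul0r cexp0.
Qed.
Lemma cpow1 s : cpow 1 s = 1.
Proof.
rewrite /cpow oner_eq0; have -> : Logc 1 = 0.
  apply: eqReIm; first by rewrite Logc_Re cabs1 ln1.
  by rewrite Logc_Im /Arg /= ltr01 mul0r atan0.
by rewrite mulr0 cexp0.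
Qed.

Lemma rcomp_cont (f : R -> R) (p : C -> R) z : {for p z, continuous (f : R^o -> R^o)} ->
  (forall e : R, 0 < e -> exists2 d : R, 0 < d & forall w, cabs (w - z) < d -> `|p w - p z| < e) ->
  forall e : R, 0 < e -> exists2 d : R, 0 < d & forall w, cabs (w - z) < d -> `|f (p w) - f (p z)| < e.
Proof.
move=> /cvgrPdist_lt cf cp e e0; have [d /= d0 hd] := cf e e0.
have [d' d'0 hd'] := cp d d0; exists d' => // w /hd' hw.
by rewrite distrC; apply: hd; rewrite /= distrC.
Qed.
Lemma ccont_real f z : ccont f z -> forall e : R, 0 < e -> exists2 d : R, 0 < d &
   forall w, cabs (w - z) < d -> `|ReC (f w) - ReC (f z)| < e /\ `|ImC (f w) - ImC (f z)| < e /\ `|cabs (f w) - cabs (f z)| < e.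
Proof.
move=> cf e e0; have [d d0 hd] := cf e e0; exists d => // w /hd h.
split; first by apply: le_lt_trans h; rewrite -ReCN -ReCD ReC_le.
split; first by apply: le_lt_trans h; rewrite -ImCN -ImCD ImC_le.
apply: le_lt_trans h; rewrite ler_norml; have := cabsB_ge (f w) (f z); have := cabsB_ge (f z) (f w).
by rewrite [cabs (f z - f w)]cabsB => *; apply/andP; split; lra.
Qed.

Lemma ccont_Logc w : ImC w != 0 -> ccont Logc w.
Proof.
move=> y0.
have w0 : w != 0 by apply: contra y0 => /eqP ->.
have cn : forall e : R, 0 < e -> exists2 d : R, 0 < d & forall v, cabs (v - w) < d -> `|ln (cabs v) - ln (cabs w)| < e.
  apply: rcomp_cont; first by apply: continuous_ln; rewrite cabs_gt0.
  move=> e e0; have [d d0 hd] := ccont_real (@ccont_id w) e0.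
  by exists d => // v /hd [_ [_]].
have cq : forall e : R, 0 < e -> exists2 d : R, 0 < d & forall v, cabs (v - w) < d ->
    `|ReC v / ImC v - ReC w / ImC w| < e.
  have rn : rC (ImC w) != 0 by rewrite rC_eq0.
  have cRe : ccont (fun v => rC (ReC v)) w.
    by move=> e e0; exists e => // v hv; rewrite -rCB cabs_rC -ReCN -ReCD; apply: le_lt_trans (ReC_le _) hv.
  have cIm : ccont (fun v => rC (ImC v)) w.
    by move=> e e0; exists e => // v hv; rewrite -rCB cabs_rC -ImCN -ImCD; apply: le_lt_trans (ImC_le _) hv.
  move=> e e0; have [d d0 hd] := ccontM cRe (ccont_comp cIm (ccont_inv rn)) e0.
  exists d => // v /hd; rewrite -!rCV -!rCM -rCB cabs_rC; exact.
have ca : forall e : R, 0 < e -> exists2 d : R, 0 < d & forall v, cabs (v - w) < d ->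
    `|atan (ReC v / ImC v) - atan (ReC w / ImC w)| < e.
  by apply: (@rcomp_cont (@atan _) (fun v => ReC v / ImC v)) => //; exact: continuous_atan.
move=> e e0.
have [d1 d10 h1] := cn (e / 2) ltac:(lra).
have [d2 d20 h2] := ca (e / 2) ltac:(lra).
have i0 : 0 < `|ImC w| by rewrite normr_gt0.
exists (Num.min (Num.min d1 d2) `|ImC w|); first by rewrite !lt_min d10 d20.
move=> v; rewrite !lt_min => /andP[/andP[/h1 k1 /h2 k2] k3].
have k4 : `|ImC v - ImC w| < `|ImC w| by apply: le_lt_trans k3; rewrite -ImCN -ImCD ImC_le.
have [vn sg] : ImC v != 0 /\ (0 < ImC v) = (0 < ImC w).
  case/orP: (lt_total y0) => s.
    rewrite (ltr0_norm s) ltr_norml in k4.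
    have vneg : ImC v < 0 by case/andP: k4; lra.
    by rewrite (lt_eqF vneg) !ltNge (ltW vneg) (ltW s).
  rewrite (gtr0_norm s) ltr_norml in k4.
  have vpos : 0 < ImC v by case/andP: k4; lra.
  by rewrite (gt_eqF vpos) vpos s.
apply: (le_lt_trans (cabs_le _)).
rewrite ReCD ReCN ImCD ImCN !Logc_Re !Logc_Im !Arg_nonreal // sg.
have -> : forall c x y : R, c - x - (c - y) = - (x - y) by move=> *; ring.
rewrite normrN; lra.
Qed.

(** The Caratheodory slope of [cexp] at Logc w is nonzero, and its inverse, composed with [Logc], is
    a slope for [Logc]. *)
Lemma cd_Logc w : ImC w != 0 -> cd Logc w (w^-1).
Proof.
move=> y0; have w0 : w != 0 by apply: contra y0 => /eqP ->.
have [p [hp cp ep]] := cd_cexp (Logc w).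
rewrite cexp_Logc // in ep hp.
have pc : ccont (fun v => p (Logc v)) w by apply: ccont_comp => //; exact: ccont_Logc.
have [d d0 hd] := pc (cabs w) ltac:(by rewrite cabs_gt0).
have pn v : cabs (v - w) < d -> p (Logc v) != 0.
  by move=> /hd h; apply/eqP => e; rewrite e ep sub0r cabsN ltxx in h.
pose r := Num.min d (cabs w); have r0 : 0 < r by rewrite lt_min d0 cabs_gt0.
(* A slope must fit at every point, so the function is redefined away from w to agree with the
   candidate. *)
apply: (@cd_near (fun v => if cabs (v - w) < r then Logc v else Logc w + (p (Logc v))^-1 * (v - w)) _ _ _ r) => //.
  by move=> v ->.
exists (fun v => (p (Logc v))^-1 ); split.
- move=> v; rewrite subrr cabs0 r0; case: ifP => //; rewrite lt_min => /andP[vd vw].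
  have v0 : v != 0 by apply/eqP => e; rewrite e sub0r cabsN ltxx in vw.
  have := hp (Logc v); rewrite cexp_Logc // => e.
  have -> : v - w = p (Logc v) * (Logc v - Logc w) by rewrite {1}e addrC addKr.
  by rewrite mulKf ?pn // addrC subrK.
- by apply: ccont_comp pc _; apply: ccont_inv; rewrite ep.
- by rewrite ep.
Qed.

Lemma cd_cpow_jac g k z : SL2 g -> Hp z ->
  cd (fun z => cpow (jac g z) k) z (rC k * gc g / jac g z * cpow (jac g z) k).
Proof.
move=> hg hz; have j0 := jac_neq0 hg hz.
(* For c = 0 the factor is constant, possibly -1 on the branch cut; otherwise it is never real on
   the half-plane. *)
have [c0|c0] := eqVneq (g 1 0) 0.
  have e w : jac g w = gd g by rewrite /jac /gc c0 mul0r add0r.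
  have -> : gc g = 0 by rewrite /gc c0.
  rewrite mulr0 !mul0r; apply: cd_ext (cd_cst (cpow (gd g) k) z) => w.
  by rewrite e.
have im w : Hp w -> ImC (jac g w) != 0.
  by move=> hw; rewrite jac_Im mulf_neq0 ?intr_eq0 // gt_eqF.
apply: (@cd_nearH (fun z => cexp (rC k * Logc (jac g z)))) => //.
  by move=> w hw; rewrite /cpow (negbTE (jac_neq0 hg hw)).
apply: cd_eq.
  apply: cd_comp (cd_cexp _); apply: cdZ.
  by apply: cd_comp (cd_Logc (im z hz)); exact: cd_jac.
by rewrite /cpow (negbTE j0); field.
Qed.

Lemma holoP f : holo f <-> holH f.
Proof.
split=> h z hz; first by exists (cderiv f z); apply/cderivP; split => //; exact: h.
by have [d /cderivP[]] := h z hz.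
Qed.

(** * Scalar modular forms *)
(* a multiplicative form of the bound |f (x + s)| <= e^(M s) |f x| is stable under bisection *)
Lemma gronwall (f : C -> C) (a b : C) (M : R) : 0 <= M ->
  (forall t : R, 0 <= t <= 1 -> exists2 d, cd f (a + rC t * (b - a)) d &
     cabs d <= M * cabs (f (a + rC t * (b - a)))) ->
  f a = 0 -> f b = 0.
Proof.
move=> M0 hf fa; pose Z t := a + rC t * (b - a); pose W t := f (Z t).
pose L := cabs (b - a); have L0 : 0 <= L := cabs_ge0 _.
pose K := M * L; have K0 : 0 <= K by rewrite mulr_ge0.
have ZB s t : Z s - Z t = rC (s - t) * (b - a) by rewrite /Z rCB; ring.
suff main e : 0 < e -> cabs (W 1) <= expR K * (cabs (W 0) + e).
  have W0 : W 0 = 0 by rewrite /W /Z rC0 mul0r addr0.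
  have W1 : W 1 = f b by rewrite /W /Z rC1 mul1r addrC subrK.
  rewrite -W1; apply: eps_eq0 => e e0.
  have := main (e / expR K) ltac:(by rewrite divr_gt0 ?expR_gt0).
  by rewrite W0 cabs0 add0r mulrC divfK // gt_eqF ?expR_gt0.
move=> e0.
(* The second coordinate of [bisect2] is idle here; the slack e s absorbs the error of the linear
   approximation. *)
pose P (x y s : R) := 0 <= x -> x + s <= 1 -> cabs (W (x + s)) <= expR (K * s) * (cabs (W x) + e * s).
have : P 0 0 1.
  apply: bisect2 => //.
    move=> x y s s0 p1 p2 _ _ x0 x1.
    have h1 := p1 x0 ltac:(lra); have := p2 ltac:(lra) ltac:(lra).
    have -> : x + s / 2 + s / 2 = x + s by field.
    move/le_trans; apply.
    have -> : expR (K * s) = expR (K * (s / 2)) * expR (K * (s / 2)).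
      by rewrite -exp.expRD; congr expR; field.
    rewrite -mulrA ler_pM2l ?expR_gt0 //.
    have E1 : 1 <= expR (K * (s / 2)).
      by apply: le_trans (expR_ge1Dx _); rewrite lerDl mulr_ge0 // divr_ge0 // ltW.
    have : e * (s / 2) <= expR (K * (s / 2)) * (e * (s / 2)).
      by rewrite ler_peMl // mulr_ge0 ?divr_ge0 // ltW.
    move: h1; set E := expR _; set A := cabs (W x).
    have -> : e * s = e * (s / 2) + e * (s / 2) by field.
    by move: (e * (s / 2)) => u; rewrite !mulrDr; lra.
  move=> p q; rewrite add0r => hp _.
  have [d hd hM] := hf p hp; rewrite -/(Z p) -/(W p) in hd hM.
  pose e' := Num.min 1 (e / (4 * (L + 1))).
  have L1 : 0 < L + 1 by lra.
  have e'0 : 0 < e' by rewrite lt_min ltr01 divr_gt0 // mulr_gt0.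
  have e'1 : e' <= 1 by rewrite ge_min lexx.
  have e'L : e' * (4 * (L + 1)) <= e by rewrite -ler_pdivlMr ?mulr_gt0 // ge_min lexx orbT.
  have [dl dl0 hdl] := (cdP _ _ _).1 hd e' e'0.
  pose A := K * ((cabs d + 1) * L) + 1.
  have A0 : 0 < A.
    have : 0 <= K * ((cabs d + 1) * L) by rewrite !mulr_ge0 // addr_ge0 // cabs_ge0.
    rewrite /A; lra.
  exists (Num.min (dl / (L + 1)) (e / (2 * A))).
    by rewrite lt_min !divr_gt0 // mulr_gt0.
  move=> x y s /andP[s0]; rewrite lt_min => /andP[s1 s2] i1 i2 _ _ /andP[j1 j2] _ x0 x1.
  rewrite ltr_pdivlMr // in s1; rewrite ltr_pdivlMr ?mulr_gt0 // in s2.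
  have near t : x <= t <= x + s -> cabs (W t - W p - d * (Z t - Z p)) <= e' * (s * L) /\ cabs (Z t - Z p) <= s * L.
    move=> ht; have zb : cabs (Z t - Z p) <= s * L.
      by rewrite ZB cabsM cabs_rC ler_wpM2r // ler_norml; lra.
    split => //; apply: le_trans (hdl (Z t) _) _; last by rewrite ler_pM2l.
    by apply: le_lt_trans zb _; nra.
  have [n1 z1] := near x ltac:(lra); have [n2 z2] := near (x + s) ltac:(lra).
  have step : cabs (W (x + s) - W x) <= cabs d * (s * L) + 2 * (e' * (s * L)).
    have -> : W (x + s) - W x = d * (Z (x + s) - Z x) + ((W (x + s) - W p - d * (Z (x + s) - Z p))
        - (W x - W p - d * (Z x - Z p))) by ring.
    apply: (le_trans (cabsD _ _)).
    have := cabsD (W (x + s) - W p - d * (Z (x + s) - Z p)) (- (W x - W p - d * (Z x - Z p))).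
    have : cabs (d * (Z (x + s) - Z x)) = cabs d * (s * L).
      by rewrite cabsM ZB cabsM cabs_rC [x + s]addrC addrK gtr0_norm.
    rewrite cabsN; lra.
  have Wp : cabs (W p) <= cabs (W x) + (cabs d + 1) * (s * L).
    have := cabsB_ge (W p) (W x); have -> : W p - W x = - (W x - W p - d * (Z x - Z p)) - d * (Z x - Z p) by ring.
    have := cabsD (- (W x - W p - d * (Z x - Z p))) (- (d * (Z x - Z p))); rewrite !cabsN cabsM.
    have : cabs d * cabs (Z x - Z p) <= cabs d * (s * L) by rewrite ler_wpM2l // cabs_ge0.
    have : e' * (s * L) <= s * L by rewrite ler_piMl // mulr_ge0 // ltW.
    lra.
  have Wxs : cabs (W (x + s)) <= (1 + K * s) * (cabs (W x) + e * s).
    have h1 := cabsB_ge (W (x + s)) (W x).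
    have h2 : cabs d * (s * L) <= K * s * cabs (W p).
      have -> : K * s * cabs (W p) = M * cabs (W p) * (s * L) by rewrite /K; ring.
      by rewrite ler_wpM2r // mulr_ge0 // ltW.
    have Ks0 : 0 <= K * s by rewrite mulr_ge0 // ltW.
    have h3 : K * s * cabs (W p) <= K * s * (cabs (W x) + (cabs d + 1) * (s * L)) by rewrite ler_wpM2l.
    have h4 : K * s * ((cabs d + 1) * (s * L)) <= e / 2 * s.
      have -> : K * s * ((cabs d + 1) * (s * L)) = (A - 1) * s * s by rewrite /A; ring.
      rewrite ler_pM2r //; nra.
    have h5 : 2 * (e' * (s * L)) <= e / 2 * s.
      have -> : 2 * (e' * (s * L)) = (e' * (4 * L)) / 2 * s by field.
      rewrite ler_pM2r //; nra.
    have h6 : 0 <= K * s * (e * s) by rewrite mulr_ge0 // mulr_ge0 // ltW.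
    rewrite mulrDr in h3; rewrite mulrDl mul1r mulrDr; lra.
  apply: (le_trans Wxs); rewrite ler_wpM2r ?expR_ge1Dx //.
  by rewrite addr_ge0 ?cabs_ge0 // mulr_ge0 // ltW.
by move/(_ (lexx _)); rewrite add0r !mulr1; apply.
Qed.

Lemma seg_Im a b t : 0 <= t <= 1 -> Num.min (ImC a) (ImC b) <= ImC (a + rC t * (b - a)).
Proof.
move=> ht; rewrite ImCD ImCM ReC_rC ImC_rC mul0r addr0 ImCD ImCN.
have m1 : Num.min (ImC a) (ImC b) <= ImC a by rewrite ge_min lexx.
have m2 : Num.min (ImC a) (ImC b) <= ImC b by rewrite ge_min lexx orbT.
move: m1 m2; set m := Num.min _ _; case/andP: ht => t0 t1; nra.
Qed.
Lemma seg_Hp a b t : Hp a -> Hp b -> 0 <= t <= 1 -> Hp (a + rC t * (b - a)).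
Proof.
move=> ha hb ht; apply: lt_le_trans (seg_Im a b ht).
by rewrite lt_min; apply/andP.
Qed.
Lemma const_H f : (forall z, Hp z -> cd f z 0) -> forall z w, Hp z -> Hp w -> f z = f w.
Proof.
move=> h z w hz hw; apply/esym/eqP; rewrite -subr_eq0; apply/eqP.
apply: (@gronwall (fun x => f x - f z) z w 0) => //; last by rewrite subrr.
move=> t ht; exists 0; last by rewrite cabs0 mul0r.
by apply: cd_eq (cdB (h _ (seg_Hp hz hw ht)) (cd_cst _ _)) _; rewrite subr0.
Qed.

Lemma dhol_bnd phi c : dhol phi -> 0 < c ->
  exists2 B, 0 < B & forall z, c <= ImC z -> cabs (phi (ee z)) <= B.
Proof.
move=> h c0; have [fh _ _] := comp_ee_hol h; have c2 : 0 < c / 2 by lra.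
have [t|M M0 hM] := @line_bound (fun w => phi (ee w)) (c / 2).
  by apply: holH_cont => //; rewrite /Hp Mk_Im.
have r : eerad c < eerad (c / 2) by rewrite ltr_expR ltrN2 ltr_pM2l ?mulr_gt0 ?pi0 //; lra.
exists (2 * (M * (eerad (c / 2) / (eerad (c / 2) - eerad c)))).
  by rewrite !mulr_gt0 ?eerad_gt0 // invr_gt0 subr_gt0.
move=> z hz; have ez : cabs (ee z) <= eerad c.
  by rewrite cabs_ee ler_expR lerN2 ler_pM2l // mulr_gt0 ?pi0.
apply: (le_trans (cauchy_le h c2 (le_lt_trans ez r) hM)).
rewrite ler_pM2l // ler_pM2l // ler_pM2l ?eerad_gt0 // lef_pV2 ?posrE ?subr_gt0 //; first lra.
exact: le_lt_trans r.
Qed.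

Lemma exp_poly_small N (c e : R) : 0 < c -> 0 < e ->
  exists2 Y : R, 0 < Y & forall y, Y < y -> y ^+ N * expR (- (c * y)) <= e.
Proof.
move=> c0 e0; pose F : R := N.+1`!%:R; have F0 : 0 < F by rewrite ltr0n fact_gt0.
have cN : 0 < c ^+ N.+1 by rewrite exprn_gt0.
exists (F / c ^+ N.+1 / e); first by rewrite !divr_gt0.
move=> y hy; have y0 : 0 < y by apply: lt_trans hy; rewrite !divr_gt0.
have h := expR_ge1Dxn N (ltW (mulr_gt0 c0 y0)).
have x0 : 0 < (c * y) ^+ N.+1 / F by rewrite divr_gt0 // exprn_gt0 // mulr_gt0.
have h2 : (c * y) ^+ N.+1 / F <= expR (c * y) by rewrite /F; lra.
have h3 : expR (- (c * y)) <= F / (c * y) ^+ N.+1.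
  by rewrite expRN -[leRHS]invrK invf_div lef_pV2 ?posrE ?expR_gt0.
have yN : 0 < y ^+ N by rewrite exprn_gt0.
apply: (@le_trans _ _ (y ^+ N * (F / (c * y) ^+ N.+1))); first by rewrite ler_pM2l.
have -> : y ^+ N * (F / (c * y) ^+ N.+1) = (F / c ^+ N.+1) / y.
  by rewrite exprMn [y ^+ N.+1]exprS; field; rewrite !gt_eqF.
by rewrite ler_pdivrMr // [e * y]mulrC; move: hy; rewrite ltr_pdivrMr // => /ltW.
Qed.

Definition mod1 (f : C -> C) := exists (N : nat) (c : R), forall z, c < ImC z -> cabs (f z) <= ImC z ^+ N.

Lemma cabs_eeR l z : cabs (ee (rC l * z)) = expR (- (2 * pi * l * ImC z)).
Proof. by rewrite cabs_ee ImCM ReC_rC ImC_rC mul0r addr0 mulrA. Qed.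
Lemma eeR_neq0 l z : ee (rC l * z) != 0. Proof. exact: ee_neq0. Qed.

(** Dividing by q^l gives a periodic function, and q^(1 - l) with l < 1 beats any power of Im z, so
    that [decay] holds. *)
Lemma qrep_moderate l f : 0 <= l < 1 -> holH f -> mod1 f ->
  (forall z, Hp z -> f (z + 1) = ee (rC l) * f z) -> exists phi, qrep l phi f.
Proof.
move=> /andP[l0 l1] fh [N [c hc]] ft.
(* Extended by 0 because [per1] asks for periodicity on the whole plane. *)
pose g z := if 0 < ImC z then ee (- (rC l * z)) * f z else 0.
have gH z : Hp z -> g z = ee (- (rC l * z)) * f z by rewrite /g /Hp => ->.
have [|||phi hphi hg] := @q_expansion g.
- move=> z hz; have [d hd] := fh z hz; eexists.
  apply: (@cd_nearH (fun z => ee (- rC l * z) * f z)) => //; last by apply: cdM hd; exact: cd_eeZ.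
  by move=> w hw; rewrite gH // mulNr.
- move=> z; rewrite /g ImCD addr0; case: ifP => // hz.
  rewrite ft // mulrA -eeD; congr (ee _ * _); ring.
- move=> e e0; have c0 : 0 < 2 * pi * (1 - l) by rewrite mulr_gt0 ?mulr_gt0 ?pi0 // subr_gt0.
  have [Y Y0 hY] := exp_poly_small N c0 e0.
  exists (Num.max Y c) => z; rewrite gt_max => /andP[zY zc].
  have z0 : Hp z by exact: lt_trans zY.
  rewrite gH // mulrA -eeD cabsM.
  have -> : z + - (rC l * z) = rC (1 - l) * z by rewrite rCB rC1; ring.
  rewrite cabs_eeR mulrC; apply: le_trans (hY _ zY).
  by rewrite ler_wpM2r ?expR_ge0 // hc.
exists phi; split => // z hz; rewrite -hg // gH // mulrA -eeD subrr ee0 mul1r //.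
Qed.

Lemma qrep_holH l phi f : qrep l phi f -> holH f.
Proof. by move=> h z hz; eexists; exact: qrep_cd h hz. Qed.
Lemma qrep_bnd l phi f : 0 <= l -> qrep l phi f ->
  exists c, forall z, c < ImC z -> cabs (f z) <= ImC z.
Proof.
move=> l0 [h hf]; have [B B0 hB] := dhol_bnd h (ltac:(lra) : 0 < (1 : R)).
exists (Num.max 1 B) => z; rewrite gt_max => /andP[z1 zB].
have z0 : Hp z by apply: lt_trans z1.
rewrite hf // cabsM cabs_eeR; apply: le_trans (ltW zB).
rewrite -[leRHS]mul1r; apply: ler_pM; rewrite ?expR_ge0 ?cabs_ge0 ?hB ?(ltW z1) //.
by rewrite expR_le1 oppr_le0 !mulr_ge0 ?pi_ge0 // ltW.
Qed.
Lemma qrep_mod1 l phi f : 0 <= l -> qrep l phi f -> mod1 f.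
Proof. by move=> l0 /(qrep_bnd l0)[c hc]; exists 1%N, c => z; rewrite expr1; exact: hc. Qed.
Lemma qrepM l l' phi psi f g : qrep l phi f -> qrep l' psi g ->
  qrep (l + l') (fun q => phi q * psi q) (fun z => f z * g z).
Proof.
move=> [h hf] [h' hg]; split; first exact: dholM.
by move=> z hz; rewrite hf // hg // rCD mulrDl eeD; ring.
Qed.
Lemma qrepD l phi psi f g : qrep l phi f -> qrep l psi g ->
  qrep l (fun q => phi q + psi q) (fun z => f z + g z).
Proof.
move=> [h hf] [h' hg]; split; first exact: dholD.
by move=> z hz; rewrite hf // hg // mulrDr.
Qed.
Lemma qrepZ l c phi f : qrep l phi f -> qrep l (fun q => c * phi q) (fun z => c * f z).
Proof.
move=> [h hf]; split; first exact: dholZ.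
by move=> z hz; rewrite hf //; ring.
Qed.
Lemma qrep_ext l phi f g : (forall z, Hp z -> f z = g z) -> qrep l phi f -> qrep l phi g.
Proof. by move=> fg [h hf]; split => // z hz; rewrite -fg // hf. Qed.
(** The tool for comparing leading coefficients at the cusp. *)
Lemma qrep_uniq l phi psi f : qrep l phi f -> qrep l psi f -> phi 0 = psi 0.
Proof.
move=> [h hf] [h' hf']; apply: (@ccont_eq_pt phi psi 0 1) => //.
- by apply: dhol_cont => //; exact: cabs01.
- by apply: dhol_cont => //; exact: cabs01.
move=> w w0; rewrite subr0 => w1; have [z ez] := ee_surj w0.
have hz : Hp z by rewrite /Hp -cabs_ee_lt1 ez.
by apply: (mulfI (eeR_neq0 l z)); rewrite -ez -hf // hf'.
Qed.
Lemma qrep_zero l phi f : qrep l phi f -> (forall z, Hp z -> f z = 0) -> phi 0 = 0.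
Proof.
move=> h f0; apply: (@qrep_uniq l phi (fun=> 0) f h).
by split; [exact: dhol_cst|move=> z hz; rewrite f0 // mulr0].
Qed.

Definition qr := qrep 0.
Lemma qrE phi f z : qr phi f -> Hp z -> f z = phi (ee z).
Proof. by move=> [_ h] hz; rewrite h // rC0 mul0r ee0 mul1r. Qed.
Lemma qrI phi f : dhol phi -> (forall z, Hp z -> f z = phi (ee z)) -> qr phi f.
Proof. by move=> h hf; split => // z hz; rewrite hf // rC0 mul0r ee0 mul1r. Qed.
Lemma qrM phi psi f g : qr phi f -> qr psi g -> qr (fun q => phi q * psi q) (fun z => f z * g z).
Proof. by move=> h h'; have := qrepM h h'; rewrite addr0. Qed.

Definition autf (k : int) (f : C -> C) := forall g, SL2 g -> forall z, Hp z -> f (mob g z) = jac g z ^ k * f z.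

Lemma mod1P f : moderate (fun z => (f z)%:M : 'cV[C]_1) <-> mod1 f.
Proof.
split=> -[N [c hc]]; exists N, c => z hz.
  by have := hc z hz 0; rewrite mxE eqxx mulr1n cabs_norm lecR.
by move=> j; rewrite (ord1 j) mxE eqxx mulr1n cabs_norm lecR; exact: hc.
Qed.
Lemma MFP k f : MF k f <-> (exists phi, qr phi f) /\ autf k f.
Proof.
split=> [[/holoP fh /mod1P fm fa]|[[phi h] fa]].
  split => //; apply: qrep_moderate => //; first by rewrite lexx ltr01.
  move=> z hz; have := fa Tm SL2_Tm z hz; rewrite mob_Tm jac_Tm => ->.
  by rewrite exp1rz rC0 ee0.
split => //; [exact/holoP/(qrep_holH h)|exact/mod1P/(qrep_mod1 (lexx _) h)].
Qed.
Lemma MF_ext k f g : (forall z, Hp z -> f z = g z) -> MF k f -> MF k g.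
Proof.
move=> fg /MFP[[phi h] fa]; apply/MFP; split; first by exists phi; exact: qrep_ext fg h.
by move=> s hs z hz; rewrite -!fg ?fa //; exact: Hp_mob.
Qed.
Lemma MFM k l f g : MF k f -> MF l g -> MF (k + l) (fun z => f z * g z).
Proof.
move=> /MFP[[phi h] fa] /MFP[[psi h'] ga]; apply/MFP; split; first by eexists; exact: qrM h h'.
move=> s hs z hz; rewrite fa // ga // expfzDr ?jac_neq0 //; ring.
Qed.
Lemma MFD k f g : MF k f -> MF k g -> MF k (fun z => f z + g z).
Proof.
move=> /MFP[[phi h] fa] /MFP[[psi h'] ga]; apply/MFP; split; first by eexists; exact: qrepD h h'.
by move=> s hs z hz; rewrite fa // ga // mulrDr.
Qed.
Lemma MFZ k c f : MF k f -> MF k (fun z => c * f z).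
Proof.
move=> /MFP[[phi h] fa]; apply/MFP; split; first by eexists; exact: qrepZ h.
by move=> s hs z hz; rewrite fa //; ring.
Qed.
Lemma MFB k f g : MF k f -> MF k g -> MF k (fun z => f z - g z).
Proof.
by move=> hf /(MFZ (-1)) hg; apply: MF_ext (MFD hf hg) => z _; rewrite mulN1r.
Qed.
Lemma MF_cst c : MF 0 (fun=> c).
Proof.
apply/MFP; split; first by exists (fun=> c); apply: qrI => //; exact: dhol_cst.
by move=> s hs z hz; rewrite expr0z mul1r.
Qed.

(** By [reduceH] some gz has height at least 1/2, where f is bounded, and then |cz + d|^2 <= 2 Im z.
    So f(z) = (cz + d)^(-k) f(gz) tends to 0 as Im z does, and [dhol_bdry0] applies. *)
Lemma MF_neg k f : k < 0 -> MF k f -> forall z, Hp z -> f z = 0.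
Proof.
move=> k0 /MFP[[phi h] fa].
have [B B0 hB] := dhol_bnd h.1 (ltac:(by rewrite invr_gt0) : 0 < (2^-1 : R)).
have p0 := dhol_bdry0 h.1.
suff H : forall q, cabs q < 1 -> phi q = 0.
  by move=> z hz; rewrite (qrE h hz) H // cabs_ee_lt1.
apply: p0 => e e0; pose x := e / B; have x0 : 0 < x by rewrite divr_gt0.
exists (Num.min 2^-1 (x ^+ 2 / 2)); first by rewrite lt_min invr_gt0 ltr0n divr_gt0 // exprn_gt0.
move=> z /andP[hz]; rewrite lt_min => /andP[z1 z2].
have [g hg hw] := reduceH hz; have hw' := Hp_mob hg hz; have j0 := jac_neq0 hg hz.
rewrite -(qrE h hz); have := fa g hg z hz.
case: k k0 {fa} => // n _; rewrite NegzE => fw.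
have e1 : f z = jac g z ^+ n.+1 * f (mob g z).
  by rewrite fw mulrA -exprnN mulfV ?mul1r // expf_neq0.
rewrite mob_Im // ler_pdivlMr ?exprn_gt0 ?cabs_gt0 // in hw.
have J0 := cabs_ge0 (jac g z).
have J1 : cabs (jac g z) <= 1.
  by rewrite -(@ler_pXn2r _ 2) ?nnegrE // expr1n; lra.
have Jx : cabs (jac g z) <= x.
  by rewrite -(@ler_pXn2r _ 2) ?nnegrE ?(ltW x0) //; lra.
rewrite e1 cabsM cabsX.
have h1 : cabs (jac g z) ^+ n.+1 <= x.
  by apply: le_trans Jx; rewrite exprS ler_piMr // exprn_ile1.
have h2 : cabs (f (mob g z)) <= B.
  rewrite (qrE h hw') hB // ; rewrite mob_Im // ler_pdivlMr ?exprn_gt0 ?cabs_gt0 //.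
have -> : e = x * B by rewrite /x divfK // gt_eqF.
by apply: ler_pM; rewrite ?exprn_ge0 ?cabs_ge0.
Qed.

(** The transformation law of - E_2 / 12; it stays a hypothesis until [quasiP_MLDE] derives it from
    the differential equation. *)
Definition quasi_P := forall g z, SL2 g -> Hp z ->
  Defs.Pfun (mob g z) = jac g z ^+ 2 * Defs.Pfun z - gc g * jac g z / tpi.

Lemma qr_P : qr pq Defs.Pfun.
Proof. by apply: qrI; [exact: pq_hol|move=> z; exact: Pfun_pq]. Qed.
Lemma DkE k f z d : cd f z d -> Dk k f z = tpi^-1 * d + rC k * Defs.Pfun z * f z.
Proof. by move=> h; rewrite /Dk (cderiv_eq h). Qed.

Definition Delta (z : C) : C := ee z * hfun (ee z) ^+ 24.
Definition Dq (q : C) : C := q * hfun q ^+ 24.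
Lemma Dq_hol : dhol Dq.
Proof. by apply: dholM; [exact: dhol_id|apply: dholX; exact: hfun_hol]. Qed.
Lemma Delta_qr : qr Dq Delta.
Proof. by apply: qrI; [exact: Dq_hol|]. Qed.
Lemma Delta_neq0 z : Hp z -> Delta z != 0.
Proof. by move=> hz; rewrite mulf_neq0 ?ee_neq0 // expf_neq0 // hfun_neq0 // cabs_ee_lt1. Qed.
Lemma Delta_cd z : Hp z -> cd Delta z (- 12%:R * tpi * Defs.Pfun z * Delta z).
Proof.
move=> hz; have q1 : cabs (ee z) < 1 by rewrite cabs_ee_lt1.
have h0 := hfun_neq0 q1.
apply: cd_eq.
  apply: cdM; first exact: cd_ee.
  by apply: cdX; apply: cd_comp (dderP hfun_hol q1); exact: cd_ee.
rewrite Pfun_pq // /Delta /pq /=; set H := hfun (ee z) in h0 *; rewrite (exprS H 23).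
by field.
Qed.

Lemma cd_jacX g z n : cd (fun z => jac g z ^+ n) z (n%:R * jac g z ^+ n.-1 * gc g).
Proof. by apply: cdX; exact: cd_jac. Qed.
Lemma cd_jacz g z (k : int) : SL2 g -> Hp z ->
  cd (fun z => jac g z ^ k) z (rC k%:~R * gc g / jac g z * jac g z ^ k).
Proof.
move=> hg hz; have := cd_cpow_jac k%:~R hg hz; rewrite cpow_int ?jac_neq0 //.
by apply: cd_nearH => // w hw; rewrite cpow_int // jac_neq0.
Qed.

Section Quasi.
Hypothesis Pq : quasi_P.

(** Differentiating the automorphy factor [a] produces the term k c / (cz + d), which the error term
    of P cancels. The factor and [F] are left general, to serve scalar and vector-valued forms
    alike. *)
Lemma Dk_slash g z k f a F d' F' : SL2 g -> Hp z ->
  cd a z (rC k * gc g / jac g z * a z) -> cd F z F' -> cd f (mob g z) d' ->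
  (forall w, Hp w -> f (mob g w) = a w * F w) ->
  Dk k f (mob g z) = jac g z ^+ 2 * a z * (tpi^-1 * F' + rC k * Defs.Pfun z * F z).
Proof.
move=> hg hz ca cF cf e; have j0 := jac_neq0 hg hz.
have c1 := cd_comp (cd_mob hg hz) cf.
have c2 : cd (fun w => f (mob g w)) z (rC k * gc g / jac g z * a z * F z + a z * F').
  by apply: (@cd_nearH (fun w => a w * F w)) => //; [move=> w hw; rewrite e|exact: cdM].
have := cd_uniq c1 c2 => h.
have -> : Dk k f (mob g z) = tpi^-1 * d' + rC k * Defs.Pfun (mob g z) * f (mob g z) by exact: DkE.
have -> : d' = jac g z ^+ 2 * (d' * (jac g z) ^- 2) by field.
rewrite h Pq // e //; field.
by rewrite j0 tpi_neq0.
Qed.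

Lemma MF_Dk k f : MF k f -> MF (k + 2) (Dk k%:~R f).
Proof.
move=> /MFP[[phi h] fa]; apply/MFP; split; first by eexists; exact: qrep_Dk h.
move=> g hg z hz; have fh := qrep_holH h; have [d hd] := fh z hz.
have [d' hd'] := fh _ (Hp_mob hg hz).
rewrite (Dk_slash hg hz (cd_jacz k hg hz) hd hd' (fun w hw => fa g hg w hw)).
by rewrite (DkE _ hd) expfzDr ?jac_neq0 // [_ * jac g z ^ k]mulrC.
Qed.

(** By quasimodularity the quotient [u] has derivative 0, so it is a constant depending
    multiplicatively on g. It is 1 on translations, and on [Sm] by evaluation at the fixed point i,
    since i^12 = 1. *)
Lemma Delta_MF : MF 12 Delta.
Proof.
apply/MFP; split; first by exists Dq; exact: Delta_qr.
pose u g z := Delta (mob g z) / (jac g z ^+ 12 * Delta z).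
have uc g : SL2 g -> forall z w, Hp z -> Hp w -> u g z = u g w.
  move=> hg; apply: const_H => z hz; have j0 := jac_neq0 hg hz; have D0 := Delta_neq0 hz.
  apply: cd_eq.
    apply: cdM; first by apply: cd_comp (cd_mob hg hz) (Delta_cd (Hp_mob hg hz)).
    apply: cdV; first by rewrite mulf_neq0 // expf_neq0.
    by apply: cdM; [exact: cd_jacX|exact: Delta_cd].
  rewrite Pq //=; field.
  by rewrite D0 j0 tpi_neq0.
have key g : SL2 g -> forall z, Hp z -> u g z = 1.
  move: g; apply: (@sl2_ind (fun g => forall z, Hp z -> u g z = 1)).
  - move=> n z hz; rewrite /u jac_Tn mob_Tn expr1n mul1r /Delta eeD ee_int mulr1 mulfV //.
    exact: Delta_neq0.
  - move=> z hz; have hi : Hp iC by rewrite /Hp ImC_iC.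
    rewrite (uc Sm SL2_Sm z iC) // /u jac_Sm mob_Sm.
    have -> : - iC^-1 = iC by apply: (mulfI iC_neq0); rewrite mulrN mulfV ?iC_neq0 // iC2.
    have -> : iC ^+ 12 = 1 by rewrite (exprM iC 2 6) expr2 iC2 -signr_odd.
    by rewrite mul1r mulfV // Delta_neq0.
  - move=> g h hg hh ug uh z hz; have hz' := Hp_mob hh hz.
    have := ug _ hz'; have := uh z hz; rewrite /u mobM // jacM //.
    have j0 := jac_neq0 hh hz; have j1 := jac_neq0 hg hz'.
    have D0 := Delta_neq0 hz; have D1 := Delta_neq0 hz'.
    move=> e1 e2; rewrite -[RHS]mulr1 -{1}e2 -e1; field.
    by rewrite D0 D1 j0 j1.
move=> g hg z hz; have := key g hg z hz; rewrite /u => /(congr1 (fun x => x * (jac g z ^+ 12 * Delta z))).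
by rewrite divfK ?mul1r // mulf_neq0 ?Delta_neq0 // expf_neq0 // jac_neq0.
Qed.

Lemma MF_divDelta k f phi : MF k f -> qr phi f -> phi 0 = 0 ->
  exists2 g, MF (k - 12) g & forall z, Hp z -> f z = Delta z * g z.
Proof.
move=> hf h p0; have [psi hpsi e] := dhol_div0 h.1 p0.
have [_ fa] := (MFP k f).1 hf; have [_ Da] := (MFP _ _).1 Delta_MF.
exists (fun z => f z / Delta z); last by move=> z hz; rewrite mulrC divfK // Delta_neq0.
apply/MFP; split.
  exists (fun q => psi q * (hfun q ^+ 24)^-1); apply: qrI.
    apply: dholM => //; apply: dholV; first by apply: dholX; exact: hfun_hol.
    by move=> q hq; rewrite expf_neq0 // hfun_neq0.
  move=> z hz; rewrite (qrE h hz) e ?cabs_ee_lt1 // /Delta.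
  by field; rewrite ee_neq0 hfun_neq0 // cabs_ee_lt1.
move=> g hg z hz; rewrite fa // Da //; have j0 := jac_neq0 hg hz.
have D0 := Delta_neq0 hz.
rewrite (@expfzDr _ (jac g z) k (- 12) j0) [jac g z ^ (- _)](_ : _ = (jac g z ^+ 12)^-1); last exact: esym (exprnN _ 12).
rewrite [jac g z ^ 12](_ : _ = jac g z ^+ 12) //; field.
by rewrite D0 j0.
Qed.
Lemma MF_cusp k f phi : k < 12 -> MF k f -> qr phi f -> phi 0 = 0 -> forall z, Hp z -> f z = 0.
Proof.
move=> k12 hf h p0 z hz; have [g hg ->] := MF_divDelta hf h p0; last by [].
by rewrite (@MF_neg (k - 12) g) ?mulr0 // subr_lt0.
Qed.
Lemma MF0_cst f : MF 0 f -> exists c, forall z, Hp z -> f z = c.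
Proof.
move=> hf; have [[phi h] _] := (MFP _ _).1 hf.
exists (phi 0) => z hz; apply/eqP; rewrite -subr_eq0; apply/eqP.
apply: (@MF_cusp 0 (fun z => f z - phi 0) (fun q => phi q + -1 * phi 0)) => //.
- by apply: MFB => //; exact: MF_cst.
- apply: qrI; first by apply: dholD => //; [exact: h.1|exact: dhol_cst].
  by move=> w hw; rewrite (qrE h hw) mulN1r.
- by rewrite mulN1r subrr.
Qed.

(* Ramanujan's differential equations for P = - E_2 / 12, read as definitions. *)
Definition E4 (z : C) : C := 144%:R * Dk 1 Defs.Pfun z.
Definition e4 (q : C) : C := 144%:R * qD 0 1 pq q.
Definition E6 (z : C) : C := - 3%:R * Dk 4 E4 z.
Definition e6 (q : C) : C := - 3%:R * qD 0 4 e4 q.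
Lemma E4_qr : qr e4 E4. Proof. by apply: qrepZ; apply: qrep_Dk; exact: qr_P. Qed.
Lemma E6_qr : qr e6 E6. Proof. by apply: qrepZ; apply: qrep_Dk; exact: E4_qr. Qed.
Lemma E4_MF : MF 4 E4.
Proof.
apply/MFP; split; first by exists e4; exact: E4_qr.
move=> g hg z hz; have [P' hP] := qrep_holH qr_P hz; have [P2 hP2] := qrep_holH qr_P (Hp_mob hg hz).
have j0 := jac_neq0 hg hz.
have c1 := cd_comp (cd_mob hg hz) hP2.
have c2 : cd (fun w => Defs.Pfun (mob g w)) z (2%:R * jac g z * gc g * Defs.Pfun z + jac g z ^+ 2 * P' - gc g ^+ 2 / tpi).
  apply: (@cd_nearH (fun w => jac g w ^+ 2 * Defs.Pfun w - gc g / tpi * jac g w)) => //.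
    by move=> w hw; rewrite Pq //; congr (_ - _); rewrite mulrAC.
  apply: cd_eq; first by apply: cdB; [apply: cdM hP; exact: cd_jacX|apply: cdZ; exact: cd_jac].
  by rewrite /=; ring.
have h := cd_uniq c1 c2; rewrite /E4 (DkE _ hP2) (DkE _ hP) Pq //.
have -> : P2 = jac g z ^+ 2 * (P2 * (jac g z) ^- 2) by field.
rewrite h rC1 [jac g z ^ 4](_ : _ = jac g z ^+ 4) //; field.
exact: tpi_neq0.
Qed.
Lemma E6_MF : MF 6 E6. Proof. by apply: MFZ; apply: (@MF_Dk 4); exact: E4_MF. Qed.
Lemma qD0 l k phi : qD l k phi 0 = (rC l + rC k * pq 0) * phi 0.
Proof. by rewrite /qD mul0r addr0. Qed.
Lemma qD_cd0 k phi : dhol phi ->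
  cd (qD 0 k phi) 0 (rC k * 2%:R * phi 0 + rC k * pq 0 * dder phi 0 + dder phi 0).
Proof.
move=> h; apply: cd_eq.
  apply: cdD; last by apply: cdM; [exact: cd_id|exact: dderP (dhol_der h) cabs01].
  apply: cdM; last exact: dderP h cabs01.
  by apply: cdD; [exact: cd_cst|apply: cdZ; exact: dderP pq_hol cabs01].
rewrite dder_pq0 rC0 /qD; cbv beta.
move: (pq 0) (phi 0) (dder phi 0) (rC k) => a b c d; ring.
Qed.
Lemma e4_0 : e4 0 = 1.
Proof. by rewrite /e4 qD0 pq0 rC0 rC1; field. Qed.
Lemma e4_cd0 : cd e4 0 240%:R.
Proof.
apply: cd_eq (cdZ _ (qD_cd0 1 pq_hol)) _; rewrite pq0 dder_pq0 rC1; by field.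
Qed.
Lemma rC4 : rC 4 = 4%:R. Proof. exact: rC_nat. Qed.
Lemma e6_0 : e6 0 = 1.
Proof. by rewrite /e6 qD0 pq0 e4_0 rC0 rC4; field. Qed.
Lemma e6_cd0 : cd e6 0 (- 504%:R).
Proof.
apply: cd_eq (cdZ _ (qD_cd0 4 E4_qr.1)) _; rewrite pq0 e4_0 (dder_eq e4_cd0) rC4; by field.
Qed.

(** A form of weight 12 vanishing at the cusp is a constant multiple of Delta; its q-coefficient is
    3 * 240 + 2 * 504 = 1728. *)
Lemma E4E6_Delta z : Hp z -> E4 z ^+ 3 - E6 z ^+ 2 = 1728%:R * Delta z.
Proof.
move=> hz; pose f z := E4 z * (E4 z * E4 z) - E6 z * E6 z.
pose phi q := e4 q * (e4 q * e4 q) + -1 * (e6 q * e6 q).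
have hf : MF 12 f.
  apply: MFB; last by apply: (@MFM 6 6); exact: E6_MF.
  by apply: (@MFM 4 8); [exact: E4_MF|apply: (@MFM 4 4); exact: E4_MF].
have h : qr phi f.
  apply: qrepD; first by apply: qrM; [exact: E4_qr|apply: qrM; exact: E4_qr].
  apply: (@qrep_ext _ _ (fun z => -1 * (E6 z * E6 z))); first by move=> w _; rewrite mulN1r.
  by apply: qrepZ; apply: qrM; exact: E6_qr.
have p0 : phi 0 = 0 by rewrite /phi e4_0 e6_0; ring.
have dphi : cd phi 0 1728%:R.
  apply: cd_eq.
    apply: cdD; first by apply: cdM; [exact: e4_cd0|apply: cdM; exact: e4_cd0].
    by apply: cdZ; apply: cdM; exact: e6_cd0.
  by rewrite /= e4_0 e6_0; ring.
have [g hg e] := MF_divDelta hf h p0.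
have [c hc] := MF0_cst hg.
have ec : c = 1728%:R.
  have [psi hpsi e2] := dhol_div0 h.1 p0.
  have c1 : cd phi 0 (psi 0).
    apply: (@cd_near (fun q => q * psi q) _ _ _ 1) => //.
      by move=> w; rewrite subr0 => /e2.
    by apply: cd_eq (cdM (cd_id 0) (dderP hpsi cabs01)) _; ring.
  rewrite -(cd_uniq c1 dphi).
  have cD : dhol (fun q => c * hfun q ^+ 24) by apply: dholZ; apply: dholX; exact: hfun_hol.
  suff <- : c * hfun 0 ^+ 24 = psi 0 by rewrite hfun0 expr1n mulr1.
  apply: (@ccont_eq_pt (fun q => c * hfun q ^+ 24) psi 0 1) => //.
  - exact: dhol_cont cD cabs01.
  - exact: dhol_cont hpsi cabs01.
  move=> q q0; rewrite subr0 => q1; have [w ew] := ee_surj q0.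
  have hw : Hp w by rewrite /Hp -cabs_ee_lt1 ew.
  have := e w hw; rewrite (qrE h hw) e2 ?ew // hc // /Delta ew => e3.
  by apply: (mulfI q0); rewrite e3; ring.
have := e z hz; rewrite /f hc // ec => e3.
by rewrite [RHS]mulrC -e3; ring.
Qed.

(** By [MF_cusp], below weight 12 a form is determined by its value at the cusp. *)
Lemma MF_gen k f E phiE : 0 <= k < 12 -> MF k E -> qr phiE E -> phiE 0 = 1 -> MF k f ->
  exists c, forall z, Hp z -> f z = c * E z.
Proof.
move=> /andP[_ k12] hE h1 hp hf; have [[phi h] _] := (MFP _ _).1 hf.
exists (phi 0) => z hz; apply/eqP; rewrite -subr_eq0; apply/eqP.
apply: (@MF_cusp k (fun z => f z - phi 0 * E z) (fun q => phi q + - phi 0 * phiE q)) => //.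
- by apply: MFB => //; exact: MFZ.
- apply: (@qrep_ext _ _ (fun z => f z + - phi 0 * E z)); first by move=> w _; rewrite mulNr.
  by apply: qrepD => //; exact: qrepZ.
- by rewrite hp; ring.
Qed.

(** From f^2 = a E4 and f^3 = b E6 come a^3 = b^2, at the cusp, and a^3 E4^3 = b^2 E6^2. Thus a^3
    Delta = 0 and a = 0. *)
Lemma MF2_zero f : MF 2 f -> forall z, Hp z -> f z = 0.
Proof.
move=> hf z hz.
have [a ha] : exists c, forall z, Hp z -> f z * f z = c * E4 z.
  by apply: (@MF_gen 4 _ _ e4) => //; [exact: E4_MF|exact: E4_qr|exact: e4_0|exact: (@MFM 2 2)].
have [b hb] : exists c, forall z, Hp z -> f z * (f z * f z) = c * E6 z.
  apply: (@MF_gen 6 _ _ e6) => //; [exact: E6_MF|exact: E6_qr|exact: e6_0|].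
  by apply: (@MFM 2 4) => //; exact: (@MFM 2 2).
have [[phi h] _] := (MFP _ _).1 hf.
have pa : phi 0 * phi 0 = a.
  have := @qrep_uniq 0 _ (fun q => a * e4 q) _ (qrM h h); rewrite e4_0 mulr1; apply.
  by apply: (@qrep_ext _ _ (fun z => a * E4 z)); [move=> w hw; rewrite ha|apply: qrepZ; exact: E4_qr].
have pb : phi 0 * (phi 0 * phi 0) = b.
  have := @qrep_uniq 0 _ (fun q => b * e6 q) _ (qrM h (qrM h h)); rewrite e6_0 mulr1; apply.
  by apply: (@qrep_ext _ _ (fun z => b * E6 z)); [move=> w hw; rewrite hb|apply: qrepZ; exact: E6_qr].
have a0 : a = 0.
  have e1 : a ^+ 3 * E4 z ^+ 3 = b ^+ 2 * E6 z ^+ 2.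
    by rewrite -!exprMn -ha // -hb //; ring.
  have e2 : a ^+ 3 = b ^+ 2 by rewrite -pa -pb; ring.
  have e3 : a ^+ 3 * (1728%:R * Delta z) = 0 by rewrite -E4E6_Delta // mulrBr e1 e2 subrr.
  have n0 : 1728%:R * Delta z != 0.
    by apply: mulf_neq0; [rewrite pnatr_eq0|exact: Delta_neq0].
  by move/eqP: e3; rewrite mulf_eq0 (negbTE n0) orbF expf_eq0 /= => /eqP.
by have /eqP := ha z hz; rewrite a0 mul0r mulf_eq0 orbb => /eqP.
Qed.
End Quasi.

(** An affine change of variable carries a disc in the half-plane to the unit disc, where [dhol_der]
    applies. *)
Lemma holH_der f : holH f -> holH (cderiv f).
Proof.
move=> h z0 hz; pose r := ImC z0; have r0 : 0 < r by [].
have rn : rC r != 0 by rewrite rC_eq0 gt_eqF.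
pose phi q := f (z0 + rC r * q).
have in_H q : cabs q < 1 -> Hp (z0 + rC r * q).
  move=> hq; apply: (@Hp_open z0).
  by rewrite [z0 + _]addrC addrK cabsM cabs_rC (gtr0_norm r0) -/r gtr_pMr.
have aff q : cd (fun q => z0 + rC r * q) q (rC r).
  by apply: cd_eq (cdD (cd_cst z0 q) (cdZ (rC r) (cd_id q))) _; rewrite add0r mulr1.
have ph : dhol phi.
  move=> q hq; have [d hd] := h _ (in_H q hq).
  by eexists; exact: (cd_comp (aff q) hd).
have e w : cabs (w - z0) < r -> cderiv f w = (rC r)^-1 * dder phi ((w - z0) / rC r).
  move=> hw; have q1 : cabs ((w - z0) / rC r) < 1.
    by rewrite cabsM cabsV cabs_rC (gtr0_norm r0) ltr_pdivrMr // mul1r.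
  have ew : z0 + rC r * ((w - z0) / rC r) = w by rewrite mulrC divfK // addrC subrK.
  have [d hd] := h w (Hp_open hw).
  rewrite (cderiv_eq hd); have c := aff ((w - z0) / rC r).
  have hd' := hd; rewrite -ew in hd'; rewrite (dder_eq (cd_comp c hd')).
  by field.
have [d hd] := dhol_der ph (ltac:(rewrite subrr mul0r cabs0; exact: ltr01) : cabs ((z0 - z0) / rC r) < 1).
eexists; apply: (@cd_near (fun w => (rC r)^-1 * dder phi ((w - z0) / rC r)) _ _ _ r) => //.
  by move=> w hw; rewrite e.
apply: cdZ; apply: (@cd_comp (fun w => (w - z0) / rC r)); last exact: hd.
apply: cdM (cd_cst _ _); apply: cdB (cd_id _) (cd_cst _ _).
Qed.
Lemma holH_cd f z : holH f -> Hp z -> cd f z (cderiv f z).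
Proof. by move=> h /h[d hd]; rewrite (cderiv_eq hd). Qed.
Lemma holHD f g : holH f -> holH g -> holH (fun z => f z + g z).
Proof. by move=> hf hg z hz; eexists; exact: cdD (holH_cd hf hz) (holH_cd hg hz). Qed.
Lemma holHM f g : holH f -> holH g -> holH (fun z => f z * g z).
Proof. by move=> hf hg z hz; eexists; exact: cdM (holH_cd hf hz) (holH_cd hg hz). Qed.
Lemma holH_cst c : holH (fun=> c). Proof. by move=> z _; exists 0; exact: cd_cst. Qed.

(** * Derivatives of determinants *)

Lemma cd_prod (I : eqType) (s : seq I) (F : I -> C -> C) (d : I -> C) z : uniq s ->
  (forall i, cd (F i) z (d i)) ->
  cd (fun w => \prod_(i <- s) F i w) z
     (\sum_(i <- s) \prod_(k <- s) (if k == i then d k else F k z)).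
Proof.
move=> us h; elim: s us => [_|i s IH /= /andP[ni us]].
  by rewrite big_nil; apply: (cd_ext (f := fun=> 1)) => [w|]; [rewrite big_nil|exact: cd_cst].
apply: (cd_ext (f := fun w => F i w * \prod_(k <- s) F k w)) => [w|]; first by rewrite big_cons.
apply: cd_eq (cdM (h i) (IH us)) _; rewrite big_cons big_cons eqxx; congr (_ + _).
  congr (_ * _); apply: eq_big_seq => k ks; case: eqP => // e; move: ni; by rewrite -e ks.
rewrite mulr_sumr; apply: eq_big_seq => k ks; rewrite big_cons; congr (_ * _).
by case: eqP => // e; move: ni; rewrite e ks.
Qed.

Definition rowrep n (A : 'M[C]_n) (a : 'I_n) (r : 'I_n -> C) : 'M[C]_n :=
  \matrix_(i, j) (if i == a then r j else A i j).

Lemma cd_det n (A : C -> 'M[C]_n) (d : 'I_n -> 'I_n -> C) z :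
  (forall i j, cd (fun w => A w i j) z (d i j)) ->
  cd (fun w => \det (A w)) z (\sum_a \det (rowrep (A z) a (d a))).
Proof.
move=> h; apply: cd_eq.
  apply: cd_sum => s _; apply: cdZ; apply: cd_prod (index_enum_uniq _) _ => i; exact: h.
rewrite exchange_big /=; apply: eq_bigr => s _; rewrite mulr_sumr; apply: eq_bigr => a _.
congr (_ * _); apply: eq_bigr => k _; rewrite mxE.
by case: eqP => // ->.
Qed.

Lemma rowrep_lin n (A : 'M[C]_n) a x y (r s : 'I_n -> C) :
  \det (rowrep A a (fun j => x * r j + y * s j)) =
  x * \det (rowrep A a r) + y * \det (rowrep A a s).
Proof.
apply: (determinant_multilinear (i0 := a)).
- by apply/rowP => j; rewrite !mxE eqxx.
- by apply/matrixP => k j; rewrite !mxE eq_sym (negbTE (neq_lift _ _)).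
- by apply/matrixP => k j; rewrite !mxE eq_sym (negbTE (neq_lift _ _)).
Qed.
Lemma rowrep_same n (A : 'M[C]_n) a : \det (rowrep A a (A a)) = \det A.
Proof. by congr (\det _); apply/matrixP => k j; rewrite mxE; case: eqP => // ->. Qed.
Lemma rowrep_dup n (A : 'M[C]_n) a b : b != a -> \det (rowrep A a (A b)) = 0.
Proof.
move=> ba; apply: (@determinant_alternate _ _ _ a b); first by rewrite eq_sym.
by move=> j; rewrite !mxE eqxx (negbTE ba).
Qed.

(** * Iterated derivatives at the cusp and convergence of the series of F1 *)

Fixpoint qDn (l k : R) (n : nat) (phi : C -> C) : C -> C :=
  if n is n'.+1 then qD l (k + 2 * n'%:R) (qDn l k n' phi) else phi.
Lemma qrep_Dkn l k n phi f : qrep l phi f -> qrep l (qDn l k n phi) (Dkn k n f).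
Proof. by move=> h; elim: n => //= n IH; exact: qrep_Dk. Qed.
Lemma qDn0 l k n phi : qDn l k n phi 0 =
  (\prod_(t < n) (rC l + rC (k + 2 * t%:R) * pq 0)) * phi 0.
Proof.
elim: n => [|n IH] /=; first by rewrite big_ord0 mul1r.
by rewrite qD0 IH big_ord_recr /= mulrA [_ * \prod_(_ < _) _]mulrC.
Qed.

Lemma ee_pow n z : ee z ^+ n = ee (n%:R * z). Proof. by rewrite ee_nat. Qed.
Lemma F1_term_bound (c : nat -> C) :
  (forall z, Hp z -> exists s : C, (fun N : nat => (\sum_(1 <= n < N) c n * ee (n%:R * z) : C^o)) @ \oo --> (s : C^o)) ->
  forall r, 0 < r < 1 -> exists2 B, 0 <= B & forall N, (0 < N)%N -> cabs (c N) * r ^+ N <= B.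
Proof.
move=> h r /andP[r0 r1].
have rn : rC r != 0 by rewrite rC_eq0 gt_eqF.
have [z ez] := ee_surj rn; have cz : cabs (ee z) = r by rewrite ez cabs_rC gtr0_norm.
have hz : Hp z by rewrite /Hp -cabs_ee_lt1 cz.
have [s /clim hs] := h z hz; have [N0 hN0] := hs 1 ltr01.
have tb N : (0 < N)%N -> (N0 <= N)%N -> cabs (c N) * r ^+ N <= 2.
  move=> Np hN; rewrite -cz -cabsX -cabsM ee_pow.
  have -> : c N * ee (N%:R * z) = (\sum_(1 <= n < N.+1) c n * ee (n%:R * z) - s)
     - (\sum_(1 <= n < N) c n * ee (n%:R * z) - s).
    by rewrite big_nat_recr //=; ring.
  have := hN0 N hN; have := hN0 N.+1 (leqW hN).
  have := cabsD (\sum_(1 <= n < N.+1) c n * ee (n%:R * z) - s) (- (\sum_(1 <= n < N) c n * ee (n%:R * z) - s)).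
  rewrite cabsN; lra.
have t0 N : 0 <= cabs (c N) * r ^+ N by rewrite mulr_ge0 ?cabs_ge0 // exprn_ge0 // ltW.
exists (2 + \sum_(N < N0) cabs (c N) * r ^+ N); first by rewrite addr_ge0 // sumr_ge0.
move=> N Np; have [hN|hN] := leqP N0 N.
  by apply: (le_trans (tb N Np hN)); rewrite lerDl sumr_ge0.
rewrite (bigD1 (Ordinal hN)) //=.
have : 0 <= \sum_(j < N0 | j != Ordinal hN) cabs (c j) * r ^+ j by apply: sumr_ge0.
lra.
Qed.

(** Convergence at each z bounds the terms, as in Abel's lemma, so the series converges
    geometrically on smaller discs. The sum starts at n = 1, hence psi 0 = 0. *)
Lemma F1_series (c : nat -> C) :
  (forall z, Hp z -> exists s : C, (fun N : nat => (\sum_(1 <= n < N) c n * ee (n%:R * z) : C^o)) @ \oo --> (s : C^o)) ->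
  exists psi, [/\ dhol psi, psi 0 = 0 & forall z s, Hp z ->
    (fun N : nat => (\sum_(1 <= n < N) c n * ee (n%:R * z) : C^o)) @ \oo --> (s : C^o) -> s = psi (ee z)].
Proof.
move=> h; pose F N q := \sum_(1 <= n < N) c n * q ^+ n.
have [||psi hpsi lim] := @dhol_lim F.
- by move=> N; apply: dhol_sum => n; apply: dholZ; apply: dholX; exact: dhol_id.
- move=> r /andP[r0 r1]; pose r' := (1 + r) / 2.
  have r'0 : 0 < r' by rewrite /r'; lra.
  have r'1 : r' < 1 by rewrite /r'; lra.
  have [B B0 hB] := F1_term_bound h (ltac:(by rewrite r'0 r'1) : 0 < r' < 1).
  exists B, (r / r'); split => //.
    by rewrite divr_ge0 ?(ltW r'0) //= ltr_pdivrMr // mul1r /r'; lra.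
  have rr : 0 <= r / r' by rewrite divr_ge0 // ltW.
  move=> [|N] q hq; rewrite /F.
    by rewrite !big_geq // subrr cabs0 expr0 mulr1.
  rewrite big_nat_recr //= [_ + c _ * _]addrC addrK cabsM cabsX.
  rewrite expr_div_n mulrA ler_pdivlMr ?exprn_gt0 // mulrAC.
  by apply: ler_pM; rewrite ?mulr_ge0 ?exprn_ge0 ?cabs_ge0 ?(ltW r'0) ?hB // lerXn2r // nnegrE cabs_ge0.
exists psi; split => //.
  apply: eps_eq0 => e e0; have [N /(_ N (leqnn N))] := lim 0 cabs01 e e0.
  rewrite (_ : F N 0 = 0) ?sub0r ?cabsN //.
  by rewrite /F big_nat_cond big1 // => n /andP[/andP[n1 _] _]; rewrite expr0n gtn_eqF // mulr0.
move=> z s hz /clim hs; apply/eqP; rewrite -subr_eq0; apply/eqP/eps_eq0 => e e0.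
have [N1 h1] := hs (e / 2) ltac:(lra).
have [N2 h2] := lim (ee z) (ltac:(by rewrite cabs_ee_lt1)) (e / 2) ltac:(lra).
have {}h1 := h1 (N1 + N2)%N (leq_addr _ _); have {}h2 := h2 (N1 + N2)%N (leq_addl _ _).
move: h1; have -> : \sum_(1 <= n < N1 + N2) c n * ee (n%:R * z) = F (N1 + N2)%N (ee z).
  by apply: eq_bigr => n _; rewrite ee_pow.
move=> h1; have -> : s - psi (ee z) = - (F (N1 + N2)%N (ee z) - s) + (F (N1 + N2)%N (ee z) - psi (ee z)) by ring.
have := cabsD (- (F (N1 + N2)%N (ee z) - s)) (F (N1 + N2)%N (ee z) - psi (ee z)); rewrite cabsN; lra.
Qed.

(** * Exponents and Wronskians *)
(* The leading coefficient at the cusp of D^a applied to q^x f is f(0) times this polynomial in x,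
   where al t = (k + 2 t) P(i oo). *)
Definition nwt (al : nat -> C) (a : nat) : {poly C} := \prod_(t < a) ('X + (al t)%:P).
Lemma nwt_monic al a : nwt al a \is monic.
Proof. by apply: monic_prod => t _; rewrite -[al t]opprK polyCN monicXsubC. Qed.
Lemma nwt_size al a : size (nwt al a) = a.+1.
Proof.
rewrite /nwt (eq_bigr (fun t : 'I_a => 'X - (- al t)%:P)); last by move=> t _; rewrite polyCN opprK.
by rewrite size_prod_XsubC /index_enum -enumT size_enum_ord.
Qed.
Lemma nwt_eval al a x : (nwt al a).[x] = \prod_(t < a) (x + al t).
Proof. by rewrite horner_prod; apply: eq_bigr => t _; rewrite hornerD hornerX hornerC. Qed.
Lemma nwt_free al n (v : nat -> C) : \sum_(a < n) v a *: nwt al a = 0 ->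
  forall a, (a < n)%N -> v a = 0.
Proof.
elim: n => // n IH; rewrite big_ord_recr /= => h.
have vn : v n = 0.
  have := congr1 (fun p : {poly C} => p`_n) h; rewrite coefD coefZ coef0 coef_sum big1.
    have := nwt_monic al n; rewrite monicE lead_coefE nwt_size /= => /eqP ->.
    by rewrite add0r mulr1.
  by move=> a _; rewrite coefZ nth_default ?mulr0 // nwt_size.
rewrite vn scale0r addr0 in h.
by move=> a; rewrite ltnS leq_eqVlt => /orP[/eqP -> //|]; exact: IH.
Qed.
Lemma nwt_comb_size al n (v : nat -> C) : (size (\sum_(a < n) v a *: nwt al a)%R <= n)%N.
Proof.
apply: (leq_trans (size_sum _ _ _)); apply/bigmax_leqP => a _; apply: leq_trans (size_scale_leq _ _) _.
by rewrite nwt_size.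
Qed.
(** The combination has degree below n, so n distinct roots make it zero, and the [nwt al a] are
    independent. *)
Lemma nwt_roots al n (v : nat -> C) (s : seq C) : uniq s -> (n <= size s)%N ->
  (forall x, x \in s -> \sum_(a < n) v a * (nwt al a).[x] = 0) ->
  forall a, (a < n)%N -> v a = 0.
Proof.
move=> us ns h; apply: (@nwt_free al); apply: (@roots_geq_poly_eq0 _ _ s) => //.
  apply/allP => x xs; rewrite rootE horner_sum; apply/eqP.
  by under eq_bigr do rewrite hornerZ; exact: h.
exact: leq_trans (nwt_comb_size _ _ _) ns.
Qed.
(** A Vandermonde determinant, in a basis of monic polynomials of degrees 0 to n - 1. *)
Lemma det_nwt n al (x : 'I_n -> C) : injective x ->
  \det (\matrix_(j < n, a < n) (nwt al a).[x j]) != 0.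
Proof.
move=> xi; rewrite -det_tr; apply/det0P => -[u u0 hu].
case/eqP: u0; apply/rowP => a; rewrite mxE.
pose w k := if insub k is Some a then u 0 a else 0.
have wE (a' : 'I_n) : w a' = u 0 a' by rewrite /w insubT ?ltn_ord //= => h; congr (u _ _); exact: val_inj.
rewrite -wE; apply: (@nwt_roots al n w [seq x j | j : 'I_n]) => //.
- by rewrite map_inj_uniq // enum_uniq.
- by rewrite size_map size_enum_ord.
move=> _ /mapP[j _ ->]; have e := congr1 (fun M : 'rV_n => M 0 j) hu.
rewrite [in RHS]mxE in e; rewrite -[RHS]e mxE.
by apply: eq_bigr => k _; rewrite !mxE wE.
Qed.
Lemma det_scale_rows n (d : 'I_n -> C) (A : 'M[C]_n) :
  \det (\matrix_(i, j) (A i j * d i)) = \prod_i d i * \det A.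
Proof.
have -> : \matrix_(i, j) (A i j * d i) = diag_mx (\row_i d i) *m A.
  by apply/matrixP => i j; rewrite mul_diag_mx !mxE mulrC.
by rewrite det_mulmx det_diag; congr (_ * _); apply: eq_bigr => i _; rewrite mxE.
Qed.

Lemma ee_sum (I : finType) (l : I -> R) z :
  ee (rC (\sum_j l j) * z) = \prod_j ee (rC (l j) * z).
Proof.
rewrite (big_morph rC rCD rC0) mulr_suml.
by apply: (big_morph ee eeD ee0).
Qed.
Lemma det_qrep n (l : 'I_n -> R) (A Phi : 'M[C]_n) z :
  (forall a j, A a j = ee (rC (l j) * z) * Phi a j) ->
  \det A = ee (rC (\sum_j l j) * z) * \det Phi.
Proof.
move=> h; rewrite ee_sum -(det_tr Phi) -det_scale_rows -det_tr; congr (\det _).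
by apply/matrixP => a j; rewrite !mxE h mulrC.
Qed.

(** * Quasimodularity of P *)
Section MLDE.
Variables (v : 'M[int]_2 -> C) (lam : 'I_4 -> R) (i : 'I_4) (M4 M6 M8 : C -> C)
  (F1 : C -> 'cV[C]_4) (b : 'I_4 -> nat -> C) (rho1 : 'M[int]_2 -> 'M[C]_4) (kap : R).
Let ex j := lam j + (if j == i then 1 else 0).
Hypotheses (lam01 : forall j, 0 <= lam j < 1) (lam_inj : injective lam).
Hypothesis kapE : kap = 3 * \sum_j lam j.
Hypotheses (hM4 : MF 4 M4) (hM6 : MF 6 M6) (hM8 : MF 8 M8).
Hypothesis hode : forall j z, Hp z -> mlde4 kap M4 M6 M8 (compo F1 j) z = 0.
Hypothesis hF1 : forall j z, Hp z -> exists s : C,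
     ((fun N : nat => (\sum_(1 <= n < N) b j n * ee (n%:R * z) : C^o)) @ \oo --> (s : C^o))
     /\ F1 z j 0 = ee (rC (ex j) * z) * (1 + s).
Hypothesis hrep : is_rep rho1.
Hypothesis hslash : forall g, SL2 g -> forall z, Hp z -> slash kap v g F1 z = rho1 g *m F1 z.
Hypothesis hv : forall g, SL2 g -> v g != 0.

Lemma F1_qrep_ex j : exists phi, phi 0 = 1 /\ qrep (ex j) phi (compo F1 j).
Proof.
have [z hz|psi [h p0 hs]] := @F1_series (b j).
  by have [s [h _]] := hF1 j hz; exists s.
exists (fun q => 1 + psi q); split; first by rewrite p0 addr0.
split; first by apply: dholD => //; exact: dhol_cst.
by move=> z hz; have [s [hl e]] := hF1 j hz; rewrite /compo e (hs z s hz hl).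
Qed.
Definition phiF j := sval (cid (F1_qrep_ex j)).
Lemma phiF0 j : phiF j 0 = 1. Proof. by rewrite /phiF; case: cid => f []. Qed.
Lemma phiFq j : qrep (ex j) (phiF j) (compo F1 j).
Proof. by rewrite /phiF; case: cid => f []. Qed.
(** Keeps the factor 4 kap + 12 in [P_defect_zero] away from 0. *)
Lemma kap_ge0 : 0 <= kap.
Proof. by rewrite kapE mulr_ge0 // sumr_ge0 // => j _; case/andP: (lam01 j). Qed.

Lemma ex_inj : injective ex.
Proof.
move=> j k; rewrite /ex; case/andP: (lam01 j) => a1 a2; case/andP: (lam01 k) => b1 b2.
case: eqP => [ji|_]; case: eqP => [ki|_] h; first by rewrite ji ki.
- by exfalso; lra.
- by exfalso; lra.
by apply: lam_inj; lra.
Qed.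

Definition WM z : 'M[C]_4 := \matrix_(a < 4, j < 4) Dkn kap a (compo F1 j) z.
Definition Wd z : C := \det (WM z).
Definition WQ q : 'M[C]_4 := \matrix_(a < 4, j < 4) qDn (ex j) kap a (phiF j) q.
Definition wq q : C := \det (WQ q).
Lemma FD_qrep a j : qrep (ex j) (qDn (ex j) kap a (phiF j)) (Dkn kap a (compo F1 j)).
Proof. by apply: qrep_Dkn; exact: phiFq. Qed.
Lemma FD_hol a j : holH (Dkn kap a (compo F1 j)). Proof. exact: qrep_holH (FD_qrep a j). Qed.
Lemma wq_hol : dhol wq.
Proof.
apply: dhol_det => a j; apply: dhol_ext (FD_qrep a j).1 => q; by rewrite mxE.
Qed.
Lemma Wd_qrep : qrep (\sum_j ex j) wq Wd.
Proof.
split; first exact: wq_hol.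
move=> z hz; apply: det_qrep => a j; rewrite !mxE.
by have [_ ->] := FD_qrep a j.
Qed.
(** As every [phiF j] starts with 1, the leading coefficient is a Vandermonde determinant in the
    distinct exponents. *)
Lemma wq0 : wq 0 != 0.
Proof.
rewrite /wq -det_tr.
pose al t := rC (kap + 2 * t%:R) * pq 0.
have -> : (WQ 0)^T = \matrix_(j < 4, a < 4) (nwt al a).[rC (ex j)].
  by apply/matrixP => j a; rewrite !mxE qDn0 phiF0 mulr1 nwt_eval.
by apply: det_nwt => j k /rC_inj /ex_inj.
Qed.
Lemma FD_cd a j z : Hp z -> cd (Dkn kap a (compo F1 j)) z
  (tpi * (Dkn kap a.+1 (compo F1 j) z - rC (kap + 2 * a%:R) * Defs.Pfun z * Dkn kap a (compo F1 j) z)).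
Proof.
move=> hz; apply: cd_eq (holH_cd (@FD_hol a j) hz) _ => /=.
by rewrite (DkE _ (holH_cd (@FD_hol a j) hz)); field; exact: tpi_neq0.
Qed.
Lemma ode j z : Hp z -> Dkn kap 4 (compo F1 j) z =
  - M4 z * Dkn kap 2 (compo F1 j) z + 1 * (- M6 z * Dkn kap 1 (compo F1 j) z + - M8 z * Dkn kap 0 (compo F1 j) z).
Proof.
move=> hz; have := hode j hz; rewrite /mlde4 [Dkn kap 0 _]/=.
move: (Dkn kap 4 _ z) (Dkn kap 2 _ z) (Dkn kap 1 _ z) (compo F1 j z) => x y t s h.
by rewrite -[LHS]subr0 -h; ring.
Qed.
(** Abel's identity. In row a, D^(a+1) repeats the next row, or, in the last row, a combination of
    earlier ones, since the equation has no D^3 term. Only the P-terms of [FD_cd] survive, with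
    total weight 4 kap + 12. *)
Lemma Wd_cd z : Hp z -> cd Wd z (- tpi * rC (4 * kap + 12) * Defs.Pfun z * Wd z).
Proof.
move=> hz.
pose d (a j : 'I_4) := tpi * Dkn kap a.+1 (compo F1 j) z + (- tpi * (rC (kap + 2 * a%:R) * Defs.Pfun z)) * WM z a j.
have hd a j : cd (fun w => WM w a j) z (d a j).
  apply: (cd_ext (f := Dkn kap a (compo F1 j))) => [w|]; first by rewrite mxE.
  by apply: cd_eq (FD_cd a j hz) _; rewrite /d mxE; ring.
apply: cd_eq (cd_det hd) _.
have E (a : 'I_4) : \det (rowrep (WM z) a (d a)) = - tpi * (rC (kap + 2 * a%:R) * Defs.Pfun z) * Wd z.
  rewrite rowrep_lin rowrep_same -[RHS]add0r; congr (_ + _).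
  have dup (r : 'I_4) : r != a -> \det (rowrep (WM z) a (WM z r)) = 0 by exact: rowrep_dup.
  have next (k : 'I_4) : k = a.+1 :> nat -> \det (rowrep (WM z) a (fun j => Dkn kap a.+1 (compo F1 j) z)) = 0.
    move=> ka; rewrite -(dup k); last by rewrite -(inj_eq val_inj) /= ka neq_ltn ltnSn orbT.
    by congr (\det (rowrep _ _ _)); apply: funext => j; rewrite mxE ka.
  have [a3|a3] := ltnP a 3.
    by rewrite (next (Ordinal (a3 : a.+1 < 4)%N)) ?mulr0.
  have ea : a = 3 :> nat by have := ltn_ord a; lia.
  rewrite (_ : (fun j => Dkn kap a.+1 (compo F1 j) z) = (fun j => - M4 z * WM z 2 j +
     1 * (- M6 z * WM z 1 j + - M8 z * WM z 0 j))); last first.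
    by apply: funext => j; rewrite ea ode // !mxE.
  have ne (k : 'I_4) : (k < 3)%N -> k != a by move=> h; apply/eqP => e; move: h; rewrite e ea.
  rewrite rowrep_lin rowrep_lin (dup _ (ne 2 isT)) (dup _ (ne 1 isT)) (dup _ (ne 0 isT)).
  by rewrite !(mulr0, addr0).
rewrite (eq_bigr _ (fun a _ => E a)) !big_ord_recl big_ord0 /=.
rewrite /bump /= !add1n.
have -> : rC (4 * kap + 12) = rC (kap + 2 * 0%:R) + rC (kap + 2 * 1%:R) + rC (kap + 2 * 2%:R) + rC (kap + 2 * 3%:R).
  by rewrite -!rCD; congr rC; ring.
by move: (rC _) (rC _) (rC _) (rC _) => x y t s; ring.
Qed.
Lemma Wd_neq0 z : Hp z -> Wd z != 0.
Proof.
move=> hz; apply/eqP => W0; have /eqP := wq0; apply.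
apply: (qrep_zero Wd_qrep) => w hw.
pose m := Num.min (ImC z) (ImC w); have m0 : 0 < m by rewrite lt_min; apply/andP.
have [B B0 hB] := dhol_bnd pq_hol m0.
pose c := - tpi * rC (4 * kap + 12).
apply: (@gronwall Wd z w (cabs c * B)) => //; first by rewrite mulr_ge0 ?cabs_ge0 // ltW.
move=> t ht; have hs := seg_Hp hz hw ht.
eexists; first exact: Wd_cd hs.
rewrite -/c (cabsM (c * _)) (cabsM c) ler_wpM2r ?cabs_ge0 // ler_wpM2l ?cabs_ge0 // Pfun_pq //.
exact: hB (seg_Im z w ht).
Qed.
Lemma wq_neq0 q : cabs q < 1 -> wq q != 0.
Proof.
move=> q1; have [->|q0] := eqVneq q 0; first exact: wq0.
have [z ez] := ee_surj q0; have hz : Hp z by rewrite /Hp -cabs_ee_lt1 ez.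
have := Wd_neq0 hz; rewrite Wd_qrep.2 // ez mulf_eq0 negb_or => /andP[] //.
Qed.

(* Both P and its transform under g turn the same equation into one satisfied by F1; comparing the
   coefficients of the third derivative shows that they agree. *)
Section QuasiP.
Variables (g : 'M[int]_2) (hg : SL2 g).
(* F1 o g = aw * (rho1 g F1), [gm m] are the components of rho1 g D^m F1, P_defect measures the
   failure of P to be quasimodular under g, and (D^n f)(g z) = (cz + d)^(2n) aw sum_m uc n m gm m. *)
Definition aw (w : C) : C := v g * cpow (jac g w) kap.
Definition gm (m : nat) (j : 'I_4) (w : C) : C := \sum_l rho1 g j l * Dkn kap m (compo F1 l) w.
Definition P_defect (w : C) : C :=
  (jac g w ^+ 2)^-1 * Defs.Pfun (mob g w) + gc g / tpi * (jac g w)^-1 - Defs.Pfun w.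
Fixpoint uc (n m : nat) {struct n} : C -> C :=
  if n is n'.+1 then fun z =>
    (if m is m'.+1 then uc n' m' z else 0)
    + (tpi^-1 * cderiv (uc n' m) z + rC (2 * n'%:R - 2 * m%:R) * Defs.Pfun z * uc n' m z)
    + rC (kap + 2 * n'%:R) * P_defect z * uc n' m z
  else fun=> (m == 0%N)%:R.

Lemma aw_neq0 w : Hp w -> aw w != 0.
Proof. by move=> hw; rewrite mulf_neq0 ?hv // cpow_neq0 // jac_neq0. Qed.
Lemma aw_cd w : Hp w -> cd aw w (rC kap * gc g / jac g w * aw w).
Proof.
move=> hw; apply: cd_eq (cdZ (v g) (cd_cpow_jac kap hg hw)) _.
by rewrite /aw; move: (rC kap * gc g / jac g w) (cpow _ _) => x y; ring.
Qed.
Lemma F1_mob w : Hp w -> F1 (mob g w) = aw w *: (rho1 g *m F1 w).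
Proof.
move=> hw; rewrite -hslash // /slash scalerA -invfM mulfV ?scale1r //.
exact: aw_neq0.
Qed.
Lemma gm_cd m j w : Hp w -> cd (gm m j) w (tpi * (gm m.+1 j w - rC (kap + 2 * m%:R) * Defs.Pfun w * gm m j w)).
Proof.
move=> hw; apply: cd_eq.
  by apply: cd_sum => l _; apply: cdZ; exact: FD_cd.
rewrite /gm mulr_sumr -sumrB mulr_sumr; apply: eq_bigr => l _; ring.
Qed.
Lemma P_hol : holH Defs.Pfun. Proof. exact: qrep_holH qr_P. Qed.
Lemma P_defect_hol : holH P_defect.
Proof.
move=> z hz; have j0 := jac_neq0 hg hz; eexists; apply: cdB; last exact: holH_cd P_hol hz.
apply: cdD.
  apply: cdM; first by apply: cdV; [rewrite expf_neq0|exact: cd_jacX].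
  by apply: cd_comp (cd_mob hg hz) (holH_cd P_hol (Hp_mob hg hz)).
by apply: cdZ; apply: cdV j0 (cd_jac g z).
Qed.
Lemma uc_hol n m : holH (uc n m).
Proof.
elim: n m => [|n IH] m /=; first exact: holH_cst.
apply: holHD; last first.
  by apply: holHM => //; apply: holHM; [exact: holH_cst|exact: P_defect_hol].
apply: holHD; first by case: m => [|m]; [exact: holH_cst|exact: IH].
apply: holHD; first by apply: holHM; [exact: holH_cst|exact: holH_der].
by apply: holHM => //; apply: holHM; [exact: holH_cst|exact: P_hol].
Qed.
Lemma cderiv_cst f c z : (forall w, Hp w -> f w = c) -> Hp z -> cderiv f z = 0.
Proof.
move=> h hz; apply: cderiv_eq; apply: (@cd_nearH (fun=> c)) => //; last exact: cd_cst.
by move=> w hw; rewrite h.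
Qed.
Lemma uc_gt n m z : (n < m)%N -> Hp z -> uc n m z = 0.
Proof.
elim: n m z => [|n IH] [|m] z //= nm hz.
have nm1 : (n < m.+1)%N by apply: ltnW.
rewrite (IH m) // (IH m.+1) // (@cderiv_cst _ 0) // => [|w hw]; last exact: IH.
by rewrite !mulr0 !addr0.
Qed.
Lemma uc_nn n z : Hp z -> uc n n z = 1.
Proof.
elim: n z => [|n IH] z //= hz.
rewrite IH // (uc_gt (ltnSn n)) // (@cderiv_cst _ 0) // => [|w hw]; last exact: uc_gt.
by rewrite !mulr0 !addr0.
Qed.
(** Each differentiation contributes its weight kap + 2 t times the defect; nothing else appears,
    because the leading coefficients are constantly 1. *)
Lemma uc_Sn n z : Hp z -> uc n.+1 n z = rC (\sum_(t < n.+1) (kap + 2 * t%:R)) * P_defect z.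
Proof.
elim: n z => [|n IH] z hz.
  rewrite big_ord_recl big_ord0 addr0 /= (@cderiv_cst _ 1) //.
  by rewrite subrr rC0 !mul0r mulr0 !addr0 add0r mulr1.
rewrite big_ord_recr rCD mulrDl -IH //.
have -> : uc n.+2 n.+1 z = uc n.+1 n z + (tpi^-1 * cderiv (uc n.+1 n.+1) z + rC (2 * n.+1%:R - 2 * n.+1%:R) * Defs.Pfun z * uc n.+1 n.+1 z)
    + rC (kap + 2 * n.+1%:R) * P_defect z * uc n.+1 n.+1 z by [].
rewrite (@cderiv_cst _ 1) // => [|w hw]; last exact: uc_nn.
by rewrite uc_nn // subrr rC0 !mul0r mulr0 !addr0 mulr1.
Qed.

Lemma FD_mob n j z : Hp z -> Dkn kap n (compo F1 j) (mob g z) =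
  jac g z ^+ (2 * n) * aw z * \sum_(m < n.+1) uc n m z * gm m j z.
Proof.
elim: n z => [|n IH] z hz.
  rewrite muln0 expr0 mul1r big_ord_recl big_ord0 addr0 /= mul1r /compo F1_mob // !mxE.
  by congr (_ * _); apply: eq_bigr => l _.
have j0 := jac_neq0 hg hz.
pose A w := jac g w ^+ (2 * n) * aw w.
pose F w := \sum_(m < n.+1) uc n m w * gm m j w.
have cA : cd A z (rC (kap + 2 * n%:R) * gc g / jac g z * A z).
  apply: cd_eq (cdM (cd_jacX g z (2 * n)) (aw_cd hz)) _.
  rewrite /A rCD rCM !rC_nat natrM; case: n {IH A F} => [|n].
    by rewrite muln0 /= expr0; ring.
  have -> : (2 * n.+1)%N = (2 * n.+1).-1.+1 by rewrite prednK // muln_gt0.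
  rewrite succnK exprS; move: (jac g z ^+ _) (aw z) (rC kap) => x y t; by field.
pose F' := \sum_(m < n.+1) (cderiv (uc n m) z * gm m j z +
    uc n m z * (tpi * (gm m.+1 j z - rC (kap + 2 * m%:R) * Defs.Pfun z * gm m j z))).
have cF : cd F z F'.
  by apply: cd_sum => m _; apply: cdM; [exact: holH_cd (@uc_hol n m) hz|exact: gm_cd].
have hm := Hp_mob hg hz.
have c0 := holH_cd (@FD_hol n j) hm.
have c1 := cd_comp (cd_mob hg hz) c0.
have c2 : cd (fun w => Dkn kap n (compo F1 j) (mob g w)) z (rC (kap + 2 * n%:R) * gc g / jac g z * A z * F z + A z * F').
  by apply: (@cd_nearH (fun w => A w * F w)) => //; [move=> w hw; rewrite IH|exact: cdM].
have h := cd_uniq c1 c2.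
have -> : Dkn kap n.+1 (compo F1 j) (mob g z) = tpi^-1 * cderiv (Dkn kap n (compo F1 j)) (mob g z)
   + rC (kap + 2 * n%:R) * Defs.Pfun (mob g z) * Dkn kap n (compo F1 j) (mob g z) by exact: DkE.
rewrite IH // -/(A z) -/(F z).
move: h; set D := cderiv _ _ => h.
have -> : D = jac g z ^+ 2 * (D * (jac g z) ^- 2) by field.
rewrite h.
have -> : jac g z ^+ (2 * n.+1) * aw z = jac g z ^+ 2 * A z.
  by rewrite /A mulnS exprD mulrA.
(* The shifted coefficients account for the derivatives of the [gm], the unshifted ones for those of
   the [uc]. *)
have -> : \sum_(m < n.+2) uc n.+1 m z * gm m j z = tpi^-1 * F' + rC (kap + 2 * n%:R) * (Defs.Pfun z + P_defect z) * F z.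
  transitivity (\sum_(m < n.+2) (if (m : nat) is m'.+1 then uc n m' z else 0) * gm m j z +
    \sum_(m < n.+2) ((tpi^-1 * cderiv (uc n m) z + rC (2 * n%:R - 2 * m%:R) * Defs.Pfun z * uc n m z)
      + rC (kap + 2 * n%:R) * P_defect z * uc n m z) * gm m j z).
    by rewrite -big_split; apply: eq_bigr => m _; rewrite /= -mulrDl !addrA.
  rewrite big_ord_recl /= mul0r add0r [X in _ + X]big_ord_recr /=.
  rewrite (uc_gt (ltnSn n)) // (@cderiv_cst _ 0) // => [|w hw]; last exact: uc_gt.
  rewrite !mulr0 !addr0 mul0r addr0.
  rewrite /F' /F !mulr_sumr -!big_split; apply: eq_bigr => m _ /=.
  rewrite /bump /= !add1n.
  have -> : rC (2 * n%:R - 2 * m%:R) = rC (kap + 2 * n%:R) - rC (kap + 2 * m%:R).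
    by rewrite -rCB; congr rC; ring.
  move: (rC (_ + _)) (rC (_ + _)) (cderiv _ _) (uc n m z) (gm m.+1 j z) (gm m j z) (Defs.Pfun z) (P_defect z) => x y t s r p q u.
  by field; exact: tpi_neq0.
have -> : Defs.Pfun z + P_defect z = (jac g z ^+ 2)^-1 * Defs.Pfun (mob g z) + gc g / tpi * (jac g z)^-1.
  by rewrite /P_defect addrC subrK.
by field; rewrite j0 tpi_neq0.
Qed.

Local Arguments uc : simpl never.
Lemma gm_ode j z : Hp z -> gm 4 j z + M4 z * gm 2 j z + M6 z * gm 1 j z + M8 z * gm 0 j z = 0.
Proof.
move=> hz; rewrite /gm !mulr_sumr -!big_split big1 // => l _ /=.
have := hode l hz; rewrite /mlde4 => h.
transitivity (rho1 g j l * 0); last by rewrite mulr0.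
by rewrite -h /=; ring.
Qed.

Lemma P_defect_zero z : Hp z -> P_defect z = 0.
Proof.
move=> hz; have j0 := jac_neq0 hg hz; have a0 := aw_neq0 hz; have hm := Hp_mob hg hz.
have [_ A4] := (MFP _ _).1 hM4; have [_ A6] := (MFP _ _).1 hM6; have [_ A8] := (MFP _ _).1 hM8.
(* The coefficients of D^0 to D^3 in the transformed equation minus the original one; the leading
   terms cancel. *)
pose cf : 'rV[C]_4 := \row_(m < 4) nth 0 [:: uc 4 0 z + M4 z * uc 2 0 z + M6 z * uc 1 0 z;
   uc 4 1 z + M4 z * uc 2 1 z; uc 4 2 z; uc 4 3 z] m.
have key j : \sum_(m < 4) cf 0 m * gm m j z = 0.
  have J8 : jac g z ^+ 8 * aw z != 0 by rewrite mulf_neq0 // expf_neq0.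
  apply: (mulfI J8); rewrite mulr0.
  have := hode j hm; rewrite /mlde4.
  have -> : compo F1 j (mob g z) = Dkn kap 0 (compo F1 j) (mob g z) by [].
  rewrite !FD_mob // A4 // A6 // A8 //.
  rewrite !big_ord_recr !big_ord0 !mxE /= !add0r.
  rewrite (uc_nn 4) // (uc_nn 2) // (uc_nn 1) // (uc_nn 0) // -[(2 * 4)%N]/8%N -[(2 * 2)%N]/4%N -[(2 * 1)%N]/2%N -[(2 * 0)%N]/0%N.
  rewrite [jac g z ^ 4](_ : _ = jac g z ^+ 4) // [jac g z ^ 6](_ : _ = jac g z ^+ 6) // [jac g z ^ 8](_ : _ = jac g z ^+ 8) //.
  have := gm_ode j hz.
  move: (uc 4 0 z) (uc 4 1 z) (uc 4 2 z) (uc 4 3 z) (uc 2 0 z) (uc 2 1 z) (uc 1 0 z) => u40 u41 u42 u43 u20 u21 u10.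
  move: (gm 4 j z) (gm 3 j z) (gm 2 j z) (gm 1 j z) (gm 0 j z) (M4 z) (M6 z) (M8 z) (aw z) (jac g z) => g4 g3 g2 g1 g0 m4 m6 m8 a J h1 h2.
  match type of h2 with ?L = _ =>
    transitivity (L - J ^+ 8 * a * (g4 + m4 * g2 + m6 * g1 + m8 * g0)) end; first by ring.
  by rewrite h1 h2 mulr0 subr0.
(* The matrix of the [gm] is the Wronskian matrix times the transpose of [rho1 g], hence
   invertible. *)
have cf0 : cf = 0.
  have h : cf *m (WM z *m (rho1 g)^T) = 0.
    apply/rowP => j; rewrite !mxE -[RHS](key j); apply: eq_bigr => m _; congr (_ * _).
    rewrite !mxE /gm; apply: eq_bigr => l _; rewrite !mxE mulrC //.
  have u1 : WM z *m (rho1 g)^T \in unitmx.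
    rewrite unitmx_mul unitmx_tr (hrep.1 g hg) andbT unitmxE unitfE.
    exact: Wd_neq0.
  by rewrite -[cf](mulmxK u1) h mul0mx.
(* The coefficient of D^3 is (4 kap + 12) times the defect. *)
have := congr1 (fun x : 'rV[C]_4 => x 0 3) cf0; rewrite !mxE /= uc_Sn // => /eqP.
rewrite mulf_eq0 rC_eq0 => /orP[/eqP h|/eqP //]; exfalso.
have := kap_ge0; move: h; rewrite !big_ord_recr big_ord0 /= => h k0; move: h.
rewrite add0r; lra.
Qed.
End QuasiP.

Lemma quasiP_MLDE : quasi_P.
Proof.
move=> g z hg hz; have := P_defect_zero hg hz; rewrite /P_defect; have j0 := jac_neq0 hg hz.
set P2 := Defs.Pfun (mob g z) => h.
have -> : P2 = jac g z ^+ 2 * ((jac g z ^+ 2)^-1 * P2 + gc g / tpi * (jac g z)^-1 - Defs.Pfun z)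
   + jac g z ^+ 2 * Defs.Pfun z - gc g * jac g z / tpi.
  by field; rewrite j0 tpi_neq0.
by rewrite h mulr0 add0r.
Qed.
End MLDE.

(** * Vector-valued forms *)
Lemma ee_rC_inj x y : 0 <= x < 1 -> 0 <= y < 1 -> ee (rC x) = ee (rC y) -> x = y.
Proof.
move=> /andP[a1 a2] /andP[b1 b2] e; have /ee_eq1[n en] : ee (rC x - rC y) = 1.
  by rewrite eeD eeN e mulfV ?ee_neq0.
apply/eqP; rewrite -subr_eq0.
have e2 : x - y = n%:~R by apply: rC_inj; rewrite rCB en /rC rmorph_int.
have n1 : (n%:~R : R) < 1%:~R by rewrite -e2; lra.
have n2 : ((-1)%:~R : R) < n%:~R by rewrite -e2 intrN; lra.
rewrite ltr_int in n1; rewrite ltr_int in n2.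
have n0 : n = 0 by lia.
by rewrite e2 n0.
Qed.

Section Forms.
Variables (v : 'M[int]_2 -> C) (lam : 'I_4 -> R) (i : 'I_4) (F1 : C -> 'cV[C]_4)
  (rho1 : 'M[int]_2 -> 'M[C]_4) (k1 : R) (phi : 'I_4 -> C -> C) (wq : C -> C).
Let kap := k1 + 2.
Let ex j := lam j + (if j == i then 1 else 0).
Hypotheses (lam01 : forall j, 0 <= lam j < 1) (lam_inj : injective lam).
Hypotheses (phi0 : forall j, phi j 0 = 1) (phiq : forall j, qrep (ex j) (phi j) (compo F1 j)).
Hypothesis Pq : quasi_P.
Local Notation W := (Wd F1 kap).
Hypotheses (Wq : qrep (\sum_j ex j) wq W) (W0 : forall z, Hp z -> W z != 0)
  (wq0 : forall q, cabs q < 1 -> wq q != 0).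
Hypothesis hrep : is_rep rho1.
Hypothesis hslash : forall g, SL2 g -> forall z, Hp z -> slash kap v g F1 z = rho1 g *m F1 z.
Hypothesis hv : forall g, SL2 g -> v g != 0.

(** The automorphy factor of the base weight k1; integer weights below are relative to k1. *)
Definition jf (g : 'M[int]_2) (z : C) : C := v g * cpow (jac g z) k1.
Definition autv (n : int) (H : C -> 'cV[C]_4) := forall g z, SL2 g -> Hp z ->
  H (mob g z) = (jf g z * jac g z ^ n) *: (rho1 g *m H z).
(** The space H(k1 + n, rho1, v), with holomorphy and growth encoded by expansions with exponents
    [lam]; [HH_vform] is the equivalence. *)
Definition vform (n : int) (H : C -> 'cV[C]_4) :=
  (forall j, exists f, qrep (lam j) f (compo H j)) /\ autv n H.

Lemma jf_neq0 g z : SL2 g -> Hp z -> jf g z != 0.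
Proof. by move=> hg hz; rewrite mulf_neq0 ?hv // cpow_neq0 // jac_neq0. Qed.
Lemma jf_cpow g z (n : int) : SL2 g -> Hp z ->
  jf g z * jac g z ^ n = v g * cpow (jac g z) (k1 + n%:~R).
Proof. by move=> hg hz; rewrite cpowD ?jac_neq0 // cpow_int ?jac_neq0 // mulrA. Qed.

Lemma slash_autv n (H : C -> 'cV[C]_4) g z : SL2 g -> Hp z ->
  slash (k1 + n%:~R) v g H z = rho1 g *m H z <->
  H (mob g z) = (jf g z * jac g z ^ n) *: (rho1 g *m H z).
Proof.
move=> hg hz; have a0 : v g * cpow (jac g z) (k1 + n%:~R) != 0.
  by rewrite mulf_neq0 ?hv // cpow_neq0 // jac_neq0.
rewrite jf_cpow // /slash -invfM; split=> [<-|->]; rewrite scalerA.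
  by rewrite mulfV ?scale1r.
by rewrite mulVf ?scale1r.
Qed.

Lemma autv_compo n H g z j : autv n H -> SL2 g -> Hp z ->
  compo H j (mob g z) = jf g z * jac g z ^ n * \sum_l rho1 g j l * compo H l z.
Proof. by move=> h hg hz; rewrite /compo h // !mxE. Qed.

Lemma F1_autv : autv 2 F1.
Proof. by move=> g z hg hz; apply/slash_autv => //; exact: hslash. Qed.

Definition DH (k : R) (a : nat) (H : C -> 'cV[C]_4) : C -> 'cV[C]_4 :=
  fun z => \col_j Dkn k a (compo H j) z.
Lemma compo_DH k a H j : compo (DH k a H) j = Dkn k a (compo H j).
Proof. by apply: funext => z; rewrite /compo mxE. Qed.
Lemma compo_Dvec k (H : C -> 'cV[C]_4) j : compo (Dvec k H) j = Dk k (compo H j).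
Proof. by apply: funext => z; rewrite /compo mxE. Qed.
Lemma DH0 k H : DH k 0 H = H.
Proof. by apply: funext => z; apply/colP => j; rewrite mxE. Qed.
Lemma DHS k a H : DH k a.+1 H = Dvec (k + 2 * a%:R) (DH k a H).
Proof. by apply: funext => z; apply/colP => j; rewrite !mxE compo_DH. Qed.

Lemma autv_Dvec n (H : C -> 'cV[C]_4) : (forall j, holH (compo H j)) -> autv n H ->
  autv (n + 2) (Dvec (k1 + n%:~R) H).
Proof.
move=> Hh Ha g z hg hz; apply/colP => j; have j0 := jac_neq0 hg hz.
pose a w := jf g w * jac g w ^ n.
have ca : cd a z (rC (k1 + n%:~R) * gc g / jac g z * a z).
  apply: cd_eq; first by apply: cdM; [apply: cdZ; exact: cd_cpow_jac|exact: cd_jacz].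
  rewrite /a /jf rCD; move: (rC k1) (rC n%:~R) (cpow _ _) (jac g z ^ n) => x y t s; by field.
pose F w := \sum_l rho1 g j l * compo H l w.
have cF : cd F z (\sum_l rho1 g j l * cderiv (compo H l) z).
  by apply: cd_sum => l _; apply: cdZ; exact: holH_cd.
have hm := Hp_mob hg hz.
rewrite mxE (Dk_slash Pq hg hz ca cF (holH_cd (@Hh j) hm) (fun w hw => autv_compo j Ha hg hw)).
rewrite !mxE expfzDr // -/(a z).
have -> : jac g z ^+ 2 * a z = jf g z * (jac g z ^ n * jac g z ^ 2).
  by rewrite /a [jac g z ^ 2](_ : _ = jac g z ^+ 2) //; ring.
congr (_ * _); rewrite !mulr_sumr -big_split; apply: eq_bigr => l _ /=.
rewrite mxE (DkE _ (holH_cd (@Hh l) hz)); ring.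
Qed.
Lemma vform_hol n H j : vform n H -> holH (compo H j).
Proof. by move=> [h _]; have [f hf] := h j; exact: qrep_holH hf. Qed.
Lemma vform_Dvec n H : vform n H -> vform (n + 2) (Dvec (k1 + n%:~R) H).
Proof.
move=> h; split; last by apply: autv_Dvec; [move=> j; exact: vform_hol h|exact: h.2].
move=> j; have [f hf] := h.1 j; exists (qD (lam j) (k1 + n%:~R) f).
by rewrite compo_Dvec; exact: qrep_Dk.
Qed.
Lemma vform_DH n H a : vform n H -> vform (n + (2 * a)%:Z) (DH (k1 + n%:~R) a H).
Proof.
move=> h; elim: a => [|a IH]; first by rewrite DH0 muln0 addr0.
have := vform_Dvec IH; rewrite DHS.
have -> : n + (2 * a)%:Z + 2 = n + (2 * a.+1)%:Z by lia.
by rewrite intrD addrA [((2 * a)%:Z)%:~R]natrM.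
Qed.

(** Read with exponents [lam], component i of F1 absorbs a factor q and so has leading coefficient
    0. *)
Lemma F1_lam j : exists f, qrep (lam j) f (compo F1 j) /\ f 0 = (if j == i then 0 else 1).
Proof.
have [h e] := phiq j; rewrite /ex in e; case: eqP e => [_|_] e.
  exists (fun q => q * phi j q); split; last by rewrite mul0r.
  split; first by apply: dholM => //; exact: dhol_id.
  by move=> z hz; rewrite e // rCD mulrDl eeD rC1 mul1r; ring.
by exists (phi j); rewrite phi0; split => //; split => // z hz; rewrite e // addr0.
Qed.
Lemma F1_vform : vform 2 F1.
Proof. by split; [move=> j; have [f []] := F1_lam j; exists f|exact: F1_autv]. Qed.

Lemma qrep_T l f h z : qrep l f h -> Hp z -> h (z + 1) = ee (rC l) * h z.
Proof.
move=> [_ e] hz; have hz1 : Hp (z + 1) by rewrite /Hp ImCD addr0.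
by rewrite !e // eeD1 mulrDr mulr1 eeD; ring.
Qed.

(** Differentiating the relation shows that N annihilates all columns of the transposed Wronskian
    matrix. Identities between constant matrices can thus be tested on F1. *)
Lemma rank_F1 (N : 'M[C]_4) : (forall z, Hp z -> N *m F1 z = 0) -> N = 0.
Proof.
move=> h; have hol l : holH (compo F1 l) := qrep_holH (phiq l).
have D a : forall j z, Hp z -> \sum_l N j l * Dkn kap a (compo F1 l) z = 0.
  elim: a => [|a IH] j z hz /=.
    by have := congr1 (fun x : 'cV_4 => x j 0) (h z hz); rewrite !mxE.
  have hl l : holH (Dkn kap a (compo F1 l)) := qrep_holH (qrep_Dkn kap a (phiq l)).
  have c : cd (fun w => \sum_l N j l * Dkn kap a (compo F1 l) w) z (\sum_l N j l * cderiv (Dkn kap a (compo F1 l)) z).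
    by apply: cd_sum => l _; apply: cdZ; exact: holH_cd.
  have c0 : cd (fun w => \sum_l N j l * Dkn kap a (compo F1 l) w) z 0.
    by apply: (@cd_nearH (fun=> 0)) => //; [move=> w hw; rewrite IH|exact: cd_cst].
  transitivity (tpi^-1 * (\sum_l N j l * cderiv (Dkn kap a (compo F1 l)) z) +
    rC (kap + 2 * a%:R) * Defs.Pfun z * (\sum_l N j l * Dkn kap a (compo F1 l) z)); last first.
    by rewrite (cd_uniq c c0) (IH j z hz) !mulr0 addr0.
  rewrite !mulr_sumr -big_split; apply: eq_bigr => l _ /=.
  rewrite (DkE _ (holH_cd (@hl l) hz)); ring.
have hi : Hp iC by rewrite /Hp ImC_iC.
have u : (WM F1 kap iC)^T \in unitmx by rewrite unitmx_tr unitmxE unitfE W0.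
rewrite -[N](mulmxK u); have -> : N *m (WM F1 kap iC)^T = 0; last by rewrite mul0mx.
apply/matrixP => j a; rewrite !mxE -[RHS](D a j iC hi); apply: eq_bigr => l _.
by rewrite !mxE.
Qed.

Lemma jf_Tm z : jf Tm z = v Tm.
Proof. by rewrite /jf jac_Tm cpow1 mulr1. Qed.
Lemma rho1_Tm : v Tm *: rho1 Tm = diag_mx (\row_j ee (rC (lam j))).
Proof.
apply/eqP; rewrite -subr_eq0; apply/eqP/rank_F1 => z hz.
have := F1_autv SL2_Tm hz; rewrite jf_Tm jac_Tm exp1rz mulr1 mob_Tm => e.
rewrite mulmxBl -scalemxAl -e mul_diag_mx; apply/colP => j; rewrite !mxE.
have [f [hf _]] := F1_lam j; have := qrep_T hf hz; rewrite /compo => ->.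
by rewrite subrr.
Qed.
Lemma lam_ee_inj j k : ee (rC (lam j)) = ee (rC (lam k)) -> j = k.
Proof. by move=> e; apply: lam_inj; exact: ee_rC_inj e. Qed.

(** By [rho1_Tm], T multiplies component j by e(lam j); as 0 <= lam j < 1, moderate growth then
    means an expansion q^(lam j) times a power series. *)
Lemma HH_vform n H : HH (k1 + n%:~R) rho1 v H <-> vform n H.
Proof.
split=> [[Hh [N [c Hm]] Hs]|[h ha]].
  have ha : autv n H by move=> g z hg hz; apply/slash_autv => //; exact: Hs.
  split => // j; apply: qrep_moderate; first exact: lam01.
  - exact/holoP.
  - by exists N, c => z hz; have := Hm z hz j; rewrite cabs_norm lecR.
  move=> z hz; have := ha Tm z SL2_Tm hz; rewrite jf_Tm jac_Tm exp1rz mulr1 mob_Tm scalemxAl rho1_Tm.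
  by rewrite /compo => ->; rewrite mul_diag_mx !mxE.
split; first by move=> j; apply/holoP; have [f hf] := h j; exact: qrep_holH hf.
  have bd j : exists c, forall z, c < ImC z -> cabs (H z j 0) <= ImC z.
    have [f hf] := h j; case/andP: (lam01 j) => l0 _; exact: qrep_bnd l0 hf.
  pose c j := sval (cid (bd j)).
  exists 1%N, (\sum_j `|c j|) => z hz j; rewrite cabs_norm lecR expr1.
  rewrite /c in hz; apply: (svalP (cid (bd j))); apply: le_lt_trans hz.
  apply: (le_trans (ler_norm _)); rewrite (bigD1 j) //= lerDl; exact: sumr_ge0.
by move=> g hg z hz; apply/slash_autv => //; exact: ha.
Qed.

Lemma vformZ l n f H : MF l f -> vform n H -> vform (l + n) (fun z => f z *: H z).
Proof.
move=> /MFP[[p hp] fa] [h ha]; split.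
  move=> j; have [f' hf] := h j; exists (fun q => p q * f' q).
  have := qrepM hp hf; rewrite add0r; apply: qrep_ext => z _; by rewrite /compo mxE.
move=> g z hg hz; rewrite fa // ha // scalerA -scalemxAr scalerA; congr (_ *: _).
by rewrite expfzDr ?jac_neq0 //; ring.
Qed.
Lemma vformD n H H' : vform n H -> vform n H' -> vform n (fun z => H z + H' z).
Proof.
move=> [h ha] [h' ha']; split.
  move=> j; have [f hf] := h j; have [f' hf'] := h' j; exists (fun q => f q + f' q).
  by apply: qrep_ext (qrepD hf hf') => z _; rewrite /compo mxE.
by move=> g z hg hz; rewrite ha // ha' // mulmxDr scalerDr.
Qed.
Lemma vformC n c H : vform n H -> vform n (fun z => c *: H z).
Proof. by move=> h; have := vformZ (MF_cst c) h; rewrite add0r. Qed.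

Definition BM (B : 'I_4 -> C -> 'cV[C]_4) (z : C) : 'M[C]_4 := \matrix_(a, j) B a z j 0.

Lemma BM_mob B (nn : 'I_4 -> int) g z : (forall a, autv (nn a) (B a)) -> SL2 g -> Hp z ->
  \det (BM B (mob g z)) = jf g z ^+ 4 * jac g z ^ (\sum_a nn a) * \det (rho1 g) * \det (BM B z).
Proof.
move=> hB hg hz; have j0 := jac_neq0 hg hz.
have -> : BM B (mob g z) = \matrix_(a, j) ((BM B z *m (rho1 g)^T) a j * (jf g z * jac g z ^ nn a)).
  apply/matrixP => a j; rewrite !mxE hB // !mxE mulrC; congr (_ * _).
  by apply: eq_bigr => l _; rewrite !mxE mulrC.
rewrite det_scale_rows det_mulmx det_tr big_split prodr_const card_ord /=.
have -> : \prod_a jac g z ^ nn a = jac g z ^ (\sum_a nn a).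
  by rewrite (big_morph (fun n => jac g z ^ n) (fun m n => expfzDr m n j0) (expr0z _)).
by rewrite mulrA mulrAC -!mulrA.
Qed.

Lemma W_BM z : W z = \det (BM (fun a => DH kap a F1) z).
Proof. by congr (\det _); apply/matrixP => a j; rewrite !mxE. Qed.
Lemma F1_DH_autv (a : 'I_4) : autv (2 + (2 * a)%:Z) (DH kap a F1).
Proof. by have [_] := vform_DH a F1_vform. Qed.
(** The rows of W have relative weights 2, 4, 6 and 8, with sum 20. With the weight 12 of Delta this
    gives the -8 of [ratio_MF]. *)
Lemma W_mob g z : SL2 g -> Hp z -> W (mob g z) = jf g z ^+ 4 * jac g z ^ 20 * \det (rho1 g) * W z.
Proof.
move=> hg hz; rewrite W_BM W_BM (BM_mob F1_DH_autv hg hz).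
by rewrite !big_ord_recl big_ord0.
Qed.

(* comparing a determinant of forms with the Wronskian of F1 cancels multipliers and det rho1 *)
Lemma ratio_MF B (nn : 'I_4 -> int) (Phi : 'I_4 -> 'I_4 -> C -> C) :
  (forall a j, qrep (lam j) (Phi a j) (compo (B a) j)) -> (forall a, autv (nn a) (B a)) ->
  MF (\sum_a nn a - 8) (fun z => Delta z * \det (BM B z) / W z) /\
  qr (fun q => hfun q ^+ 24 * \det (\matrix_(a, j) Phi a j q) / wq q) (fun z => Delta z * \det (BM B z) / W z).
Proof.
move=> hP hB.
have dP : dhol (fun q => \det (\matrix_(a, j) Phi a j q)).
  by apply: dhol_det => a j; apply: dhol_ext (hP a j).1 => q; rewrite mxE.
have hq : qr (fun q => hfun q ^+ 24 * \det (\matrix_(a, j) Phi a j q) / wq q) (fun z => Delta z * \det (BM B z) / W z).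
  apply: qrI.
    apply: dholM; last exact: dholV Wq.1 wq0.
    by apply: dholM => //; apply: dholX; exact: hfun_hol.
  move=> z hz; rewrite Wq.2 //.
  rewrite (@det_qrep _ lam _ (\matrix_(a, j) Phi a j (ee z)) z); last first.
    by move=> a j; rewrite !mxE -(hP a j).2.
  (* The shift at i gives W one more power of q, which the simple zero of Delta compensates. *)
  have -> : \sum_j ex j = \sum_j lam j + 1.
    by rewrite big_split /= -big_mkcond big_pred1_eq.
  rewrite rCD mulrDl eeD rC1 mul1r /Delta.
  have e1 := ee_neq0 z; have e2 := ee_neq0 (rC (\sum_j lam j) * z).
  have w1 : wq (ee z) != 0 by apply: wq0; rewrite cabs_ee_lt1.
  move: (\det _) (hfun (ee z)) w1 e2 => x y; move: (wq _) (ee (rC _ * z)) => t s t0 s0.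
  by field; rewrite t0 s0 e1.
split => //; apply/MFP; split; first by eexists; exact: hq.
move=> g hg z hz; have j0 := jac_neq0 hg hz; have f0 := jf_neq0 hg hz.
have [_ Da] := (MFP _ _).1 (Delta_MF Pq).
have r0 : \det (rho1 g) != 0 by rewrite -unitfE -unitmxE; exact: hrep.1.
rewrite (BM_mob hB hg hz) W_mob // Da //.
rewrite (@expfzDr _ (jac g z) _ (- 8) j0) [jac g z ^ (- 8)](_ : _ = (jac g z ^+ 8)^-1); last first.
  exact: esym (exprnN _ 8).
rewrite [jac g z ^ 12](_ : _ = jac g z ^+ 12) // [jac g z ^ 20](_ : _ = jac g z ^+ 20) //.
have w0 := W0 hz.
move: (\det (BM B z)) (jac g z ^ _) (W z) w0 => x y t t0.
by field; rewrite t0 r0 j0 f0.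
Qed.
Lemma ratio_zero B z : Hp z -> Delta z * \det (BM B z) / W z = 0 -> \det (BM B z) = 0.
Proof.
move=> hz /eqP; rewrite (mulf_eq0 (Delta z * _)) invr_eq0 (negbTE (W0 hz)) orbF.
rewrite (mulf_eq0 (Delta z)) (negbTE (Delta_neq0 hz)) /=.
by move/eqP.
Qed.
(* With exponents [ex] the ratio of [ratio_MF] vanishes at the cusp, because of the shift at i. *)
Lemma ex_det_zero B (nn : 'I_4 -> int) (Phi : 'I_4 -> 'I_4 -> C -> C) :
  (forall a j, qrep (ex j) (Phi a j) (compo (B a) j)) -> (forall a, autv (nn a) (B a)) ->
  \sum_a nn a - 8 < 12 -> \det (\matrix_(a, j) Phi a j 0) = 0.
Proof.
move=> hP hB hn.
(* Passing from [ex] to [lam] moves a factor q into column i, which vanishes at the cusp. *)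
pose s (j : 'I_4) (q : C) := if j == i then q else 1.
have hP' a j : qrep (lam j) (fun q => Phi a j q * s j q) (compo (B a) j).
  have [h e] := hP a j; split.
    by apply: dholM => //; rewrite /s; case: eqP => _; [exact: dhol_id|exact: dhol_cst].
  move=> z hz; rewrite e // /ex /s; case: eqP => _; last by rewrite addr0 mulr1.
  by rewrite rCD mulrDl eeD rC1 mul1r; ring.
have [hM hq] := ratio_MF hP' hB.
have z0 : hfun 0 ^+ 24 * \det (\matrix_(a, j) (Phi a j 0 * s j 0)) / wq 0 = 0.
  suff -> : \det (\matrix_(a, j) (Phi a j 0 * s j 0)) = 0 by rewrite mulr0 mul0r.
  apply/eqP; rewrite -det_tr; apply/eqP.
  have -> : (\matrix_(a, j) (Phi a j 0 * s j 0))^T = \matrix_(j, a) ((\matrix_(j, a) Phi a j 0) j a * s j 0).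
    by apply/matrixP => j a; rewrite !mxE.
  by rewrite det_scale_rows (bigD1 i) //= /s eqxx !mul0r.
have hz := MF_cusp Pq hn hM hq z0.
have dz z : Hp z -> \det (BM B z) = 0 by move=> h; apply: ratio_zero => //; exact: hz.
apply: (@qrep_zero (\sum_j ex j) (fun q => \det (\matrix_(a, j) Phi a j q)) (fun z => \det (BM B z))) => //.
split; first by apply: dhol_det => a j; apply: dhol_ext (hP a j).1 => q; rewrite mxE.
by move=> z h; apply: det_qrep => a j; rewrite !mxE -(hP a j).2.
Qed.

Lemma rCex_inj : injective (fun j => rC (ex j)).
Proof.
move=> j k /rC_inj; rewrite /ex; case/andP: (lam01 j) => a1 a2; case/andP: (lam01 k) => b1 b2.
case: eqP => [ji|_]; case: eqP => [ki|_] h; first by rewrite ji ki.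
- by exfalso; lra.
- by exfalso; lra.
by apply: lam_inj; lra.
Qed.

(** * Indecomposability of rho1 *)

Section Projection.
Variable d : 'I_4 -> C.
Hypothesis d01 : forall j, d j = 0 \/ d j = 1.
Hypothesis dcomm : forall g, SL2 g -> rho1 g *m diag_mx (\row_j d j) = diag_mx (\row_j d j) *m rho1 g.
Let FA (z : C) : 'cV[C]_4 := diag_mx (\row_j d j) *m F1 z.
Let FA_compo j z : compo FA j z = d j * compo F1 j z.
Proof. by rewrite /compo /FA mul_diag_mx !mxE. Qed.
Let FA_q j : qrep (ex j) (fun q => d j * phi j q) (compo FA j).
Proof. by apply: qrep_ext (qrepZ (d j) (phiq j)) => z _; rewrite FA_compo. Qed.
Let FA_autv : autv 2 FA.
Proof.
move=> g z hg hz; rewrite /FA F1_autv // -scalemxAr; congr (_ *: _).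
by rewrite !mulmxA dcomm.
Qed.
Let FA_vform : vform 2 FA.
Proof.
split; last exact: FA_autv.
move=> j; have [f [hf _]] := F1_lam j; exists (fun q => d j * f q).
by apply: qrep_ext (qrepZ (d j) hf) => z _; rewrite FA_compo.
Qed.
Let al (t : nat) : C := rC (kap + 2 * t%:R) * pq 0.
Let sq (e : bool) := [seq rC (ex j) | j <- enum [pred j : 'I_4 | (d j == 0) == e]].
Let sq_uniq e : uniq (sq e).
Proof. by rewrite map_inj_uniq ?enum_uniq //; exact: rCex_inj. Qed.
Let sq_size e : size (sq e) = #|[pred j : 'I_4 | (d j == 0) == e]|.
Proof. by rewrite size_map -cardE. Qed.
Let sqP e (x : C) : x \in sq e -> exists2 j, (d j == 0) = e & x = rC (ex j).
Proof. by move=> /mapP[j]; rewrite mem_enum inE => /eqP h ->; exists j. Qed.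
Let card_sum : addn #|[pred j : 'I_4 | (d j == 0) == true]| #|[pred j : 'I_4 | (d j == 0) == false]| = 4%N.
Proof.
rewrite -[RHS](card_ord 4) -(cardC [pred j : 'I_4 | (d j == 0) == true]); congr (_ + _)%N.
by apply: eq_card => j; rewrite !inE; case: (d j == 0).
Qed.
Let d_ff j : (d j == 0) = false -> d j = 1.
Proof. by case: (d01 j) => -> //; rewrite eqxx. Qed.

(** The forms F1, DF1, D^2 F1 and [FA] have ratio of weight 14 - 8 = 6. The resulting relation at
    the cusp is p + u d = 0 at each exponent, with p of degree at most 2: p has the three exponents
    with d = 0 as roots, so p = 0, and then u = 0. *)
Lemma proj_rank_neq1 : #|[pred j : 'I_4 | (d j == 0) == false]| <> 1%N.
Proof.
move=> c1; have c3 : #|[pred j : 'I_4 | (d j == 0) == true]| = 3%N by move: card_sum; rewrite c1; lia.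
pose B (a : 'I_4) := if (a < 3)%N then DH kap a F1 else FA.
pose nn (a : 'I_4) := if (a < 3)%N then 2 + (2 * a)%:Z else 2.
pose Phi (a j : 'I_4) := if (a < 3)%N then qDn (ex j) kap a (phi j) else fun q => d j * phi j q.
have hP a j : qrep (ex j) (Phi a j) (compo (B a) j).
  rewrite /Phi /B; case: ifP => _; last exact: FA_q.
  by rewrite compo_DH; exact: qrep_Dkn.
have hB a : autv (nn a) (B a).
  by rewrite /nn /B; case: ifP => _; [exact: F1_DH_autv|exact: FA_autv].
have hn : \sum_a nn a - 8 < 12 by rewrite !big_ord_recr big_ord0.
have /eqP /det0P [u u0 hu] := ex_det_zero hP hB hn.
have key j : \sum_(a < 3) u 0 (inord a) * (nwt al a).[rC (ex j)] + u 0 3 * d j = 0.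
  have e := congr1 (fun M : 'rV_4 => M 0 j) hu; rewrite !mxE big_ord_recr /= in e.
  rewrite -[RHS]e; congr (_ + _).
    apply: eq_bigr => a _; rewrite mxE /Phi /= ltn_ord qDn0 phi0 mulr1 nwt_eval.
    by congr (u _ _ * _); apply: val_inj; rewrite /= inordK // ltnS ltnW.
  rewrite mxE /Phi /= phi0 mulr1; congr (u _ _ * _); exact: val_inj.
have u3 : forall a, (a < 3)%N -> u 0 (inord a) = 0.
  apply: (@nwt_roots al 3 (fun a => u 0 (inord a)) (sq true)) => //; first by rewrite sq_size c3.
  by move=> x /sqP[j /eqP dj ->]; have := key j; rewrite dj mulr0 addr0.
have [j dj] : exists j, (d j == 0) = false.
  have /card_gt0P[j] : leq 1 #|[pred j : 'I_4 | (d j == 0) == false]| by rewrite c1.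
  by rewrite inE => /eqP; exists j.
have := key j; rewrite big1 ?add0r => [|a _]; last by rewrite u3 ?mul0r.
rewrite (d_ff dj) mulr1 => u03; case/eqP: u0; apply/rowP => a; rewrite mxE.
have [a3|a3] := ltnP a 3; first by rewrite -(u3 a a3); congr (u _ _); apply: val_inj; rewrite /= inordK.
by rewrite -u03; congr (u _ _); apply: val_inj => /=; have := ltn_ord a; lia.
Qed.

Local Arguments qDn : simpl never.
(** The forms F1, DF1, [FA] and D [FA] have ratio of weight 12 - 8 = 4. The relation is p + d p' = 0
    with degrees at most 1: p has the two exponents with d = 0 as roots, and then p' the two with d
    = 1. *)
Lemma proj_rank_neq2 : #|[pred j : 'I_4 | (d j == 0) == false]| <> 2%N.
Proof.
move=> c1; have c3 : #|[pred j : 'I_4 | (d j == 0) == true]| = 2%N by move: card_sum; rewrite c1; lia.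
pose B (a : 'I_4) := if (a < 2)%N then DH kap a F1 else DH kap (a - 2) FA.
pose nn (a : 'I_4) := if (a < 2)%N then 2 + (2 * a)%:Z else 2 + (2 * (a - 2))%:Z.
pose Phi (a j : 'I_4) := if (a < 2)%N then qDn (ex j) kap a (phi j)
  else qDn (ex j) kap (a - 2) (fun q => d j * phi j q).
have hP a j : qrep (ex j) (Phi a j) (compo (B a) j).
  by rewrite /Phi /B; case: ifP => _; rewrite compo_DH; apply: qrep_Dkn => //; exact: FA_q.
have hB a : autv (nn a) (B a).
  rewrite /nn /B; case: ifP => _; first exact: F1_DH_autv.
  by have [_] := vform_DH (a - 2) FA_vform.
have hn : \sum_a nn a - 8 < 12 by rewrite !big_ord_recr big_ord0.
have /eqP /det0P [u u0 hu] := ex_det_zero hP hB hn.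
have key j : \sum_(a < 2) u 0 (inord a) * (nwt al a).[rC (ex j)]
    + d j * \sum_(a < 2) u 0 (inord (a + 2)) * (nwt al a).[rC (ex j)] = 0.
  have e := congr1 (fun M : 'rV_4 => M 0 j) hu; rewrite !mxE !big_ord_recr !big_ord0 /= in e.
  rewrite -[RHS]e !big_ord_recr !big_ord0 /=.
  rewrite !mxE /Phi /= !qDn0 !phi0 !nwt_eval /= !add0r !mulr1 mulrDr addrA.
  by congr (_ + _); [congr (_ + _); [congr (_ + _)|]|]; rewrite ?(mulrCA (d j)) ?[d j * _]mulrC;
    congr (u _ _ * _); apply: val_inj; rewrite /= inordK.
have uA : forall a, (a < 2)%N -> u 0 (inord a) = 0.
  apply: (@nwt_roots al 2 (fun a => u 0 (inord a)) (sq true)) => //; first by rewrite sq_size c3.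
  by move=> x /sqP[j /eqP dj ->]; have := key j; rewrite dj mul0r addr0.
have uB : forall a, (a < 2)%N -> u 0 (inord (a + 2)) = 0.
  apply: (@nwt_roots al 2 (fun a => u 0 (inord (a + 2))) (sq false)) => //; first by rewrite sq_size c1.
  move=> x /sqP[j dj ->]; have := key j; rewrite (d_ff dj) mul1r big1 ?add0r // => a _.
  by rewrite uA ?mul0r.
case/eqP: u0; apply/rowP => a; rewrite mxE.
have [a2|a2] := ltnP a 2; first by rewrite -(uA a a2); congr (u _ _); apply: val_inj; rewrite /= inordK.
rewrite -(uB (a - 2)%N); last by have := ltn_ord a; lia.
by congr (u _ _); apply: val_inj; rewrite /= inordK subnK.
Qed.
End Projection.

Lemma diag_comm_entries (P : 'M[C]_4) :
  P *m (rho1 Tm)^T = (rho1 Tm)^T *m P -> forall j k, j != k -> P j k = 0.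
Proof.
move=> h j k jk; have : P *m (v Tm *: rho1 Tm)^T = (v Tm *: rho1 Tm)^T *m P.
  by rewrite linearZ /= -scalemxAr -scalemxAl h.
rewrite rho1_Tm tr_diag_mx => /matrixP /(_ j k); rewrite mul_mx_diag mul_diag_mx !mxE => /eqP.
rewrite mulrC -subr_eq0 -mulrBl mulf_eq0 => /orP[|/eqP //].
by rewrite subr_eq0 => /eqP /lam_ee_inj e; move: jk; rewrite e eqxx.
Qed.

(* The projection onto a summand commutes with rho1 T, so it is diagonal; up to passing to the
   complement it has rank 1 or 2, and then [ex_det_zero], applied to derivatives of F1 and of its
   projection, gives a nonzero polynomial with too many exponents as roots. *)
Theorem rho1_indecomposable : indecomposable_rep rho1.
Proof.
split => // -[U [V [U0 V0 sU sV /andP[/eqP cap /eqmxP full]]]].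
pose P := proj_mx U V.
have PU : (P <= U)%MS by rewrite -[P]mul1mx; exact: proj_mx_sub.
have cap' : (V :&: U = 0)%MS by rewrite capmxC.
have sumP : P + proj_mx V U = 1%:M.
  by have := @add_proj_mx _ _ _ U V 1%:M cap; rewrite !mul1mx; apply; rewrite full.
have PV : (proj_mx V U <= V)%MS by rewrite -[proj_mx V U]mul1mx; exact: proj_mx_sub.
have comm g : SL2 g -> P *m (rho1 g)^T = (rho1 g)^T *m P.
  move=> hg; rewrite -[in RHS](mul1mx (rho1 g)^T) -sumP mulmxDl mulmxDl.
  rewrite [P *m _ *m P]proj_mx_id //; last by apply: submx_trans (sU g hg); exact: submxMr.
  rewrite [proj_mx V U *m _ *m P]proj_mx_0 ?addr0 //.
  by apply: submx_trans (sV g hg); exact: submxMr.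
have PP : P *m P = P by rewrite proj_mx_id.
have UP : U *m P = U by rewrite proj_mx_id.
have VP : V *m P = 0 by rewrite proj_mx_0.
move: P comm PP UP VP {PU cap' sumP PV} => P comm PP UP VP.
have off := diag_comm_entries (comm Tm SL2_Tm).
pose d j := P j j.
have Pd : P = diag_mx (\row_j d j).
  apply/matrixP => j k; rewrite [RHS]mxE [(\row__ _) _ _]mxE.
  have [<-|jk] := eqVneq j k; first by rewrite ?eqxx /= mulr1n.
  by rewrite off //= mulr0n.
have d01 j : d j = 0 \/ d j = 1.
  have e : d j * d j = d j.
    have := congr1 (fun M : 'M[C]_4 => M j j) PP; rewrite {1}Pd mul_diag_mx.
    by rewrite [LHS]mxE [(\row__ _) _ _]mxE.
  by have [d0|d0] := eqVneq (d j) 0; [left|right; apply: (mulfI d0); rewrite e mulr1].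
have dc g : SL2 g -> rho1 g *m diag_mx (\row_j d j) = diag_mx (\row_j d j) *m rho1 g.
  move=> hg; have := congr1 trmx (comm g hg); rewrite !trmx_mul trmxK Pd tr_diag_mx.
  by [].
pose d' j := 1 - d j.
have Pd' : 1%:M - diag_mx (\row_j d j) = diag_mx (\row_j d' j).
  by apply/matrixP => j k; rewrite !mxE /d'; case: eqP => _ /=; rewrite ?mulr1n // !mulr0n subr0.
have d'01 j : d' j = 0 \/ d' j = 1 by rewrite /d'; case: (d01 j) => ->; [right|left]; ring.
have d'c g : SL2 g -> rho1 g *m diag_mx (\row_j d' j) = diag_mx (\row_j d' j) *m rho1 g.
  by move=> hg; rewrite -Pd' mulmxBr mulmxBl dc // mulmx1 mul1mx.
have c1 := proj_rank_neq1 d01 dc; have c2 := proj_rank_neq2 d01 dc.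
have c1' := proj_rank_neq1 d'01 d'c.
have e' j : (d' j == 0) = (d j != 0).
  by rewrite /d'; case: (d01 j) => ->; rewrite ?subr0 ?subrr ?eqxx ?oner_eq0.
have tot : addn #|[pred j : 'I_4 | (d j == 0) == false]| #|[pred j : 'I_4 | (d' j == 0) == false]| = 4%N.
  rewrite -[RHS](card_ord 4) -(cardC [pred j : 'I_4 | (d j == 0) == false]); congr (_ + _)%N.
  by apply: eq_card => j; rewrite !inE e'; case: (d j == 0).
have [z|nz] := eqVneq #|[pred j : 'I_4 | (d j == 0) == false]| 0%N.
  have P0 : P = 0.
    rewrite Pd; apply/matrixP => j k; rewrite !mxE.
    have -> : d j = 0 by have := card0_eq z j; rewrite !inE; case: (d j =P 0).
    by rewrite mul0rn.
  by case/eqP: U0; rewrite -UP P0 mulmx0.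
have z : #|[pred j : 'I_4 | (d' j == 0) == false]| = 0%N.
  move: nz c1 c2 c1' tot => /eqP; move: #|_| #|_| => x y; lia.
have P1 : P = 1%:M.
  apply/eqP; rewrite eq_sym -subr_eq0 Pd Pd'; apply/eqP/matrixP => j k; rewrite !mxE.
  have -> : d' j = 0 by have := card0_eq z j; rewrite !inE; case: (d' j =P 0).
  by rewrite mul0rn.
by case/eqP: V0; rewrite -VP P1 mulmx1.
Qed.
Lemma vform_Tn n H l z (t : nat) : vform n H -> Hp z -> H (z + t%:R) l 0 = ee (rC (lam l)) ^+ t * H z l 0.
Proof.
move=> [h _] hz; have [f hf] := h l; elim: t => [|t IH]; first by rewrite addr0 expr0 mul1r.
have hz' : Hp (z + t%:R) by rewrite /Hp ImCD -rC_nat ImC_rC addr0.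
by rewrite -natr1 addrA -[LHS]/(compo H l (z + t%:R + 1)) (qrep_T hf hz') /compo IH exprS mulrA.
Qed.
(** Translating z by 0, 1, 2, 3 multiplies component l by powers of e(lam l), so a Vandermonde
    matrix separates the terms. *)
Lemma vform_indep n H (c : 'I_4 -> C) : vform n H ->
  (forall z, Hp z -> \sum_l c l * H z l 0 = 0) -> forall l z, Hp z -> c l * H z l 0 = 0.
Proof.
move=> hH h l z hz.
pose x : 'rV[C]_4 := \row_l (c l * H z l 0).
pose A : 'M[C]_4 := \matrix_(l, a) (nwt (fun=> 0) a).[ee (rC (lam l))].
have uA : A \in unitmx by rewrite unitmxE unitfE det_nwt //; exact: lam_ee_inj.
have xA : x *m A = 0.
  apply/rowP => a; rewrite !mxE.
  have hz' : Hp (z + (a : nat)%:R) by rewrite /Hp ImCD -rC_nat ImC_rC addr0.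
  rewrite -[RHS](h _ hz'); apply: eq_bigr => k _; rewrite !mxE (vform_Tn _ _ hH hz) nwt_eval.
  under eq_bigr do rewrite addr0.
  by rewrite prodr_const card_ord; ring.
have := congr1 (fun M : 'rV[C]_4 => M 0 l) (mulmxK uA x); rewrite xA mul0mx !mxE => ->.
by [].
Qed.

Section Irreducible.
Hypothesis hirr : irreducible_rep rho1.

(** The coordinate vectors of the components not identically zero span a stable subspace: if
    component j vanishes, its transform under g is a relation among the others, and [vform_indep]
    kills the entries of row j there. Irreducibility makes this subspace everything. *)
Lemma comp_nonzero n H : vform n H -> (exists z, Hp z /\ H z != 0) ->
  forall j, exists z, Hp z /\ H z j 0 != 0.
Proof.
move=> hH [z0 [hz0 nz0]] j0; apply: contrapT => hj0.
pose Z j := forall z, Hp z -> H z j 0 = 0.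
have Zj0 : Z j0.
  by move=> z hz; apply/eqP; apply: contrapT => /negP h; apply: hj0; exists z.
pose e j : C := if asbool (Z j) then 0 else 1.
pose U : 'M[C]_4 := diag_mx (\row_j e j).
have sU : stable rho1 U.
  move=> g hg; suff <- : U *m (rho1 g)^T *m U = U *m (rho1 g)^T by exact: submxMl.
  apply/matrixP => l j; rewrite mul_mx_diag mul_diag_mx !mxE /e.
  case: (asboolP (Z j)) => Zj; last by rewrite mulr1.
  case: (asboolP (Z l)) => Zl; first by rewrite !mul0r.
  rewrite mulr0 mul1r; apply/esym.
  have [z [hz nz]] : exists z, Hp z /\ H z l 0 != 0.
    apply: contrapT => h; apply: Zl => z hz; apply/eqP; apply: contrapT => /negP hn.
    by apply: h; exists z.
  have hs w : Hp w -> \sum_k rho1 g j k * H w k 0 = 0.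
    move=> hw; have := autv_compo j hH.2 hg hw; rewrite /compo Zj; last exact: Hp_mob.
    move/esym/eqP; rewrite mulf_eq0 mulf_eq0 (negbTE (jf_neq0 hg hw)) /=.
    by rewrite (negbTE (expfz_neq0 _ (jac_neq0 hg hw))) => /eqP.
  by have /eqP := vform_indep hH hs l hz; rewrite mulf_eq0 (negbTE nz) orbF => /eqP.
have [_ irr] := hirr; have [U0|Uf] := irr U sU.
  case/eqP: nz0; apply/colP => l; rewrite mxE.
  have := congr1 (fun M : 'M[C]_4 => M l l) U0; rewrite !mxE eqxx mulr1n /e.
  by case: (asboolP (Z l)) => [Zl _|_ /eqP]; [exact: Zl|rewrite oner_eq0].
have : U \in unitmx by rewrite -row_full_unit.
rewrite unitmxE unitfE det_diag (bigD1 j0) //= mxE /e.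
by case: asboolP => // _; rewrite mul0r eqxx.
Qed.

(** Every component is nonzero, so it has an exact order, congruent to lam j modulo integers. These
    orders are distinct, and the leading coefficient is a Vandermonde determinant times nonzero
    constants. *)
Lemma wronskian_nz n H : vform n H -> (exists z, Hp z /\ H z != 0) ->
  exists z, Hp z /\ \det (BM (fun a => DH (k1 + n%:~R) a H) z) != 0.
Proof.
move=> hH nz; pose k := k1 + n%:~R.
have ord j : exists p : nat * (C -> C), p.2 0 != 0 /\ qrep (lam j + p.1%:R) p.2 (compo H j).
  have [f [hf ef]] := hH.1 j; have [|t [psi [hpsi p0 e]]] := dhol_order hf.
    move=> f0; have [z [hz]] := comp_nonzero hH nz j.
    by rewrite -[H z j 0]/(compo H j z) ef // f0 ?mulr0 ?eqxx // cabs_ee_lt1.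
  exists (t, psi); split => //; split => // z hz.
  by rewrite ef // e ?cabs_ee_lt1 // rCD mulrDl eeD rC_nat ee_nat mulrA.
pose nn j := (sval (cid (ord j))).1; pose psi j := (sval (cid (ord j))).2.
have p0 j : psi j 0 != 0 by rewrite /psi; case: cid => p [].
have pq_ j : qrep (lam j + (nn j)%:R) (psi j) (compo H j) by rewrite /psi /nn; case: cid => p [].
apply: contrapT => h.
have dz z : Hp z -> \det (BM (fun a => DH k a H) z) = 0.
  by move=> hz; apply/eqP; apply: contrapT => /negP hn; apply: h; exists z.
pose Phi (a j : 'I_4) := qDn (lam j + (nn j)%:R) k a (psi j).
have hq : qrep (\sum_j (lam j + (nn j)%:R)) (fun q => \det (\matrix_(a, j) Phi a j q))
   (fun z => \det (BM (fun a => DH k a H) z)).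
  have hP (a j : 'I_4) : qrep (lam j + (nn j)%:R) (Phi a j) (Dkn k a (compo H j)) by exact: qrep_Dkn.
  split; first by apply: dhol_det => a j; apply: dhol_ext (hP a j).1 => q; rewrite mxE.
  by move=> z hz; apply: det_qrep => a j; rewrite !mxE (hP a j).2.
have := qrep_zero hq dz; apply/eqP; rewrite -det_tr.
pose al t := rC (k + 2 * t%:R) * pq 0.
have -> : (\matrix_(a, j) Phi a j 0)^T =
   \matrix_(j, a) ((\matrix_(j < 4, a < 4) (nwt al a).[rC (lam j + (nn j)%:R)]) j a * psi j 0).
  by apply/matrixP => j a; rewrite !mxE /Phi qDn0 nwt_eval.
rewrite det_scale_rows mulf_neq0 //; first by apply/prodf_neq0 => j _; exact: p0.
apply: det_nwt => j l /(congr1 ee) e; apply: lam_ee_inj; move: e.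
by rewrite !rCD !eeD !rC_nat !(ee_int (Posz _)) !mulr1.
Qed.

Lemma vform_divDelta n N (f : 'I_4 -> C -> C) : (forall j, qrep (lam j) (f j) (compo N j)) ->
  (forall j, f j 0 = 0) -> autv n N -> vform (n - 12) (fun z => (Delta z)^-1 *: N z).
Proof.
move=> hf f0 ha; split.
  move=> j; have [h e] := hf j; have [psi hpsi ep] := dhol_div0 h (f0 j).
  exists (fun q => psi q * (hfun q ^+ 24)^-1); split.
    apply: dholM => //; apply: dholV; first by apply: dholX; exact: hfun_hol.
    by move=> q hq; rewrite expf_neq0 // hfun_neq0.
  move=> z hz; rewrite /compo mxE -[N z j 0]/(compo N j z) e // ep ?cabs_ee_lt1 // /Delta.
  by field; rewrite ee_neq0 hfun_neq0 // cabs_ee_lt1.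
move=> g z hg hz; have j0 := jac_neq0 hg hz; have D0 := Delta_neq0 hz.
have [_ Da] := (MFP _ _).1 (Delta_MF Pq).
rewrite ha // Da // -scalemxAr !scalerA; congr (_ *: _).
rewrite (@expfzDr _ (jac g z) n (- 12) j0) [jac g z ^ (- 12)](_ : _ = (jac g z ^+ 12)^-1); last first.
  exact: esym (exprnN _ 12).
rewrite [jac g z ^ 12](_ : _ = jac g z ^+ 12) //; field.
by rewrite D0 j0.
Qed.

Definition replace_form (B : 'I_4 -> C -> 'cV[C]_4) (a : 'I_4) (F : C -> 'cV[C]_4) : 'I_4 -> C -> 'cV[C]_4 :=
  fun c => if c == a then F else B c.
Lemma BM_replace B a F z : BM (replace_form B a F) z = rowrep (BM B z) a (fun j => F z j 0).
Proof. by apply/matrixP => c j; rewrite !mxE /replace_form; case: eqP. Qed.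

Lemma cramer (A : 'M[C]_4) (r : 'I_4 -> C) j :
  \det A * r j = \sum_a \det (rowrep A a r) * A a j.
Proof.
have h : (\row_j r j) *m \adj A *m A = (\row_j r j) *m (\det A)%:M by rewrite -mulmxA mul_adj_mx.
have := congr1 (fun M : 'rV[C]_4 => M 0 j) h; rewrite mul_mx_scalar [RHS]mxE [(\row__ _) _ _]mxE => <-.
rewrite mxE; apply: eq_bigr => a _; congr (_ * _); rewrite mxE (expand_det_row _ a).
apply: eq_bigr => l _; rewrite !mxE eqxx; congr (_ * _); rewrite /cofactor; congr (_ * \det _).
by apply/matrixP => x y; rewrite !mxE eq_sym (negbTE (neq_lift _ _)).
Qed.

(* Cramer's rule, with numerator and denominator made modular forms by the factor Delta / W *)
Definition cramer_coef B a F z := Delta z * \det (BM (replace_form B a F) z) / W z.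
Lemma cramer_coef_MF B nn a n F : (forall c, vform (nn c) (B c)) -> vform n F ->
  MF (n + \sum_(c | c != a) nn c - 8) (cramer_coef B a F).
Proof.
move=> hB hF; pose nn' c := if c == a then n else nn c.
have hU c : vform (nn' c) (replace_form B a F c) by rewrite /nn' /replace_form; case: eqP.
pose Phi c j := sval (cid ((hU c).1 j)).
have hP c j : qrep (lam j) (Phi c j) (compo (replace_form B a F c) j) by rewrite /Phi; case: cid.
have [hM _] := ratio_MF hP (fun c => (hU c).2).
move: hM; rewrite (bigD1 a) //= {1}/nn' eqxx.
rewrite (eq_bigr nn) // => c /negbTE ca; by rewrite /nn' ca.
Qed.
Lemma cramer_coef_sum B F z : (Delta z * \det (BM B z) / W z) *: F z = \sum_a cramer_coef B a F z *: B a z.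
Proof.
apply/colP => j; rewrite mxE summxE.
transitivity (Delta z / W z * (\det (BM B z) * F z j 0)); first by ring.
rewrite (cramer (BM B z) (fun j => F z j 0) j) mulr_sumr; apply: eq_bigr => a _.
by rewrite !mxE /cramer_coef BM_replace; ring.
Qed.

(** * The basis built from G *)

Section WithG.
Variable G : C -> 'cV[C]_4.
Hypotheses (hG : vform 0 G) (nzG : exists z, Hp z /\ G z != 0).
Hypothesis hlam : lam i != k1 / 12.

Let XG (a : 'I_4) := DH k1 a G.
Let XG_vform (a : 'I_4) : vform (2 * a)%:Z (XG a).
Proof. by have := vform_DH a hG; rewrite add0r addr0. Qed.
Let fG j := sval (cid (hG.1 j)).
Let fGq j : qrep (lam j) (fG j) (compo G j). Proof. by rewrite /fG; case: cid. Qed.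

(** The weight is 0 + 2 + 4 + 6 - 8 = 4, so the ratio is a multiple of E4, nonzero by
    [wronskian_nz]. Its value at the cusp contains each leading coefficient of G as a factor. *)
Lemma ratio_XG : exists c, [/\ c != 0, forall z, Hp z -> Delta z * \det (BM XG z) / W z = c * E4 z
  & forall j, fG j 0 != 0].
Proof.
have hP (a j : 'I_4) : qrep (lam j) (qDn (lam j) k1 a (fG j)) (compo (XG a) j).
  by rewrite compo_DH; exact: qrep_Dkn.
have [hM hq] := ratio_MF hP (fun a => (XG_vform a).2).
have e4' : \sum_(a < 4) (2 * a)%:Z - 8 = 4 :> int by rewrite !big_ord_recr big_ord0.
rewrite e4' in hM.
have [c hc] := MF_gen Pq (ltac:(by []) : 0 <= (4 : int) < 12) (E4_MF Pq) E4_qr e4_0 hM.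
have c0 : c != 0.
  apply/eqP => c0; have [z [hz]] := wronskian_nz hG nzG; rewrite addr0 => /eqP; apply.
  by apply: ratio_zero => //; rewrite hc // c0 mul0r.
exists c; split => // j.
have v0 : hfun 0 ^+ 24 * \det (\matrix_(a < 4, j < 4) qDn (lam j) k1 a (fG j) 0) / wq 0 = c.
  have := @qrep_uniq 0 _ (fun q => c * e4 q) _ hq; rewrite e4_0 mulr1; apply.
  by apply: (@qrep_ext _ _ (fun z => c * E4 z)); [move=> z hz; rewrite hc|apply: qrepZ; exact: E4_qr].
apply/eqP => f0; case/eqP: c0; rewrite -v0.
suff -> : \det (\matrix_(a < 4, j < 4) qDn (lam j) k1 a (fG j) 0) = 0 by rewrite mulr0 mul0r.
pose al t := rC (k1 + 2 * t%:R) * pq 0; apply/eqP; rewrite -det_tr; apply/eqP.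
have -> : (\matrix_(a < 4, j < 4) qDn (lam j) k1 a (fG j) 0)^T =
   \matrix_(j, a) ((\matrix_(j < 4, a < 4) (nwt al a).[rC (lam j)]) j a * fG j 0).
  by apply/matrixP => k a; rewrite !mxE qDn0 nwt_eval.
by rewrite det_scale_rows (bigD1 j) //= f0 !mul0r.
Qed.

Definition formbasis (a : 'I_4) : C -> 'cV[C]_4 := nth G [:: G; DH k1 1 G; F1; DH k1 2 G] a.
Definition formweight (a : 'I_4) : int := nth 0 [:: 0; 2; 2; 4] a.
Lemma formbasis_vform a : vform (formweight a) (formbasis a).
Proof.
rewrite /formbasis /formweight; case: a => [[|[|[|[|//]]]] ha] /=.
- exact: hG.
- exact: (XG_vform 1).
- exact: F1_vform.
- exact: (XG_vform 2).
Qed.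

(* If the determinant vanished, E4 F1 would be a combination of E6 G and E4 DG, hence E4 H = E6 G for
   a form H of weight k1 + 2, unless lam i = k1 / 12; then (E4^2 G - E6 H) / Delta would be a nonzero
   form of weight k1 - 4, and the ratio of its Wronskian a modular form of weight -12. *)
Lemma formbasis_det_neq0 : exists d, d != 0 /\ forall z, Hp z -> Delta z * \det (BM formbasis z) / W z = d.
Proof.
pose Phi a j := sval (cid ((formbasis_vform a).1 j)).
have hP a j : qrep (lam j) (Phi a j) (compo (formbasis a) j) by rewrite /Phi; case: cid.
have [hM _] := ratio_MF hP (fun a => (formbasis_vform a).2).
have e0 : \sum_a formweight a - 8 = 0 by rewrite !big_ord_recr big_ord0.
rewrite e0 in hM; have [d hd] := MF0_cst Pq hM; exists d; split => //; apply/eqP => d0.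
have det0 z : Hp z -> \det (BM formbasis z) = 0 by move=> hz; apply: ratio_zero => //; rewrite hd.
have [c [c0 hc fG0]] := ratio_XG.
(* Cramer's rule for F1 in terms of G, DG, D^2 G, D^3 G has coefficients of weights 6, 4, 2 and
   0. *)
have hcr a := cramer_coef_MF (n := 2) a XG_vform F1_vform.
have w0 : 2 + \sum_(k < 4 | k != 0%R) (2 * k)%:Z - 8 = 6 :> int by rewrite !big_mkcond !big_ord_recr big_ord0.
have w1 : 2 + \sum_(k < 4 | k != 1%R) (2 * k)%:Z - 8 = 4 :> int by rewrite !big_mkcond !big_ord_recr big_ord0.
have w2 : 2 + \sum_(k < 4 | k != 2%R) (2 * k)%:Z - 8 = 2 :> int by rewrite !big_mkcond !big_ord_recr big_ord0.
have c_0 := hcr 0; rewrite w0 in c_0; have c_1 := hcr 1; rewrite w1 in c_1; have c_2 := hcr 2; rewrite w2 in c_2.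
have [a ha] := MF_gen Pq (ltac:(by []) : 0 <= (6 : int) < 12) (E6_MF Pq) E6_qr e6_0 c_0.
have [b hb] := MF_gen Pq (ltac:(by []) : 0 <= (4 : int) < 12) (E4_MF Pq) E4_qr e4_0 c_1.
have h2 := MF2_zero Pq c_2.
(* The coefficient of D^3 G is the vanishing determinant with two rows exchanged. *)
have h3 z : Hp z -> cramer_coef XG 3 F1 z = 0.
  move=> hz; rewrite /cramer_coef; suff -> : \det (BM (replace_form XG 3 F1) z) = 0 by rewrite mulr0 mul0r.
  pose o2 := @Ordinal 4 2 isT; pose o3 := @Ordinal 4 3 isT.
  have -> : 3 = o3 :> 'I_4 by exact: val_inj.
  have -> : BM (replace_form XG o3 F1) z = xrow o2 o3 (BM formbasis z).
    apply/matrixP => x j; rewrite [LHS]mxE [RHS]mxE [RHS]mxE /replace_form.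
    case: tpermP => [->|->|x2 x3]; [by []|by rewrite eqxx|].
    move/eqP/negbTE: (x3) => ->; rewrite /XG /formbasis.
    case: x x2 x3 => [[|[|[|[|x]]]] hx] x2 x3; [by rewrite DH0|by []| | |by []].
      by case: x2; exact: val_inj.
    by case: x3; exact: val_inj.
  by rewrite xrowE det_mulmx det0 // mulr0.
have rel z : Hp z -> (c * E4 z) *: F1 z = (a * E6 z) *: G z + (b * E4 z) *: DH k1 1 G z.
  move=> hz; rewrite -hc // cramer_coef_sum !big_ord_recr big_ord0 /= add0r.
  have -> : widen_ord (leqnSn 3) (widen_ord (leqnSn 2) (widen_ord (leqnSn 1) ord_max)) = 0 :> 'I_4 by exact: val_inj.
  have -> : widen_ord (leqnSn 3) (widen_ord (leqnSn 2) ord_max) = 1 :> 'I_4 by exact: val_inj.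
  have -> : widen_ord (leqnSn 3) ord_max = 2 :> 'I_4 by exact: val_inj.
  have -> : ord_max = 3 :> 'I_4 by exact: val_inj.
  by rewrite h3 // h2 // !scale0r !addr0 ha // hb // /XG /= DH0.
(* If a = 0, leading coefficients in c F1 = b DG are compared: at i they give b (lam i - k1 / 12) =
   0, hence b = 0, and at another index then c = 0. *)
have [a0|a0] := eqVneq a 0.
  have cmp j : c * (if j == i then 0 else 1) = b * ((rC (lam j) + rC (k1 + 2 * 0%:R) * pq 0) * fG j 0).
    have [f [hf <-]] := F1_lam j.
    have q1 := qrepM (qrepZ c E4_qr) hf; have q2 := qrepM (qrepZ b E4_qr) (qrep_Dkn k1 1 (fGq j)).
    have := @qrep_uniq _ _ _ _ q1 (qrep_ext _ q2); rewrite e4_0 !mulr1 /= qD0; apply.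
    move=> z hz; have := congr1 (fun x : 'cV[C]_4 => x j 0) (rel z hz).
    by rewrite a0 mul0r scale0r add0r !mxE => <-.
  have b0 : b = 0.
    have /eqP := cmp i; rewrite eqxx mulr0 eq_sym !mulf_eq0 (negbTE (fG0 i)) orbF.
    case/orP => /eqP // h; case/eqP: hlam.
    move: h; rewrite mulr0 addr0 pq0 => h; apply: rC_inj.
    have -> : rC (k1 / 12) = rC k1 / 12%:R by rewrite rCM rCV rC_nat.
    by rewrite -[LHS](addrK (rC k1 * - 12%:R^-1)) h; ring.
  have [j ji] : exists j : 'I_4, j != i.
    have [e|e] := eqVneq i 0; first by exists 1; rewrite e.
    by exists 0; rewrite eq_sym.
  by have := cmp j; rewrite b0 mul0r (negbTE ji) mulr1 => /eqP; rewrite (negbTE c0).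
pose H z := a^-1 *: (c *: F1 z + (- b) *: DH k1 1 G z).
have hH : vform 2 H.
  apply: vformC; apply: vformD; apply: vformC; [exact: F1_vform|exact: (XG_vform 1)].
have relH z : Hp z -> E4 z *: H z = E6 z *: G z.
  move=> hz; apply/colP => j; have := congr1 (fun x : 'cV[C]_4 => x j 0) (rel z hz).
  rewrite /H; move: (F1 z) (G z) (DH k1 1 G z) (E4 z) (E6 z) => x y t e4 e6; rewrite !mxE => h.
  transitivity (a^-1 * (c * e4 * x j 0 - b * e4 * t j 0)); first by ring.
  by rewrite h addrK -mulrA mulKf.
(* Then E4 N = (E4^3 - E6^2) G = 1728 Delta G, so N vanishes at the cusp and is divisible by
   Delta. *)
pose N z := (E4 z * E4 z) *: G z + (- E6 z) *: H z.
have hN : vform 8 N.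
  apply: vformD; first by apply: (@vformZ 8 0) => //; apply: (@MFM 4 4); exact: E4_MF.
  apply: (@vformZ 6 2) => //; apply: MF_ext (MFZ (-1) (E6_MF Pq)) => z _; by rewrite mulN1r.
have EN z : Hp z -> E4 z *: N z = (1728%:R * Delta z) *: G z.
  move=> hz; apply/colP => j; have := congr1 (fun x : 'cV[C]_4 => x j 0) (relH z hz).
  rewrite -E4E6_Delta // /N; move: (H z) (G z) (E4 z) (E6 z) => x y e4 e6; rewrite !mxE => h.
  transitivity (e4 ^+ 3 * y j 0 - e6 * (e4 * x j 0)); first by ring.
  by rewrite h; ring.
pose fN j := sval (cid (hN.1 j)).
have fNq j : qrep (lam j) (fN j) (compo N j) by rewrite /fN; case: cid.
have fN0 j : fN j 0 = 0.
  have q1 := qrepM E4_qr (fNq j); have q2 := qrepM (qrepZ 1728%:R Delta_qr) (fGq j).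
  have := @qrep_uniq _ _ _ _ q1 (qrep_ext _ q2); rewrite e4_0 mul1r /Dq mul0r mulr0 mul0r; apply.
  by move=> z hz; have := congr1 (fun x : 'cV[C]_4 => x j 0) (EN z hz); rewrite /compo; move: (N z) => x; rewrite !mxE => <-.
have hG' := vform_divDelta fNq fN0 hN.2.
pose G' z := (Delta z)^-1 *: N z.
have [z [hz nz]] : exists z, Hp z /\ \det (BM (fun a => DH (k1 + (8 - 12)%:~R) a G') z) != 0.
  apply: wronskian_nz => //; have [z [hz nz]] := nzG; exists z; split => //; apply/eqP => e.
  have N0 : N z = 0.
    by have := congr1 (fun x => Delta z *: x) e; rewrite scalerA mulfV ?Delta_neq0 // scale1r scaler0.
  have := EN z hz; rewrite N0 scaler0 => /esym/eqP; rewrite scaler_eq0 (negbTE nz) orbF.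
  by apply/negP; apply: mulf_neq0; [rewrite pnatr_eq0|exact: Delta_neq0].
have hD (a' : 'I_4) := vform_DH a' hG'.
pose Ph a' j := sval (cid ((hD a').1 j)).
have hPh a' j : qrep (lam j) (Ph a' j) (compo (DH (k1 + (8 - 12)%:~R) a' G') j) by rewrite /Ph; case: cid.
have [hM' _] := ratio_MF hPh (fun a' => (hD a').2).
have e12 : \sum_(a' < 4) (8 - 12 + (2 * a')%:Z) - 8 = -12 :> int by rewrite !big_ord_recr big_ord0.
rewrite e12 in hM'; case/eqP: nz; apply: ratio_zero => //.
exact: (MF_neg _ hM').
Qed.

Lemma formbasis_coord n F : vform n F -> exists e : 'I_4 -> C -> C,
  (forall a, MF (n - formweight a) (e a)) /\ forall z, Hp z -> F z = \sum_a e a z *: formbasis a z.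
Proof.
move=> hF; have [d [d0 hd]] := formbasis_det_neq0.
exists (fun a z => d^-1 * cramer_coef formbasis a F z); split=> [a|z hz].
  apply: MFZ; have -> : n - formweight a = n + \sum_(c | c != a) formweight c - 8.
    have : \sum_c formweight c = 8 by rewrite !big_ord_recr big_ord0.
    by rewrite (bigD1 a) //= => <-; ring.
  exact: cramer_coef_MF formbasis_vform hF.
have := cramer_coef_sum formbasis F z; rewrite hd // => /(congr1 (fun x => d^-1 *: x)).
rewrite scalerA mulVf // scale1r => ->; rewrite scaler_sumr.
by apply: eq_bigr => a _; rewrite scalerA.
Qed.

(** Independence holds at each single point, since the determinant has no zeros in the
    half-plane. *)
Lemma formbasis_free z (c : 'I_4 -> C) : Hp z -> \sum_a c a *: formbasis a z = 0 -> forall a, c a = 0.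
Proof.
move=> hz h a; have [d [d0 hd]] := formbasis_det_neq0.
have uB : BM formbasis z \in unitmx.
  rewrite unitmxE unitfE; apply/eqP => e; case/eqP: d0.
  by rewrite -(hd z hz) e mulr0 mul0r.
have xB : (\row_a c a) *m BM formbasis z = 0.
  apply/rowP => j; have := congr1 (fun x : 'cV[C]_4 => x j 0) h.
  rewrite summxE [RHS]mxE => h'; rewrite [RHS]mxE -[RHS]h' mxE; apply: eq_bigr => l _.
  by rewrite !mxE.
have := congr1 (fun M : 'rV[C]_4 => M 0 a) (mulmxK uB (\row_a c a)).
by rewrite xB mul0mx !mxE => ->.
Qed.
End WithG.
End Irreducible.
End Forms.

Lemma MF_0 k : MF k (fun=> 0).
Proof.
apply/MFP; split; first by exists (fun=> 0); apply: qrI => //; exact: dhol_cst.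
by move=> g _ z _; rewrite mulr0.
Qed.
Lemma MF_sum (I : finType) k (f : I -> C -> C) : (forall i, MF k (f i)) -> MF k (fun z => \sum_i f i z).
Proof.
move=> h; elim: (index_enum I) => [|i s IH].
  by apply: MF_ext (MF_0 k) => z _; rewrite big_nil.
by apply: MF_ext (MFD (h i) IH) => z _; rewrite big_cons.
Qed.

(** * Dimensions *)
(** The dimension of the modular forms of weight 2 k: k is half the weight, and k = 1 modulo 6 is
    weight 2 modulo 12. *)
Definition dimM (k : nat) : nat := (k %/ 6 + (k %% 6 != 1))%N.
Lemma dimM_add6 k q: dimM (k + q * 6) = (dimM k + q)%N.
Proof. by rewrite /dimM; lia. Qed.
(** The generators have relative weights 0, 2, 2, 4. Both sides grow by 4 when k grows by 6, which
    leaves six residues to check. *)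
Lemma dimM_sum k : ((2 * k + 1) %/ 3 + 1)%N = (dimM k + (if k is k'.+1 then dimM k' else 0%N) +
  (if k is k'.+1 then dimM k' else 0%N) + (if k is k'.+2 then dimM k' else 0%N))%N.
Proof.
case: k => [|[|k]] //; rewrite (div.divn_eq k 6).
have := ltn_pmod k (isT : 0 < 6)%N; move: (k %/ 6)%N (k %% 6)%N => q s.
rewrite [(q * 6 + s)%N]addnC -!addSn !dimM_add6; have -> : ((2 * (s.+2 + q * 6) + 1) %/ 3 = (2 * s.+2 + 1) %/ 3 + 4 * q)%N by lia.
case: s => [|[|[|[|[|[|s]]]]]] // _; rewrite /dimM /=; lia.
Qed.

Definition mfdim (l : int) (d : nat) := exists f : 'I_d -> C -> C,
  [/\ forall i, MF l (f i),
      forall c : 'I_d -> C, (forall z, Hp z -> \sum_i c i * f i z = 0) -> forall i, c i = 0 &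
      forall g, MF l g -> exists c : 'I_d -> C, forall z, Hp z -> g z = \sum_i c i * f i z].

Lemma mfdim0 l : (forall f, MF l f -> forall z, Hp z -> f z = 0) -> mfdim l 0.
Proof.
move=> h; exists (fun _ _ => 0); split; [by case|by move=> c _ []|].
by move=> g hg; exists (fun=> 0) => z hz; rewrite big_ord0; exact: h hz.
Qed.

Section Dimensions.
Hypothesis Pq : quasi_P.

Lemma mfdim1 l E phi : 0 <= l < 12 -> MF l E -> qr phi E -> phi 0 = 1 -> mfdim l 1.
Proof.
move=> hl hE hp p0; exists (fun=> E); split=> // [c h i|g hg].
  have -> : i = ord0 by case: i => [[|//] ?]; exact: val_inj.
  have := @qrep_uniq 0 (fun q => c ord0 * phi q) (fun=> 0) (fun z => c ord0 * E z) (qrepZ _ hp).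
  rewrite p0 mulr1; apply; apply: qrI; first exact: dhol_cst.
  by move=> z hz; have := h z hz; rewrite big_ord1.
have [c hc] := MF_gen Pq hl hE hp p0 hg.
by exists (fun=> c) => z hz; rewrite big_ord1 hc.
Qed.

(** Subtracting a multiple of E makes a form vanish at the cusp; it is then Delta times a form of
    weight l. *)
Lemma mfdim_step l d E phi : MF (l + 12) E -> qr phi E -> phi 0 = 1 -> mfdim l d -> mfdim (l + 12) d.+1.
Proof.
move=> hE hp p0 [f [hf ind span]].
exists (fun i => if unlift ord0 i is Some j then fun z => Delta z * f j z else E); split.
- move=> i; case: (unlift ord0 i) => [j|//]; rewrite addrC.
  by apply: MFM => //; exact: Delta_MF Pq.
- move=> c h.
  have hS : MF l (fun z => \sum_(j < d) c (lift ord0 j) * f j z) by apply: MF_sum => j; apply: MFZ.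
  have hz z : Hp z -> c ord0 * E z + Delta z * (\sum_(j < d) c (lift ord0 j) * f j z) = 0.
    move=> hz; rewrite -[RHS](h z hz) big_ord_recl unlift_none mulr_sumr; congr (_ + _).
    by apply: eq_bigr => j _; rewrite liftK mulrCA.
  have [[s hs] _] := (MFP _ _).1 hS.
  have c0 : c ord0 = 0.
    have := @qrep_uniq _ _ (fun=> 0) _ (qrepD (qrepZ (c ord0) hp) (qrM Delta_qr hs)).
    rewrite p0 mulr1 /Dq mul0r mul0r addr0; apply.
    by apply: qrI; [exact: dhol_cst|exact: hz].
  have c1 j : c (lift ord0 j) = 0.
    apply: (ind (fun j => c (lift ord0 j))) => z hz'; have /eqP := hz z hz'; rewrite c0 mul0r add0r mulf_eq0.
    by rewrite (negbTE (Delta_neq0 hz')) => /eqP.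
  by move=> i; case: (unliftP ord0 i) => [j ->|->].
move=> g hg; have [[s hs] _] := (MFP _ _).1 hg.
have hg' : MF (l + 12) (fun z => g z - s 0 * E z) by apply: MFB => //; exact: MFZ.
have hq : qr (fun q => s q + - s 0 * phi q) (fun z => g z - s 0 * E z).
  apply: (@qrep_ext _ _ (fun z => g z + - s 0 * E z)); first by move=> w _; rewrite mulNr.
  by apply: qrepD => //; exact: qrepZ.
have [u hu e] := MF_divDelta Pq hg' hq (ltac:(by rewrite /= p0 mulr1 addrN)).
rewrite addrK in hu; have [c hc] := span u hu.
exists (fun i => if unlift ord0 i is Some j then c j else s 0) => z hz.
rewrite big_ord_recl unlift_none -[LHS](subrK (s 0 * E z)) e // hc // addrC; congr (_ + _).
by rewrite mulr_sumr; apply: eq_bigr => j _; rewrite liftK mulrCA.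
Qed.

(** Witnessed by E4^a E6^b. *)
Lemma MF_unit (a b : nat) :
  exists E phi, [/\ MF (2 * (2 * a + 3 * b))%N E, qr phi E & phi 0 = 1].
Proof.
elim: a => [|a [E [phi [hE hp p0]]]].
  elim: b => [|b [E [phi [hE hp p0]]]].
    by exists (fun=> 1), (fun=> 1); split=> //; [exact: MF_cst|apply: qrI => //; exact: dhol_cst].
  exists (fun z => E6 z * E z), (fun q => e6 q * phi q); split; last by rewrite e6_0 p0 mulr1.
    have -> : Posz (2 * (2 * 0 + 3 * b.+1))%N = (6 : int) + Posz (2 * (2 * 0 + 3 * b))%N by lia.
    by apply: MFM => //; exact: E6_MF Pq.
  by apply: qrM => //; exact: E6_qr.
exists (fun z => E4 z * E z), (fun q => e4 q * phi q); split; last by rewrite e4_0 p0 mulr1.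
  have -> : Posz (2 * (2 * a.+1 + 3 * b))%N = (4 : int) + Posz (2 * (2 * a + 3 * b))%N by lia.
  by apply: MFM => //; exact: E4_MF Pq.
by apply: qrM => //; exact: E4_qr.
Qed.

Lemma mfdim_even k : mfdim (2 * k)%N (dimM k).
Proof.
have unit j : j != 1%N -> exists E phi, [/\ MF (2 * j)%N E, qr phi E & phi 0 = 1].
  (* Every j other than 1 is 2 a + 3 b with b the parity of j. *)
  move=> j1; have -> : j = (2 * ((j - 3 * odd j) %/ 2) + 3 * odd j)%N; last exact: MF_unit.
  by have := odd_double_half j; case: (odd j) => /=; lia.
rewrite (div.divn_eq k 6) addnC; have := ltn_pmod k (isT : 0 < 6)%N.
elim: (k %/ 6)%N (k %% 6)%N => [|q IH] s s6.
  rewrite mul0n addn0 /dimM divn_small // modn_small //.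
  have [->|s1] := eqVneq s 1%N; first by apply: mfdim0 => f; exact: MF2_zero.
  have [E [phi [hE hp p0]]] := unit s s1; apply: mfdim1 hE hp p0.
  by apply/andP; split; lia.
have [E [phi [hE hp p0]]] := unit (s + q.+1 * 6)%N (ltac:(lia)).
have e : Posz (2 * (s + q.+1 * 6))%N = Posz (2 * (s + q * 6))%N + 12 by lia.
rewrite e in hE *; have -> : dimM (s + q.+1 * 6) = (dimM (s + q * 6)).+1 by rewrite /dimM; lia.
exact: mfdim_step hE hp p0 (IH s s6).
Qed.
End Dimensions.

(** The basis consists of the products of generators with scalar basis forms, indexed by pairs.
    Independence is used first over the generators at a fixed z, then in each scalar space. *)
Lemma has_dim_free n p (S : (C -> 'cV[C]_n) -> Prop) (w : 'I_p -> int) (B : 'I_p -> C -> 'cV[C]_n)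
    (d : 'I_p -> nat) : (forall a, mfdim (w a) (d a)) ->
  (forall a e, MF (w a) e -> S (fun z => e z *: B a z)) ->
  (forall F, S F -> exists e : 'I_p -> C -> C,
     (forall a, MF (w a) (e a)) /\ forall z, Hp z -> F z = \sum_a e a z *: B a z) ->
  (forall z (c : 'I_p -> C), Hp z -> \sum_a c a *: B a z = 0 -> forall a, c a = 0) ->
  has_dim S (\sum_a d a)%N.
Proof.
move=> hd hS span free.
pose f a := sval (cid (hd a)); have hf a := svalP (cid (hd a)); rewrite -/(f _) in hf.
pose T : finType := {a : 'I_p & 'I_(d a)}.
have <- : #|T| = (\sum_a d a)%N.
  rewrite card_tagged sumnE big_map big_enum; apply: eq_bigr => a _; exact: card_ord.
have sumT (V : nmodType) (F : forall a, 'I_(d a) -> V) :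
    \sum_(t < #|T|) F (tag (enum_val t)) (tagged (enum_val t)) = \sum_a \sum_(i < d a) F a i.
  rewrite (sig_big_dep (fun _ => true) (fun _ _ => true) F) /=.
  by rewrite -(big_enum_val (fun t : T => F (tag t) (tagged t))); exact: eq_bigl.
exists (fun t z => f (tag (enum_val t)) (tagged (enum_val t)) z *: B (tag (enum_val t)) z); split.
- by move=> t; apply: hS; have [h _ _] := hf (tag (enum_val t)); exact: h.
- move=> c hc.
  pose c' a (i : 'I_(d a)) := c (enum_rank (Tagged (fun a => 'I_(d a)) i)).
  have cE t : c t = c' (tag (enum_val t)) (tagged (enum_val t)).
    by rewrite /c' -[Tagged _ _](_ : enum_val t = _) ?enum_valK //; case: (enum_val t).
  have c0 a i : c' a i = 0.
    have [_ ind _] := hf a; apply: (ind (c' a)) => z hz.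
    apply: (free z (fun a => \sum_i c' a i * f a i z)) => //; rewrite -[RHS](hc z hz).
    under [RHS]eq_bigr do rewrite cE scalerA.
    rewrite (sumT _ (fun a i => (c' a i * f a i z) *: B a z)).
    by apply: eq_bigr => l _; rewrite scaler_suml.
  by move=> t; rewrite cE.
move=> F hF; have [e [he eF]] := span F hF.
have sp a : exists c : 'I_(d a) -> C, forall z, Hp z -> e a z = \sum_i c i * f a i z.
  by have [_ _ s] := hf a; exact: s.
pose c a := sval (cid (sp a)).
have hc a z : Hp z -> e a z = \sum_i c a i * f a i z by rewrite /c; case: cid => x; apply.
exists (fun t => c (tag (enum_val t)) (tagged (enum_val t))) => z hz.
under eq_bigr do rewrite scalerA.
rewrite (sumT _ (fun a i => (c a i * f a i z) *: B a z)) eF //.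
by apply: eq_bigr => a _; rewrite hc // scaler_suml.
Qed.

(** * Exponents modulo 1 and the conclusion *)

Lemma fracR_itv x : 0 <= fracR x < 1.
Proof. by rewrite /fracR subr_ge0 ltrBlDl floor_le /= -intrD1 floorD1_gt. Qed.
Lemma ee_fracR x : ee (rC (fracR x)) = ee (rC x).
Proof.
rewrite /fracR rCB eeD eeN [rC _%:~R](_ : _ = (Num.floor x)%:~R); last by rewrite /rC rmorph_int.
have -> : ee (Num.floor x)%:~R = 1 by have := ee_int (Num.floor x).
by rewrite invr1 mulr1.
Qed.
Lemma eigenvalue_diag n (d : 'rV[C]_n) a : eigenvalue (diag_mx d) a <-> exists j, a = d 0 j.
Proof.
split=> [/eigenvalueP[u hu u0]|[j ->]].
  have [j uj] : exists j, u 0 j != 0 by apply/rV0Pn.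
  exists j; have := congr1 (fun x : 'rV[C]_n => x 0 j) hu.
  by rewrite mul_mx_diag !mxE mulrC => /(mulIf uj).
apply/eigenvalueP; exists (delta_mx 0 j).
  apply/rowP => l; rewrite mul_mx_diag !mxE eqxx /= mulrC.
  by have [->//|_] := eqVneq l j; rewrite !mulr0.
by apply/rV0Pn; exists j; rewrite mxE !eqxx oner_eq0.
Qed.

Theorem theorem4p18
  (rho : 'M[int]_2 -> 'M[C]_4) (v : 'M[int]_2 -> C) (m : R)
  (r : 'I_4 -> R) (i : 'I_4)
  (M4 M6 M8 : C -> C) (F1 : C -> 'cV[C]_4) (b : 'I_4 -> nat -> C)
  (rho1 : 'M[int]_2 -> 'M[C]_4) (G : C -> 'cV[C]_4) :
  (* rho : T-determined, T-unitarizable representation *)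
  is_rep rho -> T_determined rho -> T_unitarizable rho ->
  (* eigenvalues of rho(T): e(r_1), ..., e(r_4), 0 <= r_1 < ... < r_4 < 1 *)
  (forall j, 0 <= r j < 1) -> (forall j j' : 'I_4, (j < j')%N -> r j < r j') ->
  (forall a, eigenvalue (rho Tm) a <-> exists j, a = ee (rC (r j))) ->
  (* v : multiplier system (of weight k1 = k0 + 1) with cusp parameter m *)
  let lam := fun j => fracR (r j + m / 12) in
  let lam0 := \sum_j lam j in
  let k0 := 3 * lam0 - 3 in
  let k1 := k0 + 1 in
  is_multiplier k1 v -> cusp_parameter v m ->
  lam i != k1 / 12 ->
  (* the MLDE L[f] = 0 in weight k0 + 3 with indicial roots lam_j + delta_ij *)
  let ex := fun j => lam j + (if j == i then 1 else 0) in
  MF 4 M4 -> MF 6 M6 -> MF 8 M8 ->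
  indicial4 (k0 + 3) M4 M6 M8 = \prod_j ('X - (rC (ex j))%:P) ->
  (* F1 = (f_1, ..., f_4)^t, fundamental system f_j = q^(ex j) (1 + sum b_j(n) q^n) *)
  (forall j z, Hp z -> mlde4 (k0 + 3) M4 M6 M8 (compo F1 j) z = 0) ->
  (forall j z, Hp z -> exists s : C,
     ((fun N : nat => (\sum_(1 <= n < N) b j n * ee (n%:R * z) : C^o)) @ \oo --> (s : C^o))
     /\ F1 z j 0 = ee (rC (ex j) * z) * (1 + s)) ->
  (* rho1 : the representation with F1 |_{k0+3} gamma = rho1(gamma) F1 *)
  is_rep rho1 ->
  (forall g, SL2 g -> forall z, Hp z -> slash (k0 + 3) v g F1 z = rho1 g *m F1 z) ->
  (* G : nonzero element of H(k1, rho1, v) *)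
  HH k1 rho1 v G -> (exists z, Hp z /\ G z != 0) ->
  free_M_basis (HHsum k1 rho1 v)
    (fun j : 'I_4 => nth G [:: G; Dvec k1 G; F1; Dvec (k1 + 2) (Dvec k1 G)] j) /\
  (forall k : nat, has_dim (HH (k1 + 2 * k%:R) rho1 v) ((2 * k + 1) %/ 3 + 1)%N).
Proof.
move=> hrho [hirr hT] _ r01 rlt hev lam lam0 k0 k1 [v1 hmul] [m12 vT] hlam ex hM4 hM6 hM8 hind hode hF1 hrep hslash hG nzG.
have kE : k0 + 3 = k1 + 2 by rewrite /k1; lra.
rewrite kE in hode hslash.
have kap3 : k1 + 2 = 3 * \sum_j lam j by rewrite -kE /k0 subrK.
have lam01 j : 0 <= lam j < 1 := fracR_itv _.
have rinj : injective r.
  move=> j l e; apply/eqP; case: (ltngtP j l) => [h|h|/val_inj -> //].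
    by have := rlt _ _ h; rewrite e ltxx.
  by have := rlt _ _ h; rewrite e ltxx.
have lamr j : ee (rC (lam j)) = v Tm * ee (rC (r j)).
  by rewrite /lam ee_fracR rCD eeD vT mulrC.
have hv g : SL2 g -> v g != 0.
  by move=> hg; apply/eqP => e; have := v1 g hg; rewrite e normr0 => /eqP; rewrite eq_sym oner_eq0.
have laminj : injective lam.
  move=> j l e; apply: rinj; apply: ee_rC_inj => //; apply: (mulfI (hv _ SL2_Tm)).
  by rewrite -!lamr e.
have Pq : quasi_P.
  by move=> g z; exact: (quasiP_MLDE lam01 laminj kap3 hM4 hM6 hM8 hode hF1 hrep hslash hv).
have p0 := phiF0 hF1; have pq_ := phiFq hF1.
have Wq := Wd_qrep (k1 + 2) hF1.
have W0 z (hz : Hp z) := Wd_neq0 lam01 laminj hode hF1 hz.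
have wq0 q (hq : cabs q < 1) := wq_neq0 lam01 laminj hode hF1 hq.
(* Dividing out v(T) = e(m / 12) turns the exponents [lam] back into the [r], so [rho1 Tm] has the
   eigenvalues of [rho Tm]. *)
have rho1T : rho1 Tm = diag_mx (\row_j ee (rC (r j))).
  apply: (scalerI (hv _ SL2_Tm)); rewrite (rho1_Tm p0 pq_ W0 hslash hv).
  by apply/matrixP => x y; rewrite !mxE lamr mulrnAr.
have hirr1 : irreducible_rep rho1.
  have hI := rho1_indecomposable lam01 laminj p0 pq_ Pq Wq W0 wq0 hrep hslash hv.
  apply: (hT _ hrep hI) => a; apply/idP/idP => [|/hev]; rewrite rho1T.
    by move/eigenvalue_diag => [j ->]; apply/hev; exists j; rewrite mxE.
  by move=> [j ->]; apply/eigenvalue_diag; exists j; rewrite mxE.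
have HV n H := HH_vform lam01 p0 pq_ W0 hslash hv n H.
have hG0 : vform v lam rho1 k1 0 G by apply/HV; rewrite addr0.
have bV := formbasis_vform p0 pq_ Pq hslash hv hG0.
have coord := formbasis_coord lam01 laminj p0 pq_ Pq Wq W0 wq0 hrep hslash hv hirr1 hG0 nzG hlam.
have free := formbasis_free lam01 laminj p0 pq_ Pq Wq W0 wq0 hrep hslash hv hirr1 hG0 nzG hlam.
split.
  have D1 : DH k1 1 G = Dvec k1 G by rewrite DHS DH0 mulr0 addr0.
  have D2 : DH k1 2 G = Dvec (k1 + 2) (Dvec k1 G) by rewrite DHS D1 mulr1.
  rewrite -D2 -D1 -[fun j : 'I_4 => _]/(formbasis F1 k1 G); split.
  - move=> a; exists 1%N, (fun=> formweight a), (fun=> formbasis F1 k1 G a).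
    by split=> [_|z hz]; [exact/HV|rewrite big_ord1].
  - move=> F [d [w [Fs [hFs hF]]]].
    have cF t : exists e : 'I_4 -> C -> C, (forall a, MF (w t - formweight a) (e a)) /\
        forall z, Hp z -> Fs t z = \sum_a e a z *: formbasis F1 k1 G a z.
      by apply: coord; apply/HV.
    pose e t := sval (cid (cF t)); have he t := svalP (cid (cF t)); rewrite -/(e _) in he.
    exists (fun a z => \sum_t e t a z); split=> [a|z hz].
      by exists d, (fun t => w t - formweight a), (fun t => e t a); split=> // t; have [h _] := he t.
    rewrite hF //; under eq_bigr => t _ do rewrite (he t).2 //.
    by rewrite exchange_big; apply: eq_bigr => a _; rewrite scaler_suml.
  - by move=> ms _ h a z hz; apply: (free z (fun a => ms a z)) => //; exact: h.
move=> k.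
have kk : k1 + 2 * k%:R = k1 + (2 * k)%N%:~R by rewrite -natrM.
(* Dimensions of the coefficient spaces of weights 2 k, 2 k - 2, 2 k - 2 and 2 k - 4; negative
   weights contribute 0. *)
pose d (a : 'I_4) : nat := nth 0%N [:: dimM k; if k is k'.+1 then dimM k' else 0%N;
  if k is k'.+1 then dimM k' else 0%N; if k is k'.+2 then dimM k' else 0%N] a.
have -> : ((2 * k + 1) %/ 3 + 1)%N = (\sum_a d a)%N.
  by rewrite dimM_sum !big_ord_recr big_ord0.
apply: (@has_dim_free _ _ _ (fun a => (2 * k)%N%:Z - formweight a) (formbasis F1 k1 G)).
- have neg l : l < 0 -> mfdim l 0 by move=> l0; apply: mfdim0 => f; exact: MF_neg.
  have even l (j : nat) : l = (2 * j)%N%:Z -> mfdim l (dimM j) by move=> ->; exact: mfdim_even.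
  have pred1 : mfdim ((2 * k)%N%:Z - 2) (if k is k'.+1 then dimM k' else 0%N).
    by case: (k) => [|k']; [exact: neg|apply: even; lia].
  case=> [[|[|[|[|//]]]] ha]; rewrite /d /formweight /=; [by apply: even; lia|exact: pred1|exact: pred1|].
  by case: (k) => [|[|k']]; [exact: neg|exact: neg|apply: even; lia].
- move=> a e he; rewrite kk; apply/HV.
  by have := vformZ he (bV a); rewrite subrK.
- by move=> F; rewrite kk => /HV hF; exact: coord.
- by move=> z c hz; exact: free.
Qed.
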